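(* Let $\alpha>-1$, $\gamma>-1$, $\beta<\alpha+1$ be real numbers, and consider the inequality $$\int_0^x(x^2-t^2)^\gamma\,t^{-\beta}J_\alpha(t)\,dt\ge0\qquad\text{for all } x>0.\qquad( * )$$ (i) If $( * )$ holds, then necessarily $$\beta\ge-\left(\gamma+\frac12\right)\quad\text{and}\quad-\alpha-1<\beta<\alpha+1.$$ (ii) For each $\gamma>-1$, let $\mathcal{S}_\gamma^*$ be the set of $(\alpha,\beta)\in\mathbb{R}^2$ defined by $$\mathcal{S}_\gamma^*=\left\{\alpha>-1,\ \ \max\left[-\left(\gamma+\frac12\right),\ -\frac{2\gamma+1}{2\gamma+3}(\alpha+1)\right]\le\beta<\alpha+1\right\}.$$ If $(\alpha,\beta)\in\mathcal{S}_\gamma^*$, then $( * )$ holds with strict positivity (i.e. the integral is $>0$ for all $x>0$) unless $$\alpha=\gamma+\frac12,\ \beta=-\left(\gamma+\frac12\right)\qquad\text{or}\qquad\gamma=-\frac12,\ \beta=0.$$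
   Context: $J_\alpha$ denotes the Bessel function of the first kind of order $\alpha$. *)

(* Defs.v *)
From mathcomp Require Import all_boot all_order all_algebra.
From mathcomp Require Import all_classical all_reals all_analysis.

Set Implicit Arguments.
Unset Strict Implicit.
Unset Printing Implicit Defensive.

Import Order.TTheory GRing.Theory Num.Theory.
Import numFieldNormedType.Exports.

Local Open Scope classical_set_scope.
Local Open Scope ring_scope.

(* Euler's integral: the Gamma function for 0 < s only. *)
Definition Gamma {R : realType} (s : R) : R :=
  \int[lebesgue_measure]_(t in `]0, +oo[) (t `^ (s - 1) * expR (- t)).

(* J_alpha(t) = \sum_k (-1)^k / (k! Gamma(k + alpha + 1)) (t/2)^(2k + alpha),
   meaningful for -1 < alpha (so that every argument of Gamma is positive) and
   0 < t (so that powR is the usual real power). *)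
Definition besselJ_coeff {R : realType} (alpha t : R) : R^nat :=
  [sequence (-1) ^+ k / (k`!%:R * Gamma (k%:R + alpha + 1))
            * (t / 2) `^ (k.*2%:R + alpha)]_k.

Definition besselJ {R : realType} (alpha t : R) : R :=
  limn (series (besselJ_coeff alpha t)).

(* The integrand is Lebesgue integrable on ]0, x[ whenever -1 < gamma and
   beta < alpha + 1, so the real-valued integral is not a default value. *)
Definition bessel_integral {R : realType} (alpha beta gamma x : R) : R :=
  \int[lebesgue_measure]_(t in `]0, x[)
    ((x ^+ 2 - t ^+ 2) `^ gamma * t `^ (- beta) * besselJ alpha t).

Definition Sstar {R : realType} (gamma : R) : set (R * R) :=
  [set p | let: (alpha, beta) := p in
    -1 < alpha /\
    Num.max (- (gamma + 1 / 2))
            (- ((2 * gamma + 1) / (2 * gamma + 3)) * (alpha + 1))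
      <= beta < alpha + 1].

(* Main.v *)
Require Import Defs.
From mathcomp Require Import all_boot all_order all_algebra.
From mathcomp Require Import all_classical all_reals all_analysis.
From mathcomp Require Import measurable_realfun.
From mathcomp Require Import ring lra zify.

(** The Bessel integral equals a positive multiple of f(x^2/4), where
      f(y) = 1F2(a;b,c;-y) = sum_k (a)_k (-y)^k / (k! (b)_k (c)_k),
      a = (alpha-beta+1)/2,  b = alpha+1,  c = a+gamma+1,
    because the moments of (x^2-t^2)^gamma t^s are quotients of rising
    factorials ([bessel_integral_sign]).  The theorem therefore concerns the
    sign of f on the positive axis, given 0 < a < c and 0 < b.

    Sufficiency ([hyp1F2_positive]).  The region is 3a+1/2 <= b+c together with
    a/2 <= (b-a)(c-a).  With d = (b+c-a-1/2)/2 there is an expansion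
      f(4z) = sum_n w_n z^n phi_n(z)^2
    into squares of Bessel series ([sqweight_expansion]), and the sign of w_n
    is that of the n-th Taylor coefficient of a product of two Gauss series
    2F1.  Either both series have nonnegative coefficients
    ([sqcoef_same_sign]), or a recurrence for the product propagates
    positivity ([sqcoef_opp_sign]).  For fixed z the functions phi_n tend to 1,
    so one positive weight of large index gives strict positivity; this fails
    only if all weights of positive index vanish, which happens in the two
    exceptional cases.

    Necessity, a < b ([hyp1F2_ge0_lt]).  The Laplace transform of y^(b-1) f is
    elementary, of order s^(a-b) as s tends to 0.  For nonnegative f it cannot
    decrease when s does.

    Necessity, 3a+1/2 <= b+c ([hyp1F2_ge0_sum]).  At infinity f is a
    nonoscillating term of order y^(-a) plus an oscillation in phase with
    cos(2 sqrt y); the condition says that the oscillation does not dominate.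
    The integral S(s) of e^(-s y) y^(-1/2) cos(2 sqrt y) f(y) is an explicit
    average of Gaussians ([cos_laplace]), whence S(s) has exact order s^rho with
    rho = (b+c-a-3/2)/2 ([coslap_upper], [coslap_lower]).  If f >= 0, then
    |S(s)| is at most the integral without the cosine, which has order s^e with
    e = a-1/2 when e < 0.  When e >= 0 that integral is not small, since S has
    a smooth part in s; but differences of S along s, s/4, s/16, ... that
    annihilate the powers 1, s, ..., s^(M-1) do have order s^e
    ([scale_diff_coslap_bound]).  If no natural number lies between rho and e, a
    sequence of size s^rho with small differences has order s^e
    ([scale_diff_regular]), which contradicts rho < e. *)

Set Implicit Arguments.
Unset Strict Implicit.
Unset Printing Implicit Defensive.

Import Order.TTheory GRing.Theory Num.Theory.
Import numFieldNormedType.Exports.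

Local Open Scope classical_set_scope.
Local Open Scope ring_scope.

(** * Convolutions and the recurrence for products of two Gauss series *)

Definition poch {R : realFieldType} (x : R) (n : nat) : R :=
  \prod_(i < n) (x + i%:R).

Lemma poch0 {R : realFieldType} (x : R) : poch x 0 = 1.
Proof. by rewrite /poch big_ord0. Qed.

Lemma pochS {R : realFieldType} (x : R) n : poch x n.+1 = poch x n * (x + n%:R).
Proof. by rewrite /poch big_ord_recr. Qed.

Lemma poch_gt0 {R : realFieldType} (x : R) n : 0 < x -> 0 < poch x n.
Proof. by move=> x0; apply: prodr_gt0 => i _; rewrite ltr_wpDr. Qed.

Lemma poch_add {R : realFieldType} (x : R) m n :
  poch x (m + n) = poch x m * poch (x + m%:R) n.
Proof.
elim: n => [|n IH]; first by rewrite addn0 poch0 mulr1.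
by rewrite addnS !pochS IH natrD -mulrA addrA.
Qed.

Definition conv {R : realFieldType} (u v : nat -> R) (n : nat) : R :=
  \sum_(k < n.+1) u k * v (n - k)%N.

(** Coefficients of z u'(z), where u n are those of u(z). *)
Definition theta {R : realFieldType} (u : nat -> R) : nat -> R :=
  fun n => n%:R * u n.

(** Coefficients of u'(z); the factor of [theta] without the shift by z. *)
Definition diff {R : realFieldType} (u : nat -> R) : nat -> R :=
  fun n => n.+1%:R * u n.+1.

Lemma convC {R : realFieldType} (u v : nat -> R) n : conv u v n = conv v u n.
Proof.
rewrite /conv (reindex_inj rev_ord_inj)/=; apply: eq_bigr => i _.
by rewrite subSS mulrC subKn// -ltnS.
Qed.

Lemma convDl {R : realFieldType} (u u' v : nat -> R) n :
  conv (fun k => u k + u' k) v n = conv u v n + conv u' v n.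
Proof. by rewrite -big_split/=; apply: eq_bigr => i _; rewrite mulrDl. Qed.

Lemma convZl {R : realFieldType} c (u v : nat -> R) n :
  conv (fun k => c * u k) v n = c * conv u v n.
Proof. by rewrite /conv mulr_sumr; apply: eq_bigr => i _; rewrite mulrA. Qed.

Lemma eq_convl {R : realFieldType} (u u' v : nat -> R) n :
  u =1 u' -> conv u v n = conv u' v n.
Proof. by move=> e; apply: eq_bigr => i _; rewrite e. Qed.

Lemma conv_theta {R : realFieldType} (u v : nat -> R) n :
  n%:R * conv u v n = conv (theta u) v n + conv u (theta v) n.
Proof.
rewrite /conv mulr_sumr -big_split/=; apply: eq_bigr => i _.
rewrite /theta; have -> : n%:R = i%:R + (n - i)%:R :> R.
  by rewrite -natrD subnKC// -ltnS.
by ring.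
Qed.

Lemma conv_thetaS {R : realFieldType} (u v : nat -> R) n :
  conv (theta u) v n.+1 = conv (diff u) v n.
Proof.
rewrite /conv big_ord_recl/= {1}/theta !mul0r add0r; apply: eq_bigr => i _.
by rewrite /theta /diff /bump/= add1n subSS.
Qed.

Lemma conv_theta0 {R : realFieldType} (u v : nat -> R) : conv (theta u) v 0 = 0.
Proof. by rewrite /conv big_ord1 /theta !mul0r. Qed.

Lemma conv_thetaSr {R : realFieldType} (u v : nat -> R) n :
  conv u (theta v) n.+1 = conv u (diff v) n.
Proof. by rewrite convC conv_thetaS convC. Qed.

Lemma conv_theta0r {R : realFieldType} (u v : nat -> R) : conv u (theta v) 0 = 0.
Proof. by rewrite convC conv_theta0. Qed.

(** Both sides are coefficients of z u'(z) v'(z). *)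
Lemma conv_diff_theta {R : realFieldType} (u v : nat -> R) n :
  conv (diff u) (theta v) n = conv (theta u) (diff v) n.
Proof.
by case: n => [|n]; rewrite ?conv_theta0 ?conv_theta0r// conv_thetaS conv_thetaSr.
Qed.

Lemma conv_diffS {R : realFieldType} (u v : nat -> R) n :
  conv (diff u) v n + conv u (diff v) n = n.+1%:R * conv u v n.+1.
Proof. by rewrite conv_theta conv_thetaS conv_thetaSr. Qed.

(** The differential equation of the Gauss series 2F1(p,q;d;z), read on coefficients. *)
Definition hyp_rec {R : realFieldType} (p q d : R) (u : nat -> R) :=
  forall n, (n%:R + d) * diff u n = (n%:R + p) * (n%:R + q) * u n.

Lemma hyp_rec_conv {R : realFieldType} (p q d : R) (u v : nat -> R) n :
  hyp_rec p q d u ->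
  (n%:R + d) * conv (diff u) v n =
    (n%:R + p + q) * conv (theta u) v n + p * q * conv u v n
    + conv (diff u) (theta v) n - conv (theta u) (theta v) n.
Proof.
move=> hu.
have e : conv (theta (diff u)) v n + d * conv (diff u) v n =
   conv (theta (theta u)) v n + (p + q) * conv (theta u) v n + p * q * conv u v n.
  rewrite -!convZl -!convDl; apply: eq_convl => k.
  by rewrite /theta; have := hu k; move: (diff u k) => D; lra.
have := conv_theta (theta u) v n; have := conv_theta (diff u) v n.
lra.
Qed.

(** Add the equation of u multiplied by v' and that of v multiplied by u':
    the mixed terms recombine by the Leibniz rule. *)
Lemma hyp_rec_conv2 {R : realFieldType} (p q r s d : R) (u v : nat -> R) n :
  hyp_rec p q d u -> hyp_rec r s d v ->
  (n%:R + 2 * d) * conv (diff u) (diff v) n =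
    p * q * conv u (diff v) n + r * s * conv (diff u) v n
    + (n%:R + 1 + p + q + r + s) * conv (theta u) (diff v) n.
Proof.
move=> hu hv.
have := hyp_rec_conv (diff v) n hu.
have := hyp_rec_conv (diff u) n hv.
rewrite !(convC (diff v)) !(convC (theta v)) !(convC v).
have e1 : conv (diff u) (theta (diff v)) n + conv (theta (diff u)) (diff v) n
          = n%:R * conv (diff u) (diff v) n.
  by rewrite conv_theta addrC.
have e3 := conv_diff_theta u v n.
have e4 : conv (theta (diff u)) (theta v) n + conv (theta u) (theta (diff v)) n
  = (n%:R - 1) * conv (theta u) (diff v) n.
  case: n {e1 e3} => [|n].
    by rewrite conv_theta0 conv_theta0r conv_theta0; ring.
  by rewrite conv_thetaSr !(conv_thetaS u) -conv_theta -natr1; ring.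
move: e1 e3 e4.
move: (conv (diff u) (diff v) n) (conv (theta u) (diff v) n)
  (conv (diff u) (theta v) n) (conv (theta u) (theta (diff v)) n)
  (conv (theta (diff u)) (theta v) n) (conv (diff u) (theta (diff v)) n)
  (conv (theta (diff u)) (diff v) n) => N NP NP' Z1 Z2 Z3 Z4 e1 e3 e4.
move: (conv u _ n) (conv _ v n) => Y X.
subst NP'.
lra.
Qed.

(** A product of two solutions of second-order equations satisfies a
    recurrence in which every convolution other than u v can be eliminated.
    The balance p+q+r+s = 2d is what makes the equations of u v' and u' v
    close up; the result is arranged so that each coefficient has a visible
    sign in the application. *)
Lemma conv_recurrence {R : realFieldType} (p q r s d : R) (u v : nat -> R) j
  (P := conv u v) (A := fun n => n.+1%:R * P n.+1 - n%:R * P n)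
  (delta := p + q - d) (kap := (p * q - r * s) / 2) (mu := (p * q + r * s) / 2) :
  p + q + r + s = 2 * d ->
  hyp_rec p q d u -> hyp_rec r s d v ->
  (j%:R + 2 * d) * (j%:R + d) *
    ((j.+1%:R + d) * A j.+1 - (j%:R + d) * A j - 2 * mu * (P j.+1 - P j)) =
  (delta * (j%:R + 2 * d) - 2 * kap) * (2 * kap + delta * j%:R) * P j
    + 2 * mu * (j%:R + d) * A j.
Proof.
move=> hs hu hv.
have EX n : (n%:R + d) * conv (diff u) v n =
    (n%:R + p + q) * conv (theta u) v n + p * q * P n
    + conv (diff u) (theta v) n - conv (theta u) (theta v) n := hyp_rec_conv v n hu.
have EY n : (n%:R + d) * conv u (diff v) n =
    (n%:R + r + s) * conv u (theta v) n + r * s * P n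
    + conv (theta u) (diff v) n - conv (theta u) (theta v) n.
  have := hyp_rec_conv u n hv.
  by rewrite (convC (diff v)) !(convC (theta v)) (convC (diff v)) (convC v).
have EN n := hyp_rec_conv2 n hu hv.
have EP n : conv (theta u) v n + conv u (theta v) n = n%:R * P n.
  by rewrite -conv_theta.
have ED n : conv (diff u) v n + conv u (diff v) n = n.+1%:R * P n.+1 := conv_diffS u v n.
have EN' n : (n%:R - 1 + 2 * d) * conv (theta u) (diff v) n =
    p * q * conv u (theta v) n + r * s * conv (theta u) v n
    + (n%:R + 2 * d) * conv (theta u) (theta v) n.
  case: n => [|n]; first by rewrite !conv_theta0 conv_theta0r; ring.
  rewrite !conv_thetaSr !conv_thetaS -natr1.
  have := EN n.
  have -> : n%:R + 1 + p + q + r + s = n%:R + 1 + 2 * d by rewrite -hs; ring.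
  by move=> <-; congr (_ * _); ring.
have EA n : (n%:R + d) * A n =
  delta * (conv (theta u) v n - conv u (theta v) n) + 2 * mu * P n
  + 2 * (conv (theta u) (diff v) n - conv (theta u) (theta v) n).
  have := EX n; have := EY n; rewrite conv_diff_theta /A -ED -EP /mu /delta.
  have -> : s = 2 * d - p - q - r by rewrite -hs; ring.
  lra.
have EW n : (n%:R + d) * (conv (diff u) v n - conv u (diff v) n - conv (theta u) v n + conv u (theta v) n) = (delta * n%:R + 2 * kap) * P n.
  have -> : (delta * n%:R + 2 * kap) * P n =
    delta * (n%:R * P n) + 2 * kap * P n by ring.
  rewrite -EP.
  have := EX n; have := EY n; rewrite conv_diff_theta /kap /delta.
  have -> : s = 2 * d - p - q - r by rewrite -hs; ring.
  lra.
have EM n : (n%:R + 2 * d) * (conv (diff u) (diff v) n - 2 * conv (theta u) (diff v) n + conv (theta u) (theta v) n) = mu * A n - kap * (conv (diff u) v n - conv u (diff v) n - conv (theta u) v n + conv u (theta v) n).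
  have := EN n; have := EN' n; rewrite /A -ED -EP /mu /kap.
  have -> : s = 2 * d - p - q - r by rewrite -hs; ring.
  lra.
(* A at j and j+1 differ by first-order convolutions, given by EW, and second-order ones, given by EM. *)
have := EA j.+1; have := EA j; have := EW j; have := EM j.
rewrite !conv_thetaSr !conv_thetaS.
move: (A j) (A j.+1) (P j) (P j.+1) (conv (diff u) (diff v) j)
 (conv (theta u) (diff v) j) (conv (theta u) (theta v) j)
 (conv (diff u) v j) (conv u (diff v) j) (conv (theta u) v j) (conv u (theta v) j).
move=> A0 A1 P0 P1 N NP NPP X Y x y.
set w := X - Y - x + y => hM hW h0 h1.
have -> : (j.+1%:R + d) * A1 - (j%:R + d) * A0 - 2 * mu * (P1 - P0) =
   delta * w + 2 * (N - 2 * NP + NPP) by rewrite h1 h0 /w; ring.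
have -> : (j%:R + 2 * d) * (j%:R + d) * (delta * w + 2 * (N - 2 * NP + NPP)) =
  delta * (j%:R + 2 * d) * ((j%:R + d) * w) +
  2 * (j%:R + d) * ((j%:R + 2 * d) * (N - 2 * NP + NPP)) by ring.
rewrite hM.
have -> : 2 * (j%:R + d) * (mu * A0 - kap * w) =
  2 * (j%:R + d) * mu * A0 - 2 * kap * ((j%:R + d) * w) by ring.
by rewrite hW; ring.
Qed.

(** * Positivity of the Taylor coefficients of the product *)

Definition hyp {R : realFieldType} (p q d : R) (n : nat) : R :=
  poch p n * poch q n / (n`!%:R * poch d n).

Lemma hyp0 {R : realFieldType} (p q d : R) : hyp p q d 0 = 1.
Proof. by rewrite /hyp !poch0 fact0 !mulr1 divr1. Qed.

Lemma hyp_recP {R : realFieldType} (p q d : R) : 0 < d -> hyp_rec p q d (hyp p q d).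
Proof.
move=> d0 n; rewrite /diff /hyp !pochS factS natrM.
have h1 : n`!%:R != 0 :> R by rewrite pnatr_eq0 -lt0n fact_gt0.
have h2 : poch d n != 0 by rewrite gt_eqF// poch_gt0.
have h3 : n%:R + d != 0 by rewrite gt_eqF// ltr_wpDl.
have h4 : n%:R + 1 != 0 :> R by rewrite natr1 pnatr_eq0.
by field; rewrite h1 h2 (addrC d) h3 (addrC 1) h4.
Qed.

Lemma pochSl {R : realFieldType} (x : R) n : poch x n.+1 = x * poch (x + 1) n.
Proof.
rewrite /poch big_ord_recl addr0; congr (_ * _); apply: eq_bigr => i _.
by rewrite /bump/= natrD addrA.
Qed.

Lemma poch_ge0 {R : realFieldType} (x : R) n : 0 <= x -> 0 <= poch x n.
Proof. by move=> x0; apply: prodr_ge0 => i _; rewrite addr_ge0. Qed.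

Lemma hyp_ge0 {R : realFieldType} (p q d : R) n :
  0 < d -> 0 <= p -> 0 <= q -> 0 <= hyp p q d n.
Proof.
move=> d0 p0 q0; rewrite /hyp divr_ge0 ?mulr_ge0 ?poch_ge0//; exact: ltW.
Qed.

Lemma hyp_gt0 {R : realFieldType} (p q d : R) n :
  0 < d -> 0 < p -> 0 < q -> 0 < hyp p q d n.
Proof.
by move=> d0 p0 q0; rewrite /hyp divr_gt0 ?mulr_gt0 ?poch_gt0 ?ltr0n ?fact_gt0.
Qed.

(** Only the first factor of each rising factorial can be negative, and these
    two factors occur as the product p q. *)
Lemma hyp_same_sign {R : realFieldType} (p q d : R) n :
  0 < d -> -1 < p -> -1 < q -> 0 <= p * q -> 0 <= hyp p q d n.
Proof.
move=> d0 p1 q1 pq; case: n => [|n]; first by rewrite hyp0.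
have -> : hyp p q d n.+1 = (p * q) * (poch (p + 1) n * poch (q + 1) n / (n.+1`!%:R * poch d n.+1)).
  by rewrite /hyp (pochSl p) (pochSl q); ring.
have p1' : 0 < p + 1 by lra.
have q1' : 0 < q + 1 by lra.
rewrite mulr_ge0// divr_ge0 ?mulr_ge0 ?poch_ge0//; exact: ltW.
Qed.

Lemma hyp_same_sign_gt0 {R : realFieldType} (p q d : R) n :
  0 < d -> -1 < p -> -1 < q -> 0 < p * q -> 0 < hyp p q d n.
Proof.
move=> d0 p1 q1 pq; case: n => [|n]; first by rewrite hyp0.
have -> : hyp p q d n.+1 = (p * q) * (poch (p + 1) n * poch (q + 1) n / (n.+1`!%:R * poch d n.+1)).
  by rewrite /hyp (pochSl p) (pochSl q); ring.
have p1' : 0 < p + 1 by lra.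
have q1' : 0 < q + 1 by lra.
by rewrite mulr_gt0// divr_gt0 ?mulr_gt0 ?poch_gt0 ?ltr0n ?fact_gt0.
Qed.

(** Coefficients of the product 2F1(d-p,d-q;d;z) 2F1(p+q-d-1/2,d+1/2;d;z). *)
Definition sqcoef {R : realFieldType} (p q d : R) : nat -> R :=
  conv (hyp (d - p) (d - q) d) (hyp (p + q - d - 1 / 2) (d + 1 / 2) d).

Lemma conv_ge0 {R : realFieldType} (u v : nat -> R) n :
  (forall k, 0 <= u k) -> (forall k, 0 <= v k) -> 0 <= conv u v n.
Proof. by move=> u0 v0; apply: sumr_ge0 => i _; rewrite mulr_ge0. Qed.

Lemma conv_ge_head {R : realFieldType} (u v : nat -> R) n :
  (forall k, 0 <= u k) -> (forall k, 0 <= v k) -> u 0%N * v n <= conv u v n.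
Proof.
move=> u0 v0; rewrite /conv big_ord_recl/= subn0 lerDl.
by apply: sumr_ge0 => i _; rewrite mulr_ge0.
Qed.

Lemma sqcoef0 {R : realFieldType} (p q d : R) : sqcoef p q d 0 = 1.
Proof. by rewrite /sqcoef /conv big_ord1 !hyp0 mulr1. Qed.

Lemma sqcoef1 {R : realFieldType} (p q d : R) : 0 < d ->
  d * sqcoef p q d 1 = p * q - (2 * d + 1 / 2 - p - q) / 2.
Proof.
move=> d0; rewrite /sqcoef /conv big_ord_recl big_ord1/= subn0 subnn !hyp0.
rewrite /hyp !pochS !poch0 factS fact0 muln1.
by field; rewrite gt_eqF.
Qed.

(** Both Gauss series have nonnegative coefficients here, and they are both
    constant exactly in the excluded cases. *)
Lemma sqcoef_same_sign {R : realFieldType} (p q d : R) :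
  0 < d -> d <= p + q - 1 / 2 -> p + q - 1 / 2 < 2 * d ->
  0 <= (d - p) * (d - q) ->
  (forall n, 0 <= sqcoef p q d n) /\
  (~ (d = p + q - 1 / 2 /\ (d = p \/ d = q)) ->
    forall n, 0 < sqcoef p q d n).
Proof.
move=> d0 h1 h2 h3.
have [p1 q1] : -1 < d - p /\ -1 < d - q by split; nra.
have u0 k := hyp_same_sign k d0 p1 q1 h3.
have v0 k : 0 <= hyp (p + q - d - 1 / 2) (d + 1 / 2) d k by apply: hyp_ge0 => //; lra.
split=> [n|hex n]; first exact: conv_ge0.
have [e|ne] := eqVneq d (p + q - 1 / 2).
  rewrite /sqcoef convC; apply: (lt_le_trans _ (conv_ge_head n v0 u0)).
  rewrite hyp0 mul1r hyp_same_sign_gt0// lt_neqAle h3 andbT eq_sym mulf_neq0//.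
    by apply/eqP => /subr0_eq ep; apply: hex; split=> //; left.
  by apply/eqP => /subr0_eq ep; apply: hex; split=> //; right.
apply: (lt_le_trans _ (conv_ge_head n u0 v0)).
rewrite hyp0 mul1r hyp_gt0//; last by lra.
have : d < p + q - 1 / 2 by rewrite lt_neqAle ne.
by lra.
Qed.

Lemma sqcoef_recurrence {R : realFieldType} (p q d : R) j
  (P := sqcoef p q d) (A := fun n => n.+1%:R * P n.+1 - n%:R * P n)
  (a := 2 * d + 1 / 2 - p - q) (delta := p + q - d)
  (kap := (p * q + a / 2) / 2) (mu := (p * q - a / 2) / 2) :
  0 < d ->
  (j%:R + 2 * d) * (j%:R + d) *
    ((j.+1%:R + d) * A j.+1 - (j%:R + d) * A j - 2 * mu * (P j.+1 - P j)) =
  (delta * (j%:R + 2 * d) - 2 * kap) * (2 * kap + delta * j%:R) * P j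
    + 2 * mu * (j%:R + d) * A j.
Proof.
move=> d0.
have hs : (d - p) + (d - q) + (p + q - d - 1 / 2) + (d + 1 / 2) = 2 * d by ring.
have := conv_recurrence j hs (hyp_recP _ _ d0) (hyp_recP _ _ d0).
rewrite -/(sqcoef p q d) -/P /=.
have -> : ((d - p) * (d - q) + (p + q - d - 1 / 2) * (d + 1 / 2)) / 2 = mu.
  by rewrite /mu /a; field.
have -> : ((d - p) * (d - q) - (p + q - d - 1 / 2) * (d + 1 / 2)) / 2 = kap - delta * d.
  by rewrite /kap /delta /a; field.
have -> : d - p + (d - q) - d = - delta by rewrite /delta; ring.
by move=> ->; rewrite /A; ring.
Qed.

(** One Gauss series alternates, so the sign is not visible termwise.  The
    recurrence is a monotonicity statement instead: it makes
    (n+d) A_n - 2 mu P_n nondecreasing in n, starting from 0, as long as the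
    earlier P and A are nonnegative. *)
Lemma sqcoef_opp_sign {R : realFieldType} (p q d : R) :
  0 < p -> 0 < q ->
  0 < d -> d <= p + q - 1 / 2 -> p + q - 1 / 2 < 2 * d ->
  (2 * d + 1 / 2 - p - q) / 2 <= p * q ->
  (d - p) * (d - q) < 0 ->
  (forall n, 0 <= sqcoef p q d n) /\ (forall n, 0 < sqcoef p q d n.+2).
Proof.
move=> p0 q0 d0 h1 h2 hpq h3.
pose P := sqcoef p q d.
pose A n := n.+1%:R * P n.+1 - n%:R * P n.
pose a := 2 * d + 1 / 2 - p - q.
pose delta := p + q - d.
pose kap := (p * q + a / 2) / 2.
pose mu := (p * q - a / 2) / 2.
have a0 : 0 < a by rewrite /a; lra.
have mu0 : 0 <= mu by rewrite /mu; move: hpq; rewrite -/a; lra.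
have kap0 : 0 < kap by rewrite /kap; nra.
have delta0 : 0 < delta by rewrite /delta; lra.
(* 2 (kap - delta d) is (d-p)(d-q), negative, minus a nonnegative product. *)
have dk : kap < delta * d by rewrite /kap /delta /a; nra.
have rec j : (j%:R + 2 * d) * (j%:R + d) *
    ((j.+1%:R + d) * A j.+1 - (j%:R + d) * A j - 2 * mu * (P j.+1 - P j)) =
  (delta * (j%:R + 2 * d) - 2 * kap) * (2 * kap + delta * j%:R) * P j
    + 2 * mu * (j%:R + d) * A j := sqcoef_recurrence p q j d0.
(* The quantity made monotone by the recurrence; A and then P inherit its sign. *)
pose Q n := (n%:R + d) * A n - 2 * mu * P n.
have jd (j : nat) : 0 < j%:R + d by rewrite ltr_wpDl.
have jd2 (j : nat) : 0 < j%:R + 2 * d by rewrite ltr_wpDl// mulr_gt0.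
have P0 : P 0%N = 1 by exact: sqcoef0.
have Q0 : Q 0%N = 0.
  by rewrite /Q /A P0 mul0r subr0 mul1r add0r sqcoef1// /mu /a; field.
have AQ n : A n = (Q n + 2 * mu * P n) / (n%:R + d).
  by rewrite /Q; field; rewrite gt_eqF// jd.
have PA n : P n.+1 = (A n + n%:R * P n) / n.+1%:R.
  by rewrite /A; field; rewrite nat1r pnatr_eq0.
have QS n : Q n.+1 = Q n + ((delta * (n%:R + 2 * d) - 2 * kap) * (2 * kap + delta * n%:R) * P n
    + 2 * mu * (n%:R + d) * A n) / ((n%:R + 2 * d) * (n%:R + d)).
  by rewrite -rec /Q; field; rewrite !gt_eqF ?jd ?jd2.
clearbody mu kap delta.
have coef (n : nat) : 0 < delta * (n%:R + 2 * d) - 2 * kap.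
  have := mulr_ge0 (ltW delta0) (ler0n R n); lra.
have coef2 (n : nat) : 0 < 2 * kap + delta * n%:R.
  have := mulr_ge0 (ltW delta0) (ler0n R n); lra.
have main n : [/\ 0 <= P n, 0 <= Q n & ((0 < n)%N -> 0 < Q n)].
  elim: n => [|n [Pn Qn Qn']]; first by rewrite P0 Q0.
  have An : 0 <= A n.
    rewrite AQ divr_ge0 ?(ltW (jd n))// addr_ge0// !mulr_ge0//.
  have Qinc : Q n <= Q n.+1.
    rewrite QS lerDl divr_ge0 ?addr_ge0 ?mulr_ge0 ?(ltW (coef _)) ?(ltW (coef2 _)) ?(ltW (jd _)) ?(ltW (jd2 _))//.
  split.
  - by rewrite PA divr_ge0// addr_ge0// mulr_ge0.
  - exact: le_trans Qinc.
  - move=> _; case: n Pn Qn Qn' An Qinc => [|n] Pn Qn Qn' An Qinc.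
      rewrite QS Q0 add0r divr_gt0 ?mulr_gt0//.
      by rewrite ltr_pwDl ?mulr_gt0 ?P0 ?mulr_ge0 ?(ltW (coef _)) ?(ltW (coef2 _)) ?(ltW (jd _)) ?(ltW (jd2 _))//.
    exact: lt_le_trans (Qn' _) Qinc.
split=> n; first by have [] := main n.
have [Pn _ Qn] := main n.+1.
rewrite -/P PA divr_gt0// ltr_pwDl ?mulr_ge0//.
rewrite AQ divr_gt0// ltr_pwDl ?mulr_ge0// ?mulr_ge0//.
exact: Qn.
Qed.

(** * The sum-of-squares expansion, coefficient by coefficient *)

Lemma poch_neq0 {R : realFieldType} (x : R) n : 0 < x -> poch x n != 0.
Proof. by move=> x0; rewrite gt_eqF// poch_gt0. Qed.

Lemma fact_neq0 {R : realFieldType} n : n`!%:R != 0 :> R.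
Proof. by rewrite pnatr_eq0 -lt0n fact_gt0. Qed.

(** The binomial coefficient with arbitrary upper entry. *)
Definition gbinom {R : realFieldType} (X : R) (k : nat) : R :=
  (\prod_(i < k) (X - i%:R)) / k`!%:R.

Lemma diff_gbinom {R : realFieldType} (X : R) n :
  diff (gbinom X) n = (X - n%:R) * gbinom X n.
Proof.
rewrite /diff /gbinom big_ord_recr/= factS natrM.
have h1 := @fact_neq0 R n.
by field; rewrite h1 nat1r pnatr_eq0.
Qed.

(** Vandermonde's identity, by induction through the Leibniz rule. *)
Lemma conv_gbinom {R : realFieldType} (X Y : R) n :
  conv (gbinom X) (gbinom Y) n = gbinom (X + Y) n.
Proof.
elim: n => [|n IH].
  by rewrite /conv big_ord1 /gbinom !big_ord0 fact0 !divr1 mulr1.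
have n0 : n.+1%:R != 0 :> R by rewrite pnatr_eq0.
apply: (mulfI n0); rewrite -conv_diffS.
have -> : n.+1%:R * gbinom (X + Y) n.+1 = diff (gbinom (X + Y)) n by [].
rewrite diff_gbinom -IH.
rewrite (eq_convl (u := diff (gbinom X)) _ _ (u' := fun k => X * gbinom X k + (- 1) * theta (gbinom X) k)); last first.
  by move=> k; rewrite diff_gbinom /theta; ring.
rewrite (convC (gbinom X) (diff _)).
rewrite (eq_convl (u := diff (gbinom Y)) _ _ (u' := fun k => Y * gbinom Y k + (- 1) * theta (gbinom Y) k)); last first.
  by move=> k; rewrite diff_gbinom /theta; ring.
rewrite !convDl !convZl !(convC _ (gbinom X)).
have := conv_theta (gbinom X) (gbinom Y) n.
lra.
Qed.

Lemma poch_falling {R : realFieldType} (X : R) k :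
  \prod_(i < k) (X - i%:R) = poch (X - k%:R + 1) k.
Proof.
rewrite /poch (reindex_inj rev_ord_inj)/=; apply: eq_bigr => i _.
by rewrite natrB//; rewrite -natr1; ring.
Qed.

(** The coefficients of the square of a Bessel series: Vandermonde's identity
    with both upper entries equal to x+k-1. *)
Lemma conv_inv_poch {R : realFieldType} (x : R) k : 0 < x ->
  conv (fun i => (i`!%:R * poch x i)^-1) (fun i => (i`!%:R * poch x i)^-1) k =
  poch (2 * x - 1 + k%:R) k / (k`!%:R * poch x k ^+ 2).
Proof.
move=> x0.
have -> : poch (2 * x - 1 + k%:R) k / (k`!%:R * poch x k ^+ 2) =
  gbinom ((x + k%:R - 1) + (x + k%:R - 1)) k / poch x k ^+ 2.
  rewrite /gbinom poch_falling.
  have -> : x + k%:R - 1 + (x + k%:R - 1) - k%:R + 1 = 2 * x - 1 + k%:R by ring.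
  by rewrite invfM mulrA.
rewrite -conv_gbinom /conv mulr_suml; apply: eq_bigr => i _.
have ik : (i <= k)%N by rewrite -ltnS.
rewrite /gbinom !poch_falling.
have -> : x + k%:R - 1 - i%:R + 1 = x + (k - i)%:R by rewrite natrB//; ring.
have -> : x + k%:R - 1 - (k - i)%:R + 1 = x + i%:R by rewrite natrB//; ring.
have e1 := poch_add x i (k - i); have e2 := poch_add x (k - i) i.
rewrite subnKC// in e1; rewrite subnK// in e2.
have p1 := poch_neq0 i x0; have p2 := poch_neq0 (k - i) x0.
have xi : 0 < x + i%:R by rewrite ltr_pwDl.
have xki : 0 < x + (k - i)%:R by rewrite ltr_pwDl.
have p3 := poch_neq0 (k - i) xi; have p4 := poch_neq0 i xki.
rewrite expr2 {1}e1 e2.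
have h1 := @fact_neq0 R i; have h2 := @fact_neq0 R (k - i).
by field; rewrite h1 h2 p1 p2 p3 p4.
Qed.

Lemma poch_double {R : realFieldType} (d : R) m :
  poch (2 * d) (m + m) = 4 ^+ m * poch d m * poch (d + 1 / 2) m.
Proof.
elim: m => [|m IH]; first by rewrite !poch0 expr0 !mulr1.
by rewrite addnS addSn !pochS IH -natr1 natrD exprS; field.
Qed.

(** The part of the coefficient of z^m in the n-th square that depends on m;
    it is extended by 0 so that sums over n may overshoot m. *)
Definition sqker {R : realFieldType} (b c d : R) (m n : nat) : R :=
  if (n <= m)%N then (- 1) ^+ n * poch d n /
    (poch b n * poch c n * (m - n)`!%:R * poch (2 * d) (m + n)) else 0.

(** This is (2n+2d-1) (2d)_(n-1) for n > 0; the present form needs no separate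
    value at n = 0. *)
Definition sqlam {R : realFieldType} (d : R) (n : nat) : R :=
  poch (2 * d) n + n%:R * poch (2 * d) n.-1.

Lemma sqker_succ_l {R : realFieldType} (b c d : R) m n :
  0 < b -> 0 < c -> 0 < d -> (n <= m.+1)%N ->
  sqker b c d m n = (m%:R + 1 - n%:R) * (2 * d + m%:R + n%:R) * sqker b c d m.+1 n.
Proof.
move=> b0 c0 d0 nm; rewrite /sqker nm.
case: (leqP n m) => h; last first.
  have -> : n = m.+1 by apply/eqP; rewrite eqn_leq nm h.
  by rewrite natr1 subrr !mul0r.
rewrite subSn// factS natrM addSn pochS.
have -> : (m - n).+1%:R = m%:R + 1 - n%:R :> R by rewrite -natr1 natrB//; ring.
have d20 : 0 < 2 * d by rewrite mulr_gt0.
have p1 := poch_neq0 n b0; have p2 := poch_neq0 n c0; have p3 := poch_neq0 (m + n) d20.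
have h1 := @fact_neq0 R (m - n).
have h2 : m%:R + 1 - n%:R != 0 :> R.
  by rewrite gt_eqF// natr1 subr_gt0 ltr_nat ltnS.
have h3 : 2 * d + (m%:R + n%:R) != 0 by rewrite gt_eqF// -natrD ltr_pwDl.
by rewrite natrD; field; rewrite p1 p2 p3 h1 h2/= addrA in h3 *; rewrite h3.
Qed.

Lemma sqker_succ_r {R : realFieldType} (b c d : R) m n :
  0 < b -> 0 < c -> 0 < d -> (n <= m)%N ->
  sqker b c d m n.+1 =
   - ((d + n%:R) * (m%:R - n%:R) / ((b + n%:R) * (c + n%:R) * (2 * d + m%:R + n%:R))) * sqker b c d m n.
Proof.
move=> b0 c0 d0 nm; rewrite /sqker nm.
case: ltnP => h; last first.
  have -> : n = m by apply/eqP; rewrite eqn_leq nm h.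
  by rewrite subrr mulr0 mul0r oppr0 mul0r.
rewrite addnS !pochS exprS.
have -> : (m - n)%N = (m - n.+1).+1 by rewrite subnSK.
rewrite factS natrM.
have -> : (m - n.+1).+1%:R = m%:R - n%:R :> R by rewrite subnSK// natrB// ltnW.
have d20 : 0 < 2 * d by rewrite mulr_gt0.
have p1 := poch_neq0 n b0; have p2 := poch_neq0 n c0; have p3 := poch_neq0 (m + n) d20.
have h1 := @fact_neq0 R (m - n.+1).
have h2 : m%:R - n%:R != 0 :> R by rewrite gt_eqF// subr_gt0 ltr_nat.
have h3 : 2 * d + m%:R + n%:R != 0 by rewrite -addrA gt_eqF// -natrD ltr_pwDl.
have h4 : b + n%:R != 0 by rewrite gt_eqF// ltr_pwDl.
have h5 : c + n%:R != 0 by rewrite gt_eqF// ltr_pwDl.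
by rewrite natrD addrA; field; rewrite p1 p2 p3 h1 h2 h3 h4 h5.
Qed.

(** Middle and lower coefficients of the recurrence as a three-term one. *)
Definition rec_mid {R : realFieldType} (p q d j : R) : R :=
  let a := 2 * d + 1 / 2 - p - q in
  let mu := (p * q - a / 2) / 2 in
  - (j + 1 + d) * (j + 1) - ((j + d) + 2 * mu / (j + 2 * d)) * (j + 1) - 2 * mu.

Definition rec_low {R : realFieldType} (p q d j : R) : R :=
  let a := 2 * d + 1 / 2 - p - q in
  let delta := p + q - d in
  let kap := (p * q + a / 2) / 2 in
  let mu := (p * q - a / 2) / 2 in
  ((j + d) + 2 * mu / (j + 2 * d)) * j
  - (delta - 2 * kap / (j + 2 * d)) * (2 * kap + delta * j) / (j + d) + 2 * mu.

Lemma sqcoef_rec3 {R : realFieldType} (p q d : R) j : 0 < d ->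
  (j%:R + 1 + d) * (j%:R + 2) * sqcoef p q d j.+2
  + rec_mid p q d j%:R * sqcoef p q d j.+1 + rec_low p q d j%:R * sqcoef p q d j = 0.
Proof.
move=> d0.
have := sqcoef_recurrence p q j d0; rewrite /rec_mid /rec_low /=.
have h1 : j%:R + d != 0 by rewrite gt_eqF// ltr_wpDl.
have h2 : j%:R + 2 * d != 0 by rewrite gt_eqF// ltr_wpDl// mulr_gt0.
move: (sqcoef p q d j) (sqcoef p q d j.+1) (sqcoef p q d j.+2) => P0 P1 P2.
move=> /eqP; rewrite -subr_eq0 => /eqP e.
apply: (mulfI (mulf_neq0 h2 h1)); rewrite mulr0 -{}[RHS]e -!natr1.
by field; rewrite h1 h2.
Qed.

(** The rational identity behind [sqker_sum_rec]: r1 and r2 are the ratios of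
    consecutive values of [sqker]. *)
Lemma sqker_step {R : realFieldType} (N m b c d : R)
  (q := 2 * d + 1 / 2 - b) (p := 2 * d + 1 / 2 - c) (a := b + c - 2 * d - 1 / 2)
  (r1 := - ((d + N) * (m + 1 - N) / ((b + N) * (c + N) * (2 * d + (m + 1) + N))))
  (r2 := - ((d + (N + 1)) * (m + 1 - (N + 1)) / ((b + (N + 1)) * (c + (N + 1)) * (2 * d + (m + 1) + (N + 1))))) :
  N + d != 0 -> N + 2 * d != 0 -> N + 1 + d != 0 -> N + 1 + 2 * d != 0 ->
  b + N != 0 -> c + N != 0 -> b + (N + 1) != 0 -> c + (N + 1) != 0 ->
  2 * d + (m + 1) + N != 0 -> 2 * d + (m + 1) + (N + 1) != 0 ->
  ((m + 1) * (d + m) * (b + m) * (c + m)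
    - (d + 1 / 2 + m) * (a + m) * ((m - N) * (2 * d + m + N + 1))) * (r1 * (2 * d + N + (N + 1))) =
  - (1 / 2) * ((m + 1 - N) * (2 * d + m + N)) * ((N + d) * (N + 1))
  - (1 / 2) * ((m - N) * (2 * d + m + N + 1)) * r1 * (2 * d + N) * rec_mid p q d N
  - (1 / 2) * ((m - 1 - N) * (2 * d + m + N + 2)) * r1 * r2 * (2 * d + N) * (2 * d + N + 1) * rec_low p q d (N + 1).
Proof.
rewrite /r1 /r2 /rec_mid /rec_low /p /q /a.
move=> h1 h2 h3 h4 h5 h6 h7 h8 h9 h10.
by field; rewrite ?h1 ?h2 ?h3 ?h4 ?h5 ?h6 ?h7 ?h8 ?h9 ?h10.
Qed.

Lemma sqlam0 {R : realFieldType} (d : R) : sqlam d 0 = 1.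
Proof. by rewrite /sqlam poch0 mul0r addr0. Qed.

Lemma sqlamS {R : realFieldType} (d : R) n :
  sqlam d n.+1 = poch (2 * d) n * (2 * d + n%:R + (n%:R + 1)).
Proof. by rewrite /sqlam pochS -natr1/=; ring. Qed.

(** Creative telescoping: the difference of the two sides is a sum over n of
    multiples of sqcoef n, and these multiples are combinations of shifts of
    one sequence xi with the coefficients of the three-term recurrence, so the
    sum telescopes. *)
Lemma sqker_sum_rec {R : realFieldType} (b c d : R) m
  (p := 2 * d + 1 / 2 - c) (q := 2 * d + 1 / 2 - b) (a := b + c - 2 * d - 1 / 2)
  (Z := fun m => \sum_(n < m.+1) sqker b c d m n * sqlam d n * sqcoef p q d n) :
  0 < b -> 0 < c -> 0 < d ->
  (m%:R + 1) * (d + m%:R) * (b + m%:R) * (c + m%:R) * Z m.+1 =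
  (d + 1 / 2 + m%:R) * (a + m%:R) * Z m.
Proof.
move=> b0 c0 d0.
pose P := sqcoef p q d.
pose H := sqker b c d m.+1.
pose g := poch (2 * d).
pose br n := ((m%:R + 1) * (d + m%:R) * (b + m%:R) * (c + m%:R) * H n
   - (d + 1 / 2 + m%:R) * (a + m%:R) * sqker b c d m n) * sqlam d n.
(* The telescoping multiplier: a solution of the adjoint of the three-term recurrence. *)
pose xi n := - (1 / 2) * ((m%:R + 1 - n%:R) * (2 * d + m%:R + n%:R)) * H n * g n.
pose V n := xi n.+1 * rec_low p q d n%:R * P n - xi n * ((n%:R + d) * (n%:R + 1)) * P n.+1.
have nat0 x (n : nat) : 0 < x -> x + n%:R != 0 :> R.
  by move=> x0; rewrite gt_eqF// ltr_pwDl.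
have nat0' x (n : nat) : 0 < x -> n%:R + x != 0 :> R.
  by move=> x0; rewrite addrC nat0.
have d20 : 0 < 2 * d by rewrite mulr_gt0.
(* At M = m+1 both terms of V vanish, which ends the telescoping. *)
have tel M : (M <= m.+1)%N -> \sum_(n < M.+1) br n * P n = V M.
  elim: M => [_|M IH Mm].
    have HS := sqker_succ_r b0 c0 d0 (leq0n m.+1).
    have HB := sqker_succ_l b0 c0 d0 (leq0n m.+1).
    have P1 : P 1%N = (p * q - (2 * d + 1 / 2 - p - q) / 2) / d.
      by rewrite -sqcoef1// mulrC mulKf// gt_eqF.
    rewrite -/H in HS HB.
    rewrite big_ord1 /br /V /xi HB HS P1 /rec_low /P sqcoef0 sqlam0.
    rewrite /g pochS poch0 -!(natr1 m) /p /q /a.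
    have h1 : 2 * d + (m%:R + 1) != 0 by rewrite natr1 nat0.
    by field; rewrite h1 !gt_eqF.
  rewrite big_ord_recr/= IH; last exact: ltnW.
  have HS := sqker_succ_r b0 c0 d0 (ltnW Mm : (M <= m.+1)%N).
  have HSS := sqker_succ_r b0 c0 d0 Mm.
  have HB := sqker_succ_l b0 c0 d0 Mm.
  rewrite -/H in HS HSS HB.
  have gS : g M.+1 = g M * (2 * d + M%:R) by exact: pochS.
  have gSS : g M.+2 = g M.+1 * (2 * d + M.+1%:R) by exact: pochS.
  have key : br M.+1 = xi M * ((M%:R + d) * (M%:R + 1)) + xi M.+1 * rec_mid p q d M%:R
             + xi M.+2 * rec_low p q d M.+1%:R.
    rewrite /br /xi HB sqlamS gSS gS HSS HS -!(natr1 m) -!(natr1 M.+1) -!(natr1 M) -/g.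
    have n3 : M%:R + 1 + d != 0 by rewrite natr1 nat0'.
    have n4 : M%:R + 1 + 2 * d != 0 by rewrite natr1 nat0'.
    have n7 : b + (M%:R + 1) != 0 by rewrite natr1 nat0.
    have n8 : c + (M%:R + 1) != 0 by rewrite natr1 nat0.
    have n9 : 2 * d + (m%:R + 1) + M%:R != 0.
      by rewrite natr1 -addrA -natrD nat0.
    have n10 : 2 * d + (m%:R + 1) + (M%:R + 1) != 0.
      by rewrite !natr1 -addrA -natrD nat0.
    have := sqker_step (nat0' _ M d0) (nat0' _ M d20) n3 n4 (nat0 _ M b0) (nat0 _ M c0) n7 n8 n9 n10.
    rewrite -/p -/q -/a /=; set r1 := - ((d + M%:R) * _ / _); set r2 := - ((d + (M%:R + 1)) * _ / _).
    move: r1 r2 (rec_mid _ _ _ _) (rec_low _ _ _ _) (H M) (g M) => r1 r2 A1 A2 HM gM st.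
    transitivity (((m%:R + 1) * (d + m%:R) * (b + m%:R) * (c + m%:R) -
       (d + 1 / 2 + m%:R) * (a + m%:R) * ((m%:R - M%:R) * (2 * d + m%:R + M%:R + 1))) *
      (r1 * (2 * d + M%:R + (M%:R + 1))) * (HM * gM)).
      by ring.
    by rewrite st; ring.
  have E := sqcoef_rec3 p q M d0; rewrite -/P in E.
  rewrite key /V -!(natr1 M); move: E.
  move: (rec_mid _ _ _ _) (rec_low _ _ _ _) (rec_low _ _ _ _) => A1 A2 A3.
  move: (xi M) (xi M.+1) (xi M.+2) (P M) (P M.+1) (P M.+2) => x0 x1 x2 y0 y1 y2 E.
  apply/eqP; rewrite -subr_eq0; apply/eqP.
  by transitivity (x1 * 0); [rewrite -[in RHS]E; ring | rewrite mulr0].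
have Z1 : V m.+1 = 0.
  by rewrite /V /xi {1}/H /sqker ltnn natr1 subrr !(mul0r, mulr0) subrr.
have := tel m.+1 (leqnn _); rewrite Z1 => e.
apply/eqP; rewrite -subr_eq0 -e /Z.
rewrite !mulr_sumr [X in _ - X](_ : _ = \sum_(n < m.+2) (d + 1 / 2 + m%:R) * (a + m%:R) *
 (sqker b c d m n * sqlam d n * sqcoef p q d n)); last first.
  by rewrite [RHS]big_ord_recr/= {3}/sqker ltnn !(mul0r, mulr0) addr0.
rewrite -sumrB; apply/eqP/eq_bigr => i _.
by rewrite /br -/P -/H; ring.
Qed.

(** Both sides satisfy the same first-order recurrence in m. *)
Lemma sqker_sum {R : realFieldType} (b c d : R) m
  (p := 2 * d + 1 / 2 - c) (q := 2 * d + 1 / 2 - b) (a := b + c - 2 * d - 1 / 2) :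
  0 < b -> 0 < c -> 0 < d ->
  \sum_(n < m.+1) sqker b c d m n * sqlam d n * sqcoef p q d n =
  poch (d + 1 / 2) m * poch a m / (m`!%:R * poch d m * poch b m * poch c m).
Proof.
move=> b0 c0 d0; elim: m => [|m IH].
  rewrite big_ord1 /sqker sqlam0 sqcoef0 leqnn subnn addn0 !poch0 expr0 fact0.
  by rewrite !(mulr1, divr1).
have := sqker_sum_rec m b0 c0 d0; rewrite -/p -/q -/a IH => e.
rewrite factS natrM !pochS -(natr1 m).
have h1 : m%:R + 1 != 0 :> R by rewrite natr1 pnatr_eq0.
have h2 : d + m%:R != 0 by rewrite gt_eqF// ltr_pwDl.
have h3 : b + m%:R != 0 by rewrite gt_eqF// ltr_pwDl.
have h4 : c + m%:R != 0 by rewrite gt_eqF// ltr_pwDl.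
apply: (mulfI (mulf_neq0 (mulf_neq0 (mulf_neq0 h1 h2) h3) h4)).
rewrite [LHS]e.
have p1 := poch_neq0 m b0; have p2 := poch_neq0 m c0; have p3 := poch_neq0 m d0.
have p4 := @fact_neq0 R m.
move: (poch a m) (poch (d + 1 / 2) m) => A1 A2.
by field; rewrite ?h1 ?h2 ?h3 ?h4 ?p1 ?p2 ?p3 ?p4.
Qed.

Definition sqweight {R : realFieldType} (b c d : R) (n : nat) : R :=
  sqlam d n * poch d n * sqcoef (2 * d + 1 / 2 - c) (2 * d + 1 / 2 - b) d n /
  (poch b n * poch c n * poch (d + 1 / 2) n ^+ 2).

(** Comparison of the coefficients of z^m in
    1F2(a;b,c;-4z) = sum_n w_n z^n phi_n(z)^2,   a = b+c-2d-1/2,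
    where phi_n(z) = sum_i (-z)^i / (i! (d+1/2+n)_i) is a Bessel function of
    order d-1/2+n up to elementary factors. *)
Lemma sqweight_expansion {R : realFieldType} (b c d z : R) m :
  0 < b -> 0 < c -> 0 < d ->
  poch (b + c - 2 * d - 1 / 2) m / (m`!%:R * poch b m * poch c m) * (- (4 * z)) ^+ m =
  \sum_(n < m.+1) sqweight b c d n * z ^+ n *
     conv (fun i => (- z) ^+ i / (i`!%:R * poch (d + 1 / 2 + n%:R) i))
          (fun i => (- z) ^+ i / (i`!%:R * poch (d + 1 / 2 + n%:R) i)) (m - n).
Proof.
move=> b0 c0 d0.
have e0 : 0 < d + 1 / 2 by rewrite addr_gt0// divr_gt0.
have d20 : 0 < 2 * d by rewrite mulr_gt0.
transitivity ((- z) ^+ m * poch (2 * d) (m + m) / poch (d + 1 / 2) m ^+ 2 *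
  (poch (d + 1 / 2) m * poch (b + c - 2 * d - 1 / 2) m /
   (m`!%:R * poch d m * poch b m * poch c m))).
  have -> : - (4 * z) = 4 * - z by rewrite mulrN.
  rewrite exprMn poch_double.
  have p1 := poch_neq0 m b0; have p2 := poch_neq0 m c0; have p3 := poch_neq0 m d0.
  have p4 := poch_neq0 m e0; have p5 := @fact_neq0 R m.
  move: (poch (d + 1 / 2) m) p4 => E p4; move: (poch (b + _ - _ - _) m) => A1.
  by field; rewrite ?p1 ?p2 ?p3 ?p4 ?p5.
rewrite -sqker_sum// mulr_sumr; apply: eq_bigr => n _.
have nm : (n <= m)%N by rewrite -ltnS.
have en0 : 0 < d + 1 / 2 + n%:R by rewrite ltr_pwDl.
have -> : conv (fun i => (- z) ^+ i / (i`!%:R * poch (d + 1 / 2 + n%:R) i))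
          (fun i => (- z) ^+ i / (i`!%:R * poch (d + 1 / 2 + n%:R) i)) (m - n) =
   (- z) ^+ (m - n) * (poch (2 * d + m%:R + n%:R) (m - n) /
     ((m - n)`!%:R * poch (d + 1 / 2 + n%:R) (m - n) ^+ 2)).
  have -> : 2 * d + m%:R + n%:R = 2 * (d + 1 / 2 + n%:R) - 1 + (m - n)%:R.
    by rewrite natrB//; field.
  rewrite -conv_inv_poch// /conv mulr_sumr; apply: eq_bigr => i _.
  have ik : (i <= m - n)%N by rewrite -ltnS.
  have -> : (- z) ^+ (m - n) = (- z) ^+ i * (- z) ^+ (m - n - i).
    by rewrite -exprD subnKC.
  by ring.
rewrite /sqker nm /sqweight.
have ez : (- z) ^+ m = (- 1) ^+ n * z ^+ n * (- z) ^+ (m - n).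
  by rewrite -exprNn -exprD subnKC.
have e1 : poch (2 * d) (m + m) = poch (2 * d) (m + n) * poch (2 * d + m%:R + n%:R) (m - n).
  by rewrite -addrA -natrD -poch_add; congr poch; lia.
have e2 : poch (d + 1 / 2) m = poch (d + 1 / 2) n * poch (d + 1 / 2 + n%:R) (m - n).
  by rewrite -poch_add subnKC.
rewrite ez e1 e2.
have p1 := poch_neq0 n b0; have p2 := poch_neq0 n c0.
have p3 := poch_neq0 n e0; have p4 := poch_neq0 (m - n) en0; have p5 := @fact_neq0 R (m - n).
have p6 := poch_neq0 (m + n) d20.
have s : (- 1) ^+ n * (- 1) ^+ n = 1 :> R by rewrite -exprD addnn -mul2n exprM sqrrN !expr1n.
transitivity (((- 1) ^+ n * (- 1) ^+ n) * (z ^+ n * (- z) ^+ (m - n) * sqlam d n *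
  poch d n * sqcoef (2 * d + 1 / 2 - c) (2 * d + 1 / 2 - b) d n *
  poch (2 * d + m%:R + n%:R) (m - n) / (poch b n * poch c n * (m - n)`!%:R *
   (poch (d + 1 / 2) n * poch (d + 1 / 2 + n%:R) (m - n)) ^+ 2))); last first.
  rewrite s; move: (poch (d + 1 / 2) n) (poch (d + 1 / 2 + n%:R) _) (poch b n) (poch c n) (sqcoef _ _ _ _) p1 p2 p3 p4 => X1 X2 X3 X4 X5 p1 p2 p3 p4.
  by field; rewrite ?p1 ?p2 ?p3 ?p4 ?p5.
move: (poch (d + 1 / 2) n) (poch (d + 1 / 2 + n%:R) _) (poch b n) (poch c n) (sqcoef _ _ _ _) (poch (2 * d) (m + n)) p1 p2 p3 p4 p6 => X1 X2 X3 X4 X5 X6 p1 p2 p3 p4 p6.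
by field; rewrite ?p1 ?p2 ?p3 ?p4 ?p5 ?p6.
Qed.

(** * Series dominated by the exponential series *)

Definition expdom {R : realType} (C K : R) (u : nat -> R) :=
  forall n, `|u n| <= C * (K ^+ n / n`!%:R).

Lemma cvg_series_exp {R : realType} (K : R) :
  series (fun n => K ^+ n / n`!%:R) @ \oo --> expR K.
Proof. exact: is_cvg_series_exp_coeff. Qed.

Lemma cvg_seriesZ {R : realType} (c l : R) (u : nat -> R) :
  series u @ \oo --> l -> series (fun n => c * u n) @ \oo --> c * l.
Proof.
move=> h; rewrite (_ : series _ = fun n => c * series u n); first exact: cvgMl_tmp.
by apply/funext => n; rewrite /series/= mulr_sumr.
Qed.

Lemma expdom_cvg {R : realType} (C K : R) (u : nat -> R) :
  expdom C K u -> cvgn (series u).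
Proof.
move=> h; apply: normed_cvg.
apply: (@series_le_cvg _ _ (fun n => C * (K ^+ n / n`!%:R))) => [n|n|n|] //=.
  exact: le_trans (h n).
by apply/cvg_ex; exists (C * expR K); apply: cvg_seriesZ; exact: cvg_series_exp.
Qed.

Lemma sum_conv {R : realFieldType} (u v : nat -> R) N :
  \sum_(k < N) conv u v k = \sum_(i < N) u i * \sum_(j < N - i) v j.
Proof.
elim: N => [|N IH]; first by rewrite !big_ord0.
rewrite big_ord_recr/= IH [RHS]big_ord_recr/= subSnn big_ord1.
rewrite /conv big_ord_recr/= subnn addrA -big_split/=.
congr (_ + _); apply: eq_bigr => i _.
by rewrite subSn ?(ltnW (ltn_ord i))// big_ord_recr/= mulrDr.
Qed.

Lemma cauchy_remainder {R : realFieldType} (u v : nat -> R) N :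
  (\sum_(i < N) u i) * (\sum_(j < N) v j) - \sum_(k < N) conv u v k =
  \sum_(i < N) u i * \sum_(N - i <= j < N) v j.
Proof.
rewrite sum_conv mulr_suml -sumrB; apply: eq_bigr => i _; rewrite -mulrBr; congr (_ * _).
by rewrite -!(big_mkord xpredT) (@big_cat_nat _ _ _ (N - i)%N 0 N)//= ?leq_subr// addrAC subrr add0r.
Qed.

Lemma conv_exp {R : realType} (K : R) n :
  conv (fun n => K ^+ n / n`!%:R) (fun n => K ^+ n / n`!%:R) n = (2 * K) ^+ n / n`!%:R.
Proof.
have -> : (2 * K) ^+ n = (K + K) ^+ n by congr (_ ^+ _); ring.
rewrite exprDn mulr_suml /conv; apply: eq_bigr => i _.
have i_n : (i <= n)%N by rewrite -ltnS.
rewrite -mulr_natr -(bin_fact i_n) !natrM.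
have h1 := @fact_neq0 R i; have h2 := @fact_neq0 R (n - i).
have h3 : 'C(n, i)%:R != 0 :> R by rewrite pnatr_eq0 -lt0n bin_gt0.
by field; rewrite h1 h2 h3.
Qed.

(** The difference between the product of partial sums and the partial sum of
    the product is a sum over pairs (i,j); domination bounds it by the same
    expression for exponential series, which tends to 0. *)
Lemma cauchy_product {R : realType} (C D K : R) (u v : nat -> R) :
  expdom C K u -> expdom D K v ->
  series (conv u v) @ \oo --> limn (series u) * limn (series v).
Proof.
move=> hu hv.
pose e n := K ^+ n / n`!%:R.
pose rem (u v : nat -> R) N := (\sum_(i < N) u i) * (\sum_(j < N) v j) - \sum_(k < N) conv u v k.
have cu : series u @ \oo --> limn (series u) by exact: expdom_cvg hu.
have cv : series v @ \oo --> limn (series v) by exact: expdom_cvg hv.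
have se (w : nat -> R) N : series w N = \sum_(k < N) w k by rewrite /series/= big_mkord.
have rem0 : rem e e @ \oo --> (0 : R).
  have -> : (0 : R) = expR K * expR K - expR (2 * K).
    by rewrite (_ : 2 * K = K + K) ?expRD ?subrr//; ring.
  have -> : rem e e = (series e * series e) - series (fun n => (2 * K) ^+ n / n`!%:R).
    apply/funext => N; change (rem e e N = series e N * series e N - series (fun n => (2 * K) ^+ n / n`!%:R) N).
    rewrite !se /rem; congr (_ - _).
    by apply: eq_bigr => k _; rewrite -conv_exp.
  by apply: cvgB; [apply: cvgM|]; exact: cvg_series_exp.
have remle N : `|rem u v N| <= C * D * rem e e N.
  rewrite /rem !cauchy_remainder mulr_sumr (le_trans (ler_norm_sum _ _ _))//.
  apply: ler_sum => i _; rewrite normrM mulrACA.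
  apply: ler_pM => //.
  rewrite mulr_sumr (le_trans (ler_norm_sum _ _ _))//; apply: ler_sum => j _.
  exact: (hv j).
have remuv : rem u v @ \oo --> (0 : R).
  apply/norm_cvg0P/(@squeeze_cvgr _ _ _ _ (cst 0) (fun N => C * D * rem e e N)).
  - by near=> N; rewrite /= normr_ge0 remle.
  - exact: cvg_cst.
  - by rewrite -[X in _ --> X](mulr0 (C * D)); exact: cvgMl_tmp.
have -> : series (conv u v) = (series u * series v) - rem u v.
    apply/funext => N; change (series (conv u v) N = series u N * series v N - rem u v N).
  by rewrite !se /rem; ring.
rewrite -[X in _ --> X]subr0; apply: cvgB => //; exact: cvgM.
Unshelve. all: by end_near.
Qed.

Lemma sum_triangle {R : realFieldType} (T : nat -> nat -> R) N :
  \sum_(m < N) \sum_(n < m.+1) T n m = \sum_(n < N) \sum_(n <= m < N) T n m.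
Proof.
elim: N => [|N IH]; first by rewrite !big_ord0.
rewrite !big_ord_recr/= IH big_nat1 addrA -big_split/=; congr (_ + _).
by apply: eq_bigr => i _; rewrite big_nat_recr//= ltnW.
Qed.

(** A row-summed triangular double series bounds each of its nonnegative column
    sums; the domination by B makes the missing tails of the columns
    negligible. *)
Lemma double_series_ge {R : realType} (T : nat -> nat -> R) (B S : nat -> R) (F : R) n0 :
  (forall n m, (n <= m)%N -> `|T n m| <= B m) ->
  cvgn (series (fun m => m.+1%:R * B m)) ->
  (forall n, (fun M => \sum_(n <= m < M) T n m) @ \oo --> S n) ->
  (forall n, 0 <= S n) ->
  (fun N => \sum_(m < N) \sum_(n < m.+1) T n m) @ \oo --> F ->
  S n0 <= F.
Proof.
move=> TB cB cT S0 cF.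
pose B' m := m.+1%:R * B m.
have B0 m : 0 <= B m by exact: le_trans (TB m m (leqnn m)).
have B'0 m : 0 <= B' m by rewrite mulr_ge0.
pose tail N := limn (series B') - series B' N.
have tail0 : tail @ \oo --> (0 : R).
  by rewrite -(subrr (limn (series B'))); apply: cvgB => //; exact: cvg_cst.
(* Multiplying by N+1 pays for the number of columns summed afterwards. *)
have low N n : (n <= N)%N ->
    N.+1%:R * (S n - \sum_(n <= m < N.+1) T n m) <= tail N.+1.
  move=> nN.
  have h : (fun M => N.+1%:R * (\sum_(n <= m < M) T n m - \sum_(n <= m < N.+1) T n m))
     @ \oo --> N.+1%:R * (S n - \sum_(n <= m < N.+1) T n m).
    by apply: cvgMl_tmp; apply: cvgB; [exact: cT | exact: cvg_cst].
  rewrite -(cvg_lim (@Rhausdorff R) h); apply: limr_le.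
    by apply/cvg_ex; eexists; exact: h.
  near=> M.
  have NM : (N.+1 <= M)%N by near: M; exact: nbhs_infty_ge.
  rewrite (@big_cat_nat _ _ _ N.+1 n M)//=; last exact: leqW.
  rewrite addrAC subrr add0r mulr_sumr.
  apply: (@le_trans _ _ (\sum_(N.+1 <= m < M) B' m)).
    rewrite big_nat_cond [leRHS]big_nat_cond; apply: ler_sum => m.
    rewrite andbT => /andP[Nm _].
    apply: (@le_trans _ _ (N.+1%:R * B m)).
      rewrite ler_wpM2l// (le_trans (ler_norm _))// TB// (leq_trans nN)//.
      exact: ltnW.
    by rewrite ler_wpM2r// ler_nat ltnW.
  rewrite -sub_series_geq// /tail lerB//.
  apply: nondecreasing_cvgn_le => //.
  by apply: nondecreasing_series => k _ _; exact: B'0.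
have main N : (n0 <= N)%N -> S n0 - tail N.+1 <= \sum_(m < N.+1) \sum_(n < m.+1) T n m.
  move=> nN; rewrite sum_triangle.
  apply: (@le_trans _ _ (\sum_(n < N.+1) (S n - tail N.+1 / N.+1%:R))).
    rewrite sumrB sumr_const card_ord -(mulr_natr (_ / _)) divfK ?pnatr_eq0// lerD2r.
    have n0N : (n0 < N.+1)%N by [].
    rewrite (bigD1 (Ordinal n0N))//= lerDl; exact: sumr_ge0.
  apply: ler_sum => i _.
  have := low N i (ltn_ord i : (i <= N)%N).
  by rewrite mulrC -ler_pdivlMr ?ltr0n// !lerBlDr addrC.
have h : (fun N => \sum_(m < N.+1) \sum_(n < m.+1) T n m + tail N.+1) @ \oo --> F + 0.
  apply: cvgD.
    by rewrite (cvg_shiftS (fun N => \sum_(m < N) \sum_(n < m.+1) T n m)).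
  by rewrite (cvg_shiftS tail).
rewrite -(addr0 F) -(cvg_lim (@Rhausdorff R) h); apply: limr_ge.
  by apply/cvg_ex; eexists; exact: h.
near=> N; rewrite -lerBlDr; apply: main; near: N; exact: nbhs_infty_ge.
Unshelve. all: by end_near.
Qed.

(** * Growth bookkeeping and the hypergeometric series 1F2 *)

(** u n = O(K^n n!^s / n!^t).  Counting factorials in two exponents lets
    products be estimated by [growthM] and cancelled by [growthS], with no
    attention to constants. *)
Definition growth {R : realFieldType} (s t : nat) (u : nat -> R) :=
  exists C K : R, [/\ 0 <= C, 0 <= K &
    forall n, `|u n| * n`!%:R ^+ t <= C * K ^+ n * n`!%:R ^+ s].

Lemma growthM {R : realFieldType} s t s' t' (u v : nat -> R) :
  growth s t u -> growth s' t' v -> growth (s + s') (t + t') (fun n => u n * v n).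
Proof.
move=> [C [K [C0 K0 hu]]] [D [L [D0 L0 hv]]].
exists (C * D), (K * L); split; rewrite ?mulr_ge0// => n.
rewrite normrM !exprD exprMn mulrACA.
have -> : C * D * (K ^+ n * L ^+ n) * (n`!%:R ^+ s * n`!%:R ^+ s') =
   (C * K ^+ n * n`!%:R ^+ s) * (D * L ^+ n * n`!%:R ^+ s') by ring.
by apply: ler_pM => //; rewrite mulr_ge0// exprn_ge0.
Qed.

Lemma growth_pow {R : realFieldType} (z : R) : growth 0 0 (fun n => z ^+ n).
Proof.
exists 1, `|z|; split => // n; by rewrite normrX !expr0 !mulr1 mul1r.
Qed.

Lemma fact_ge1 {R : realFieldType} n : 1 <= n`!%:R :> R.
Proof. by rewrite ler1n fact_gt0. Qed.

Lemma poch_growth {R : realFieldType} (x : R) : growth 1 0 (poch x).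
Proof.
exists 1, (1 + `|x|); split; rewrite ?addr_ge0// => n.
rewrite expr0 mulr1 mul1r expr1; elim: n => [|n IH].
  by rewrite poch0 normr1 fact0 expr0 mulr1.
have -> : (1 + `|x|) ^+ n.+1 * n.+1`!%:R =
   ((1 + `|x|) ^+ n * n`!%:R) * ((1 + `|x|) * n.+1%:R).
  by rewrite factS natrM exprS; ring.
rewrite pochS normrM ler_pM// (le_trans (ler_normD _ _))// normr_nat.
by rewrite -natr1; have := normr_ge0 x; have := ler0n R n; nra.
Qed.

Lemma inv_poch_growth {R : realFieldType} (x : R) : 0 < x ->
  growth 0 1 (fun n => (poch x n)^-1).
Proof.
move=> x0; exists 1, (1 + x^-1); split; rewrite ?addr_ge0// ?invr_ge0 ?(ltW x0)// => n.
rewrite expr0 expr1 mulr1 mul1r normfV (gtr0_norm (poch_gt0 n x0)).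
rewrite ler_pdivrMl ?poch_gt0// mulrC; elim: n => [|n IH].
  by rewrite poch0 fact0 expr0 mulr1.
have -> : (1 + x^-1) ^+ n.+1 * poch x n.+1 =
   ((1 + x^-1) * (x + n%:R)) * ((1 + x^-1) ^+ n * poch x n).
  by rewrite pochS exprS; ring.
rewrite factS natrM ler_pM// -natr1.
have -> : (1 + x^-1) * (x + n%:R) = n%:R + 1 + x + n%:R / x.
  by field; rewrite gt_eqF.
by rewrite -addrA lerDl addr_ge0 ?(ltW x0)// divr_ge0// ltW.
Qed.

Lemma inv_fact_growth {R : realFieldType} : growth 0 1 (fun n => n`!%:R^-1 : R).
Proof.
exists 1, 1; split => // n.
by rewrite expr0 expr1 expr1n !mulr1 normfV ger0_norm// mulVf// fact_neq0.
Qed.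

Lemma growthS {R : realFieldType} s t (u : nat -> R) :
  growth s.+1 t.+1 u -> growth s t u.
Proof.
move=> [C [K [C0 K0 h]]]; exists C, K; split => // n.
have := h n; by rewrite !exprSr !mulrA ler_pM2r// ltr0n fact_gt0.
Qed.

Lemma growth_weak {R : realFieldType} s t (u : nat -> R) :
  growth s t.+1 u -> growth s t u.
Proof.
move=> [C [K [C0 K0 h]]]; exists C, K; split => // n.
by apply: le_trans (h n); rewrite exprSr mulrA ler_peMr ?fact_ge1.
Qed.

Lemma eq_growth {R : realFieldType} s t (u v : nat -> R) :
  u =1 v -> growth s t u -> growth s t v.
Proof. by move=> e; rewrite (_ : u = v)//; apply/funext. Qed.

Lemma growth_expdom {R : realType} (u : nat -> R) :
  growth 0 1 u -> exists C K, [/\ 0 <= C, 0 <= K & expdom C K u].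
Proof.
move=> [C [K [C0 K0 h]]]; exists C, K; split => // n.
by have := h n; rewrite expr0 expr1 mulr1 mulrA ler_pdivlMr// ltr0n fact_gt0.
Qed.

Lemma hyp_growth {R : realFieldType} (p q d : R) : 0 < d -> growth 0 0 (hyp p q d).
Proof.
move=> d0; apply/growthS/growthS.
have := growthM (growthM (poch_growth p) (poch_growth q)) (growthM inv_fact_growth (inv_poch_growth d0)).
by apply: eq_growth => n; rewrite /hyp invfM.
Qed.

Lemma conv_growth {R : realFieldType} (u v : nat -> R) :
  growth 0 0 u -> growth 0 0 v -> growth 0 0 (conv u v).
Proof.
move=> [C [K [C0 K0 hu]]] [D [L [D0 L0 hv]]].
exists (C * D), (2 * (K + L)); split; rewrite ?mulr_ge0 ?addr_ge0// => n.
rewrite !expr0 !mulr1 /conv (le_trans (ler_norm_sum _ _ _))//.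
apply: (@le_trans _ _ (\sum_(i < n.+1) C * D * (K + L) ^+ n)).
  apply: ler_sum => i _; have i_n : (i <= n)%N by rewrite -ltnS.
  have -> : (K + L) ^+ n = (K + L) ^+ i * (K + L) ^+ (n - i) by rewrite -exprD subnKC.
  rewrite normrM mulrACA; have := hu i; have := hv (n - i)%N; rewrite !expr0 !mulr1 => h1 h2.
  apply: ler_pM => //.
    by rewrite (le_trans h2)// ler_wpM2l// lerXn2r ?nnegrE ?addr_ge0// lerDl.
  by rewrite (le_trans h1)// ler_wpM2l// lerXn2r ?nnegrE ?addr_ge0// lerDr.
rewrite sumr_const card_ord -(mulr_natr (C * D * _)) exprMn -!mulrA !ler_wpM2l//.
rewrite mulrC ler_wpM2r ?exprn_ge0 ?addr_ge0//.
by rewrite -natrX ler_nat ltn_expl.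
Qed.

Lemma sqlam_growth {R : realFieldType} (d : R) : 0 < d -> growth 1 0 (sqlam d).
Proof.
move=> d0; have d20 : 0 < 2 * d by rewrite mulr_gt0.
have [C [K [C0 K0 h]]] := poch_growth (2 * d).
exists (2 * C), (K + 1); split; rewrite ?mulr_ge0 ?addr_ge0// => n.
rewrite expr0 mulr1 expr1 /sqlam.
have h' m : poch (2 * d) m <= C * (K + 1) ^+ m * m`!%:R.
  apply: (@le_trans _ _ (C * K ^+ m * m`!%:R)).
    by have := h m; rewrite expr0 expr1 mulr1; apply: le_trans; exact: ler_norm.
  by rewrite ler_wpM2r// ler_wpM2l// lerXn2r ?nnegrE ?addr_ge0// lerDl.
rewrite ger0_norm; last by rewrite addr_ge0 ?mulr_ge0// ltW// poch_gt0.
have -> : 2 * C * (K + 1) ^+ n * n`!%:R = C * (K + 1) ^+ n * n`!%:R + C * (K + 1) ^+ n * n`!%:R by ring.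
rewrite lerD//; case: n => [|n].
  by rewrite mul0r !mulr_ge0// exprn_ge0// addr_ge0.
have -> : C * (K + 1) ^+ n.+1 * n.+1`!%:R = (K + 1) * (n.+1%:R * (C * (K + 1) ^+ n * n`!%:R)).
  by rewrite exprS factS natrM; ring.
apply: (le_trans (ler_wpM2l (ler0n R n.+1) (h' n))).
by rewrite ler_peMl ?lerDr// !mulr_ge0// exprn_ge0// addr_ge0.
Qed.

Lemma sqweight_growth {R : realFieldType} (b c d : R) :
  0 < b -> 0 < c -> 0 < d -> growth 0 1 (sqweight b c d).
Proof.
move=> b0 c0 d0.
have e0 : 0 < d + 1 / 2 by rewrite addr_gt0// divr_gt0.
have := growthM (growthM (growthM (sqlam_growth d0) (poch_growth d))
   (conv_growth (hyp_growth (d - (2 * d + 1 / 2 - c)) (d - (2 * d + 1 / 2 - b)) d0)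
     (hyp_growth ((2 * d + 1 / 2 - c) + (2 * d + 1 / 2 - b) - d - 1 / 2) (d + 1 / 2) d0)))
  (growthM (growthM (inv_poch_growth b0) (inv_poch_growth c0))
    (growthM (inv_poch_growth e0) (inv_poch_growth e0))).
move=> /growthS/growthS/growth_weak; apply: eq_growth => n.
by rewrite /sqweight -!invfM expr2.
Qed.

Definition hyp1F2_coef {R : realFieldType} (a b c : R) (m : nat) : R :=
  poch a m / (m`!%:R * poch b m * poch c m).

Definition hyp1F2 {R : realType} (a b c y : R) : R :=
  limn (series (fun m => hyp1F2_coef a b c m * (- y) ^+ m)).

Lemma hyp1F2_coef_growth {R : realFieldType} (a b c : R) :
  0 < b -> 0 < c -> growth 0 2 (hyp1F2_coef a b c).
Proof.
move=> b0 c0; apply: growthS.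
have := growthM (poch_growth a) (growthM (growthM inv_fact_growth (inv_poch_growth b0)) (inv_poch_growth c0)).
by apply: eq_growth => n; rewrite /hyp1F2_coef -!invfM.
Qed.

Lemma hyp1F2_expdom {R : realType} (a b c y : R) : 0 < b -> 0 < c ->
  exists C K, [/\ 0 <= C, 0 <= K & expdom C K (fun m => hyp1F2_coef a b c m * (- y) ^+ m)].
Proof.
move=> b0 c0; apply/growth_expdom/growth_weak.
exact: (growthM (hyp1F2_coef_growth a b0 c0) (growth_pow (- y))).
Qed.

Lemma hyp1F2_cvg {R : realType} (a b c y : R) : 0 < b -> 0 < c ->
  series (fun m => hyp1F2_coef a b c m * (- y) ^+ m) @ \oo --> hyp1F2 a b c y.
Proof.
by move=> b0 c0; have [C [K [_ _ h]]] := hyp1F2_expdom a y b0 c0; exact: expdom_cvg h.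
Qed.

(** * The series 1F2 dominates each of its squares *)

Definition sqterm {R : realFieldType} (d z : R) (n i : nat) : R :=
  (- z) ^+ i / (i`!%:R * poch (d + 1 / 2 + n%:R) i).

Lemma sqterm_le {R : realFieldType} (d z : R) n i : 0 < d -> 0 <= z ->
  `|sqterm d z n i| <= (3 * z) ^+ i / i`!%:R.
Proof.
move=> d0 z0; set x := d + 1 / 2 + n%:R.
have x0 : 1 / 2 < x by rewrite /x -addrA; have := ler0n R n; lra.
have xp : 0 < x by lra.
rewrite /sqterm -/x normrM normrX normrN (ger0_norm z0) normfV normrM normr_nat.
rewrite (gtr0_norm (poch_gt0 i xp)) exprMn invfM mulrA.
rewrite -[leRHS]mulrA [leRHS]mulrC ler_wpM2l ?divr_ge0 ?exprn_ge0//.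
rewrite -[_^-1]mul1r ler_pdivrMr ?poch_gt0//.
elim: i => [|i IH]; first by rewrite poch0 expr0 mulr1.
rewrite pochS exprSr mulrACA -[leLHS]mulr1 ler_pM//.
by have := ler0n R i; lra.
Qed.

Definition sqfun {R : realType} (d z : R) (n : nat) : R :=
  limn (series (sqterm d z n)).

Lemma sqterm_expdom {R : realType} (d z : R) n : 0 < d -> 0 <= z ->
  expdom 1 (3 * z) (sqterm d z n).
Proof. by move=> d0 z0 i; rewrite mul1r sqterm_le. Qed.

(** All terms w_n z^n phi_n(z)^2 of the expansion are nonnegative, so the sum
    is at least any single one of them. *)
Lemma hyp1F2_ge_square {R : realType} (b c d z : R) n :
  0 < b -> 0 < c -> 0 < d -> 0 <= z ->
  (forall n, 0 <= sqweight b c d n) ->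
  sqweight b c d n * z ^+ n * sqfun d z n ^+ 2 <=
    hyp1F2 (b + c - 2 * d - 1 / 2) b c (4 * z).
Proof.
move=> b0 c0 d0 z0 w0.
have [C [K [C0 K0 hw]]] : exists C K, [/\ 0 <= C, 0 <= K & expdom C K (sqweight b c d)].
  by apply: growth_expdom; exact: sqweight_growth.
pose g := sqterm d z.
pose T n m := sqweight b c d n * z ^+ n * conv (g n) (g n) (m - n)%N.
pose L := K * z + 6 * z.
have L0 : 0 <= L by rewrite addr_ge0 ?mulr_ge0.
apply: (@double_series_ge R T (fun m => C * ((2 * L) ^+ m / m`!%:R))
  (fun n => sqweight b c d n * z ^+ n * sqfun d z n ^+ 2)).
- move=> k m km; rewrite /T.
  have hc : `|conv (g k) (g k) (m - k)| <= (6 * z) ^+ (m - k) / (m - k)`!%:R.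
    have -> : 6 * z = 2 * (3 * z) by ring.
    rewrite -conv_exp /conv (le_trans (ler_norm_sum _ _ _))//; apply: ler_sum => i _.
    by rewrite normrM ler_pM// sqterm_le.
  have hz : `|sqweight b c d k * z ^+ k| <= C * ((K * z) ^+ k / k`!%:R).
    rewrite normrM (ger0_norm (exprn_ge0 k z0)) exprMn.
    have -> : C * (K ^+ k * z ^+ k / k`!%:R) = (C * (K ^+ k / k`!%:R)) * z ^+ k by ring.
    by rewrite ler_wpM2r ?exprn_ge0.
  rewrite normrM (le_trans (ler_pM _ _ hz hc))// -mulrA ler_wpM2l//.
  rewrite -conv_exp /conv.
  have km' : (k < m.+1)%N by [].
  rewrite (bigD1 (Ordinal km'))//= -[leLHS]addr0 lerD//; last first.
    by apply: sumr_ge0 => i _; rewrite mulr_ge0// divr_ge0// exprn_ge0.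
  have le1 : K * z <= L by rewrite lerDl mulr_ge0.
  have le2 : 6 * z <= L by rewrite lerDr mulr_ge0.
  by apply: ler_pM; rewrite ?divr_ge0 ?exprn_ge0 ?mulr_ge0// ler_wpM2r ?invr_ge0// lerXn2r ?nnegrE ?mulr_ge0.
- apply: (@series_le_cvg _ _ (fun m => C * ((4 * L) ^+ m / m`!%:R))) => [m|m|m|].
  + by rewrite mulr_ge0// mulr_ge0// divr_ge0// exprn_ge0// mulr_ge0.
  + by rewrite mulr_ge0// divr_ge0// exprn_ge0// mulr_ge0.
  + rewrite mulrCA ler_wpM2l// mulrA ler_wpM2r ?invr_ge0//.
    have -> : 4 * L = 2 * (2 * L) by ring.
    rewrite [leRHS]exprMn ler_wpM2r ?exprn_ge0 ?mulr_ge0//.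
    by rewrite -natrX ler_nat ltn_expl.
  + by apply/cvg_ex; exists (C * expR (4 * L)); apply: cvg_seriesZ; exact: cvg_series_exp.
- move=> k.
  have h : series (conv (g k) (g k)) @ \oo --> sqfun d z k ^+ 2.
    rewrite expr2; exact: (cauchy_product (sqterm_expdom k d0 z0) (sqterm_expdom k d0 z0)).
  rewrite (_ : (fun M => _) = fun M => (sqweight b c d k * z ^+ k) * series (conv (g k) (g k)) (M - k)%N).
    by apply: cvgMl_tmp; rewrite (cvg_centern k (series (conv (g k) (g k)))).
  apply/funext => M; rewrite /T /series/= -mulr_sumr; congr (_ * _).
  rewrite -[X in \big[_/_]_(X <= _ < M) _](add0n k) big_addn.
  by apply: eq_bigr => i _; rewrite addnK.
- by move=> k; rewrite mulr_ge0 ?sqr_ge0// mulr_ge0 ?exprn_ge0.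
- have := @hyp1F2_cvg R (b + c - 2 * d - 1 / 2) b c (4 * z) b0 c0.
  apply: cvg_trans; rewrite (_ : series _ = (fun N => \sum_(m < N) \sum_(n0 < m.+1) T n0 m)) //.
  apply/funext => N; rewrite /series/= big_mkord; apply: eq_bigr => m _.
  by rewrite /hyp1F2_coef sqweight_expansion.
Qed.

(** The n-th Bessel series has first term 1, and its other terms together are
    at most e^z / (d+1/2+n). *)
Lemma sqfun_gt0 {R : realType} (d z : R) : 0 < d -> 0 <= z ->
  exists N, forall n, (N <= n)%N -> 0 < sqfun d z n.
Proof.
move=> d0 z0.
(* From this index on e^z < d + 1/2 + n. *)
exists (Num.trunc (expR z)).+1 => n Nn.
have zn : expR z < n%:R.
  apply: (lt_le_trans (truncnS_gt (expR z))).
  by rewrite ler_nat.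
set x := d + 1 / 2 + n%:R.
have xn : n%:R < x by rewrite /x; lra.
have n0 : 0 < n%:R :> R by apply: lt_trans zn; exact: expR_gt0.
have x1 : 1 < x by apply: lt_trans xn; rewrite (le_lt_trans _ zn)// -(expR0) ler_expR.
have xp : 0 < x by lra.
have cv : cvgn (series (sqterm d z n)) by exact: expdom_cvg (sqterm_expdom n d0 z0).
suff h : 1 - expR z / x <= sqfun d z n.
  apply: lt_le_trans h; rewrite subr_gt0 ltr_pdivrMr// mul1r; exact: lt_trans xn.
apply: limr_ge => //.
near=> N.
have N0 : (0 < N)%N by near: N; exact: nbhs_infty_ge.
rewrite /series/= -(prednK N0) big_nat_recl//= /sqterm expr0 fact0 poch0 mulr1 divr1.
rewrite lerD2l -lerNl -sumrN.
apply: (@le_trans _ _ (\sum_(0 <= i < N.-1) (z ^+ i.+1 / i.+1`!%:R) / x)).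
  apply: ler_sum => i _; rewrite (le_trans (ler_norm _))// normrN -/x.
  rewrite normrM normrX normrN (ger0_norm z0) normfV normrM normr_nat.
  rewrite (gtr0_norm (poch_gt0 _ xp)) invfM mulrA ler_wpM2l ?divr_ge0 ?exprn_ge0//.
  rewrite lef_pV2 ?posrE ?poch_gt0// pochSl ler_peMr ?(ltW xp)//.
  elim: (i) => [|j IH]; first by rewrite poch0.
  by rewrite pochS mulr_ege1//; have := ler0n R j; lra.
rewrite -mulr_suml ler_wpM2r ?invr_ge0 ?(ltW xp)//.
apply: (@le_trans _ _ (series (exp_coeff z) N)).
  rewrite /series/= -[in leRHS](prednK N0) big_nat_recl//= lerDr.
  by rewrite /exp_coeff/= expr0 fact0 divr1.
apply: nondecreasing_cvgn_le; last exact: is_cvg_series_exp_coeff.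
by apply: nondecreasing_series => k _ _; exact: exp_coeff_ge0.
Unshelve. all: by end_near.
Qed.

(** The sum of squares, with d chosen so that b+c-2d-1/2 = a.  Positivity of
    the weights is a condition on the pair (b-a, c-a): the bound on b+c
    gives d >= a, and the bound on (b-a)(c-a) is nonnegativity of the weight
    at n = 1.  For strictness one positive weight of large index is enough. *)
Lemma hyp1F2_positive {R : realType} (a b c y : R) :
  0 < a -> a < b -> a < c -> 3 * a + 1 / 2 <= b + c ->
  a / 2 <= (b - a) * (c - a) -> 0 < y ->
  0 <= hyp1F2 a b c y /\
  (~ ((b = a + 1 / 2 /\ c = 2 * a) \/ (b = 2 * a /\ c = a + 1 / 2)) ->
    0 < hyp1F2 a b c y).
Proof.
move=> a0 ab ac hs hp y0.
pose d := (b + c - a - 1 / 2) / 2.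
pose p := 2 * d + 1 / 2 - c; pose q := 2 * d + 1 / 2 - b.
have pE : p = b - a by rewrite /p /d; field.
have qE : q = c - a by rewrite /q /d; field.
have d0 : 0 < d by rewrite /d; lra.
have b0 : 0 < b by lra.
have c0 : 0 < c by lra.
have h1 : d <= p + q - 1 / 2 by rewrite pE qE /d; lra.
have h2 : p + q - 1 / 2 < 2 * d by rewrite pE qE /d; lra.
have [ge0 gt0] : (forall n, 0 <= sqcoef p q d n) /\
  (~ ((b = a + 1 / 2 /\ c = 2 * a) \/ (b = 2 * a /\ c = a + 1 / 2)) ->
     forall n, 0 < sqcoef p q d n.+2).
  have [h3|h3] := leP 0 ((d - p) * (d - q)).
    have [g0 gp] := sqcoef_same_sign d0 h1 h2 h3.
    split=> // ne n; apply: gp => -[e1 [e2|e2]]; apply: ne.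
      by right; move: e1 e2; rewrite pE qE /d => e1 e2; split; lra.
    by left; move: e1 e2; rewrite pE qE /d => e1 e2; split; lra.
  have h4 : (2 * d + 1 / 2 - p - q) / 2 <= p * q.
    have -> : 2 * d + 1 / 2 - p - q = a by rewrite pE qE /d; field.
    by rewrite pE qE.
  have p0 : 0 < p by rewrite pE subr_gt0.
  have q0 : 0 < q by rewrite qE subr_gt0.
  by have [g0 gp] := sqcoef_opp_sign p0 q0 d0 h1 h2 h4 h3.
have e0 : 0 < d + 1 / 2 by lra.
have d20 : 0 < 2 * d by lra.
have lam0 n : 0 < sqlam d n.
  by rewrite /sqlam ltr_pwDl ?poch_gt0// mulr_ge0// ltW// poch_gt0.
have w0 n : 0 <= sqweight b c d n.
  have pge0 x k : 0 < x -> 0 <= poch x k by move=> x0; exact/ltW/poch_gt0.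
  by rewrite /sqweight -/p -/q divr_ge0 ?mulr_ge0 ?ge0 ?exprn_ge0 ?pge0 ?(ltW (lam0 _)).
have z0 : 0 <= y / 4 by rewrite divr_ge0// ltW.
have yE : y = 4 * (y / 4) by field.
have aE : b + c - 2 * d - 1 / 2 = a by rewrite /d; field.
have sq n : sqweight b c d n * (y / 4) ^+ n * sqfun d (y / 4) n ^+ 2 <= hyp1F2 a b c y.
  by have := hyp1F2_ge_square n b0 c0 d0 z0 w0; rewrite -yE aE.
split.
  apply: le_trans (sq 0%N).
  by rewrite mulr_ge0 ?sqr_ge0// mulr_ge0// exprn_ge0.
move=> /gt0 {}gt0; have [N hN] := sqfun_gt0 d0 z0.
apply: lt_le_trans (sq N.+2).
have sN : 0 < sqfun d (y / 4) N.+2 by apply: hN; rewrite (leq_trans (leqnSn N)).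
have wN : 0 < sqweight b c d N.+2.
  rewrite /sqweight -/p -/q; apply: divr_gt0.
    by rewrite !mulr_gt0 ?gt0 ?lam0 ?poch_gt0.
  by rewrite !mulr_gt0 ?exprn_gt0 ?poch_gt0.
have zN : 0 < (y / 4) ^+ N.+2 by rewrite exprn_gt0// divr_gt0.
by apply: mulr_gt0; [apply: mulr_gt0 | apply: exprn_gt0].
Qed.

Local Notation mu := lebesgue_measure.

(** * Termwise integration *)

Lemma Rintegral_sum {R : realType} (D : set R) (g : nat -> R -> R) N :
  measurable D -> (forall n, mu.-integrable D (EFin \o g n)) ->
  mu.-integrable D (EFin \o (fun x => \sum_(k < N) g k x)) /\
  \int[mu]_(x in D) (\sum_(k < N) g k x) =
    \sum_(k < N) \int[mu]_(x in D) g k x.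
Proof.
move=> mD ig; elim: N => [|N [IH1 IH2]].
  split.
    rewrite (_ : _ \o _ = cst 0%E); first exact: integrable0.
    by apply/funext => x /=; rewrite big_ord0.
  rewrite big_ord0 -[RHS](mul0r (fine (lebesgue_measure D))) -Rintegral_cst//.
  by apply: eq_Rintegral => x _; rewrite big_ord0.
have e : (fun x => \sum_(k < N.+1) g k x) = (fun x => (\sum_(k < N) g k x) + g N x).
  by apply/funext => x; rewrite big_ord_recr.
rewrite e; split.
  rewrite (_ : _ \o _ = (EFin \o (fun x => \sum_(k < N) g k x)) \+ (EFin \o g N)); last first.
    by apply/funext => x.
  exact: integrableD.
by rewrite RintegralD// IH2 big_ord_recr.
Qed.

(** Dominated convergence, with the sum of the absolute values as dominating function. *)
Lemma Rintegral_series {R : realType} (D : set R) (g : nat -> R -> R) (G : R -> R) :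
  measurable D -> (forall n, mu.-integrable D (EFin \o g n)) ->
  cvgn (series (fun n => \int[mu]_(x in D) `|g n x|)) ->
  (forall x, D x -> series (g ^~ x) @ \oo --> G x) ->
  mu.-integrable D (EFin \o G) /\
  series (fun n => \int[mu]_(x in D) g n x) @ \oo -->
    \int[mu]_(x in D) G x.
Proof.
move=> mD ig cg cG.
have mg n : measurable_fun D (g n).
  by have /measurable_int/measurable_EFinP := ig n.
have mG : measurable_fun D G.
  apply: (@measurable_fun_cvg _ _ _ _ (fun N x => \sum_(k < N) g k x)) => //.
    by move=> N; exact: measurable_sum.
  move=> x Dx; have := cG x Dx; apply: cvg_trans.
  by rewrite (_ : series _ = (fun N => \sum_(k < N) g k x))// /series/=; apply/funext => N; rewrite big_mkord.
pose h x := (\sum_(n <oo) `|g n x|%:E)%E.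
have mgn n : measurable_fun D (fun x => `|g n x|%:E).
  by apply/measurable_EFinP; exact: (measurableT_comp (@normr_measurable R setT) (mg n)).
have mh : measurable_fun D h by exact: ge0_emeasurable_sum.
have h0 x : (0 <= h x)%E by apply: nneseries_ge0 => // k _ _; rewrite lee_fin.
have ih : mu.-integrable D h.
  apply/integrableP; split => //.
  rewrite (_ : (\int[mu]_(x in D) `|h x|)%E = (\int[mu]_(x in D) h x)%E); last first.
    by apply: eq_integral => x _; rewrite gee0_abs.
  rewrite integral_nneseries//.
  pose r n := \int[mu]_(x in D) `|g n x|.
  have E n : (\int[mu]_(x in D) `|g n x|%:E)%E = (r n)%:E.
    rewrite /r /Rintegral fineK//; apply: integrable_fin_num => //.
    exact: (integrable_norm (ig n)).
  rewrite (eq_eseriesr (fun n _ => E n)).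
  have -> : (\sum_(0 <= n <oo) (r n)%:E)%E = limn (EFin \o series r).
    by congr (limn _); apply/funext => N; rewrite /= sumEFin.
  by rewrite EFin_lim// ltry.
have le N x : D x -> (`|(\sum_(k < N) g k x)%:E| <= h x)%E.
  move=> Dx; apply: (@le_trans _ _ (\sum_(0 <= k < N) `|g k x|%:E)%E).
    by rewrite sumEFin lee_fin big_mkord ler_norm_sum.
  by apply: nneseries_lim_ge => k _; rewrite lee_fin.
have mS N : measurable_fun D (EFin \o (fun x => \sum_(k < N) g k x)).
  by apply/measurable_EFinP; exact: measurable_sum.
have mG' : measurable_fun D (EFin \o G) by apply/measurable_EFinP.
have [||i1 _ i2] := @dominated_convergence _ _ _ mu D mD _ _ h mS mG' _ ih _.
- apply/nearW => x Dx; apply/fine_cvgP; split; first by near=> N.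
  have := cG x Dx; apply: cvg_trans.
  rewrite (_ : fine \o _ = series (g ^~ x)); first exact: cvg_id.
  by apply/funext => N; rewrite /series/= big_mkord.
- by apply/nearW => x N Dx; exact: le.
split; first exact: i1.
have -> : series (fun n => \int[mu]_(x in D) g n x) =
   fun N => fine (\int[mu]_(x in D) (\sum_(k < N) g k x)%:E)%E.
  apply/funext => N; rewrite /series/= big_mkord.
  by have [_ <-] := Rintegral_sum N mD ig.
apply: fine_cvg; rewrite /Rintegral fineK//; exact: integrable_fin_num.
Unshelve. all: by end_near.
Qed.

(** * Improper integrals over open intervals *)

(** Increasing compact intervals that fill the open set D. *)
Definition exhausts {R : realType} (al be : nat -> R) (D : set R) :=
  [/\ forall n, al n < be n,
      nondecreasing_seq (fun n => `[al n, be n]%classic),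
      D = \bigcup_n `[al n, be n]%classic & open D].

Lemma exhausts_cvg {R : realType} (al be : nat -> R) (D : set R) (g : R -> R) :
  exhausts al be D -> mu.-integrable D (EFin \o g) ->
  (fun n => \int[mu]_(x in `[al n, be n]) g x) @ \oo -->
    \int[mu]_(x in D) g x.
Proof.
move=> [lt nd DE oD] ig.
pose mu := @lebesgue_measure R.
have mD : measurable D by exact: open_measurable.
have mg : measurable_fun D g by have /measurable_int/measurable_EFinP := ig.
pose F n := `[al n, be n]%classic : set R.
have FD n : F n `<=` D by rewrite DE; exact: bigcup_sup.
have mF n : measurable (F n) by exact: measurable_itv.
have mf n : measurable_fun D (EFin \o (g \_ (F n))).
  apply/measurable_EFinP/measurable_restrict => //.
  apply: measurable_funS mg => //; exact: subIsetl.
have absg x : `|(EFin \o g) x|%E = (`|g x|)%:E by [].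
have [||_ _ i2] := @dominated_convergence _ _ _ mu D mD _ (EFin \o g) _ mf
  (measurable_int mu ig) _ (integrable_norm ig) _.
- apply/nearW => x Dx.
  have [N _ FN] : (\bigcup_n F n) x by rewrite -DE.
  apply: cvg_near_cst; near=> n => /=; rewrite patchE ifT// inE.
  have Nn : (N <= n)%N by near: n; exact: nbhs_infty_ge.
  by have /subsetPset sub := nd _ _ Nn; exact: (sub _ FN).
- apply/nearW => x n Dx /=; rewrite patchE; case: ifPn => // _.
  by rewrite normr0 lee_fin.
have iD : (\int[mu]_(x in D) (EFin \o g) x)%E = (\int[mu]_(x in D) g x)%:E.
  by rewrite /Rintegral fineK//; exact: integrable_fin_num.
rewrite iD in i2.
have -> : (fun n => \int[mu]_(x in `[al n, be n]) g x) =
   (fun n => fine (\int[mu]_(x in D) (EFin \o (g \_ (F n))) x)%E); last exact: fine_cvg i2.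
apply/funext => n /=; rewrite -[LHS]/(\int[mu]_(x in F n) g x).
by rewrite -{1}(setIidr (FD n)) Rintegral_mkcondr.
Unshelve. all: by end_near.
Qed.

Lemma FTC_itv {R : realType} (a b : R) (G g : R -> R) : a < b ->
  (forall x, a <= x <= b -> is_derive x 1 G (g x)) ->
  (forall x, a <= x <= b -> {for x, continuous g}) ->
  \int[mu]_(x in `[a, b]) g x = G b - G a.
Proof.
move=> ab dG cg.
have cG x : a <= x <= b -> {for x, continuous G}.
  move=> xab; have [dGx _] := dG x xab.
  exact/differentiable_continuous/derivable1_diffP.
rewrite /Rintegral (@continuous_FTC2 R g G a b)//.
- apply: continuous_in_subspaceT => x; rewrite inE/= in_itv/=; exact: cg.
- split.
  + by move=> x; rewrite in_itv/= => /andP[ax xb]; have [] := dG x; rewrite ?ltW// ?(ltW ax) ?(ltW xb).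
  + by apply: cvg_at_right_filter; apply: cG; rewrite lexx ltW.
  + by apply: cvg_at_left_filter; apply: cG; rewrite lexx ltW.
- move=> x; rewrite in_itv/= => /andP[ax xb].
  by rewrite derive1E; have [] := dG x; rewrite ?(ltW ax) ?(ltW xb).
Qed.

(** A nonnegative derivative with a bounded primitive is integrable, by
    monotone convergence along the exhaustion. *)
Lemma exhausts_integrable {R : realType} (al be : nat -> R) (D : set R) (G g : R -> R) M :
  exhausts al be D ->
  (forall x, D x -> is_derive x 1 G (g x)) ->
  (forall x, D x -> {for x, continuous g}) ->
  (forall x, D x -> 0 <= g x) -> (forall x, D x -> `|G x| <= M) ->
  mu.-integrable D (EFin \o g).
Proof.
move=> [lt nd DE oD] dG cg g0 GM.
pose mu := @lebesgue_measure R.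
have mg : measurable_fun D g.
  by apply: open_continuous_measurable_fun => // x; rewrite inE; exact: cg.
pose F n := `[al n, be n]%classic : set R.
have FD n : F n `<=` D by rewrite DE; exact: bigcup_sup.
apply/integrableP; split; first exact/measurable_EFinP.
have -> : (\int[mu]_(x in D) `|(EFin \o g) x|)%E = (\int[mu]_(x in D) (g x)%:E)%E.
  by apply: eq_integral => x; rewrite inE => Dx /=; rewrite ger0_norm// g0.
have h : (\int[mu]_(x in F n) (g x)%:E @[n --> \oo] --> \int[mu]_(x in \bigcup_n F n) (g x)%:E)%E.
  apply: ge0_nondecreasing_set_cvg_integral => //.
  - by move=> n; exact: measurable_itv.
  - by move=> n; apply/measurable_EFinP; exact: measurable_funS (open_measurable oD) (FD n) mg.
  - by move=> n x /FD Dx; rewrite lee_fin g0.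
rewrite -DE in h; rewrite -(cvg_lim _ h)//.
apply: (@le_lt_trans _ _ (2 * M)%:E); last exact: ltry.
apply: lime_le; first by apply/cvg_ex; eexists; exact: h.
near=> n.
have Dab x : al n <= x <= be n -> D x.
  by move=> h1; apply: (FD n); rewrite /F/= ?in_itv.
have := FTC_itv (lt n) (fun x hx => dG x (Dab x hx)) (fun x hx => cg x (Dab x hx)).
have ifin : (\int[mu]_(x in F n) (g x)%:E)%E \is a fin_num.
  apply: integrable_fin_num; first exact: measurable_itv.
  apply: continuous_compact_integrable; first exact: segment_compact.
  by apply: continuous_in_subspaceT => x; rewrite inE/= ?in_itv/= => /Dab; exact: cg.
rewrite /Rintegral => e; rewrite -(fineK ifin) lee_fin e.
have h1 := GM _ (Dab _ (_ : al n <= al n <= be n)).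
have h2 := GM _ (Dab _ (_ : al n <= be n <= be n)).
have l := ltW (lt n).
have {}h1 : `|G (al n)| <= M by apply: h1; rewrite lexx l.
have {}h2 : `|G (be n)| <= M by apply: h2; rewrite lexx l.
have := ler_norm (G (be n)); have := ler_norm (- G (al n)); rewrite normrN; lra.
Unshelve. all: by end_near.
Qed.

Lemma exhausts_FTC {R : realType} (al be : nat -> R) (D : set R) (G g : R -> R) l0 l1 :
  exhausts al be D -> mu.-integrable D (EFin \o g) ->
  (forall x, D x -> is_derive x 1 G (g x)) ->
  (forall x, D x -> {for x, continuous g}) ->
  G \o al @ \oo --> l0 -> G \o be @ \oo --> l1 ->
  \int[mu]_(x in D) g x = l1 - l0.
Proof.
move=> ex ig dG cg h0 h1; have [lt nd DE oD] := ex.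
have e n : \int[mu]_(x in `[al n, be n]) g x = G (be n) - G (al n).
  have Dab x : al n <= x <= be n -> D x.
    by move=> hx; rewrite DE; exists n => //=; rewrite in_itv.
  by apply: FTC_itv => // x /Dab; [exact: dG | exact: cg].
have := exhausts_cvg ex ig; under eq_fun do rewrite e.
move=> /(cvg_unique _); apply; first exact: Rhausdorff.
exact: (cvgB h1 h0).
Qed.

Lemma cvg_inv_succ {R : realType} (c : R) k :
  (fun n => c / (n + k.+1)%:R) @ \oo --> (0 : R).
Proof.
rewrite -[X in _ --> X](mulr0 c); apply: cvgMl_tmp.
have := @cvg_harmonic R; rewrite -(cvg_shiftn k); apply: cvg_trans.
rewrite (_ : (fun n => _) = (fun n => (n + k.+1)%:R^-1))//.
by apply/funext => n; rewrite /harmonic/= addnS.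
Qed.

Lemma exhausts_bounded {R : realType} (x : R) : 0 < x ->
  exhausts (fun n => x / (n + 3)%:R) (fun n => x - x / (n + 3)%:R) `]0, x[.
Proof.
move=> x0; have n0 (n : nat) : 0 < (n + 3)%:R :> R by rewrite ltr0n addn_gt0 orbT.
have le (n m : nat) : (n <= m)%N -> x / (m + 3)%:R <= x / (n + 3)%:R.
  by move=> nm; rewrite ler_pM2l// lef_pV2 ?posrE// ler_nat leq_add2r.
split=> [n|n m nm||].
- rewrite ltrBrDr -mulrDl ltr_pdivrMr// (_ : x + x = x * 2); last by ring.
  by rewrite ltr_pM2l// ltr_nat addn3.
- apply/subsetPset => y /=; rewrite !in_itv/= => /andP[h1 h2]; apply/andP; split.
    exact: le_trans (le _ _ nm) h1.
  by apply: le_trans h2 _; rewrite lerB// le.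
- apply/seteqP; split=> y.
    rewrite /= in_itv/= => /andP[y0 yx].
    have h : (fun n => x / (n + 3)%:R) @ \oo --> (0 : R) by exact: cvg_inv_succ.
    have m0 : 0 < Num.min y (x - y) by rewrite lt_min y0 subr_gt0.
    have /cvgr0Pnorm_lt/(_ _ m0)[N _ hN] := h.
    exists N => //=; rewrite in_itv/=.
    have := hN N (leqnn N); rewrite /= ger0_norm ?divr_ge0// ?(ltW x0)//.
    rewrite lt_min => /andP[h1 h2]; rewrite (ltW h1)/=; lra.
  move=> [n _] /=; rewrite !in_itv/= => /andP[h1 h2].
  have p : 0 < x / (n + 3)%:R by rewrite divr_gt0.
  by apply/andP; split; lra.
- exact: interval_open.
Qed.

Lemma exhausts_ray {R : realType} (s : R) : 0 < s ->
  exhausts (fun n => s * (n + 2)%:R^-1) (fun n => s * (n + 2)%:R) `]0, +oo[.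
Proof.
move=> s0; have n0 (n : nat) : 0 < (n + 2)%:R :> R by rewrite ltr0n addn_gt0 orbT.
split=> [n|n m nm||].
- rewrite ltr_pM2l// (@lt_trans _ _ 1)// ?invf_lt1// ?ltr1n ?addn2//.
- apply/subsetPset => y /=; rewrite !in_itv/= => /andP[h1 h2]; apply/andP; split.
    by apply: le_trans h1; rewrite ler_pM2l// lef_pV2 ?posrE// ler_nat leq_add2r.
  by apply: le_trans h2 _; rewrite ler_pM2l// ler_nat leq_add2r.
- apply/seteqP; split=> y.
    rewrite /= in_itv/= andbT => y0.
    have h : (fun n => s / (n + 2)%:R) @ \oo --> (0 : R) by exact: cvg_inv_succ.
    have /cvgr0Pnorm_lt/(_ _ y0)[N _ hN] := h.
    pose M := (Num.trunc (y / s)).+1.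
    exists (maxn N M) => //=; rewrite in_itv/=; apply/andP; split.
      have := hN (maxn N M) (leq_maxl _ _).
      by rewrite /= ger0_norm ?divr_ge0// ?(ltW s0)// => /ltW.
    rewrite mulrC -ler_pdivrMr// (le_trans (ltW (truncnS_gt (y / s))))//.
    by rewrite ler_nat (leq_trans (leq_maxr N M))// leq_addr.
  move=> [n _] /=; rewrite !in_itv/= => /andP[h1 h2].
  by rewrite andbT (lt_le_trans _ h1)// mulr_gt0// invr_gt0.
- exact: interval_open.
Qed.

Lemma integrable_ge0_le {R : realType} (D : set R) (f g : R -> R) :
  measurable D -> measurable_fun D f -> (forall x, D x -> `|f x| <= g x) ->
  mu.-integrable D (EFin \o g) ->
  mu.-integrable D (EFin \o f).
Proof.
move=> mD mf fg ig; apply: le_integrable ig => //; first exact/measurable_EFinP.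
move=> x Dx /=; rewrite lee_fin (le_trans (fg x Dx))//; exact: ler_norm.
Qed.

Lemma eq_integrableR {R : realType} (D : set R) (f g : R -> R) :
  measurable D -> (forall x, D x -> f x = g x) ->
  mu.-integrable D (EFin \o f) ->
  mu.-integrable D (EFin \o g).
Proof.
by move=> mD fg; apply: eq_integrable => // x; rewrite inE => Dx /=; rewrite fg.
Qed.

Lemma Rintegral_ge_sub {R : realType} (D : set R) (f : R -> R) (a b c : R) :
  measurable D -> mu.-integrable D (EFin \o f) ->
  (forall x, D x -> 0 <= f x) -> a <= b -> 0 <= c ->
  (forall x, a <= x <= b -> D x /\ c <= f x) ->
  c * (b - a) <= \int[mu]_(x in D) f x.
Proof.
move=> mD fi f0 ab c0 h.
pose mu := @lebesgue_measure R.
have mf : measurable_fun D (EFin \o f) by exact: measurable_int fi.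
have sub : `[a, b]%classic `<=` D.
  by move=> x /=; rewrite in_itv/= => /h[].
have mI : measurable (`[a, b]%classic : set R) by exact: measurable_itv.
rewrite -lee_fin.
have -> : (\int[mu]_(x in D) f x)%:E = (\int[mu]_(x in D) (EFin \o f) x)%E.
  by rewrite /Rintegral fineK//; exact: integrable_fin_num.
apply: (@le_trans _ _ (\int[mu]_(x in `[a, b]) (EFin \o f) x)%E); last first.
  by apply: ge0_subset_integral => // x Dx; rewrite lee_fin f0.
apply: (@le_trans _ _ (\int[mu]_(x in `[a, b]) (cst c%:E) x)%E); last first.
  apply: ge0_le_integral => //.
  - exact: measurable_funS mD sub mf.
  - by move=> x /=; rewrite in_itv/= => /h[_]; rewrite lee_fin.
rewrite integral_cst//= lebesgue_measure_itv/= lte_fin.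
move: ab; rewrite le_eqVlt => /predU1P[->|ab]; first by rewrite subrr mulr0 ltxx mule0.
by rewrite ab -EFinB -EFinM.
Qed.

Lemma integrable_sub {R : realType} (E D : set R) (f : R -> R) :
  measurable E -> measurable D -> D `<=` E ->
  mu.-integrable E (EFin \o f) ->
  mu.-integrable D (EFin \o f).
Proof. by move=> mE mD DE; apply: integrableS. Qed.

Lemma integrable_lin {R : realType} (D : set R) (f g : R -> R) (c d : R) :
  measurable D -> mu.-integrable D (EFin \o f) ->
  mu.-integrable D (EFin \o g) ->
  mu.-integrable D (EFin \o (fun x => c * f x + d * g x)).
Proof.
move=> mD fi gi.
have -> : EFin \o (fun x => c * f x + d * g x) =
   ((fun x => c%:E * (EFin \o f) x) \+ (fun x => d%:E * (EFin \o g) x))%E by [].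
by apply: integrableD => //; apply: integrableZl.
Qed.

Lemma Rintegral_lin {R : realType} (D : set R) (f g : R -> R) (c d : R) :
  measurable D -> mu.-integrable D (EFin \o f) ->
  mu.-integrable D (EFin \o g) ->
  \int[mu]_(x in D) (c * f x + d * g x) =
  c * (\int[mu]_(x in D) f x) + d * \int[mu]_(x in D) g x.
Proof.
move=> mD fi gi.
have fi' : mu.-integrable D (EFin \o (fun x => c * f x)).
  have -> : EFin \o (fun x => c * f x) = (fun x => c%:E * (EFin \o f) x)%E by [].
  exact: integrableZl.
have gi' : mu.-integrable D (EFin \o (fun x => d * g x)).
  have -> : EFin \o (fun x => d * g x) = (fun x => d%:E * (EFin \o g) x)%E by [].
  exact: integrableZl.
by rewrite RintegralD// !RintegralZl.
Qed.

(** A bound for both signs of the exponent at once, at the price of adding the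
    two endpoint values. *)
Lemma powR_between {R : realType} (l u y r : R) : 0 < l -> l <= y <= u ->
  y `^ r <= l `^ r + u `^ r.
Proof.
move=> l0 /andP[ly yu].
have y0 : 0 < y by exact: lt_le_trans ly.
have [r0|r0] := leP 0 r.
  apply: (@le_trans _ _ (u `^ r)); last by rewrite lerDr powR_ge0.
  by apply: ge0_ler_powR => //; rewrite nnegrE ltW// (lt_le_trans y0).
apply: (@le_trans _ _ (l `^ r)); last by rewrite lerDl powR_ge0.
have e z : z `^ r = (z `^ (- r))^-1 by rewrite -powRN opprK.
rewrite !e lef_pV2 ?posrE ?powR_gt0//.
by apply: ge0_ler_powR => //; rewrite ?nnegrE ?oppr_ge0 ltW.
Qed.

Lemma powR_continuous {R : realType} (r x : R) : 0 < x ->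
  {for x, continuous (fun t : R => t `^ r)}.
Proof.
move=> x0; have [d _] := @is_derive1_powR R r x x0.
exact/differentiable_continuous/derivable1_diffP.
Qed.

Lemma powR_integrable {R : realType} (r x : R) : -1 < r -> 0 < x ->
  mu.-integrable `]0, x[ (EFin \o (fun t => t `^ r)).
Proof.
move=> r1 x0; have r10 : 0 < r + 1 by lra.
apply: (@exhausts_integrable _ _ _ _ (fun t => (r + 1)^-1 * t `^ (r + 1)) _ ((r + 1)^-1 * x `^ (r + 1)) (exhausts_bounded x0)).
- move=> t /=; rewrite in_itv/= => /andP[t0 _].
  have d := @is_derive1_powR R (r + 1) t t0.
  have dd : is_derive t (1 : R) ((r + 1)^-1 \*: (fun z : R => z `^ (r + 1))) _ := is_deriveZ _ d.
  apply: (is_derive_eq dd).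
  by rewrite addrK /GRing.scale/= mulrA mulVf ?mul1r// gt_eqF.
- by move=> t /=; rewrite in_itv/= => /andP[t0 _]; exact: powR_continuous.
- by move=> t _; exact: powR_ge0.
- move=> t /=; rewrite in_itv/= => /andP[t0 tx].
  rewrite ger0_norm ?mulr_ge0 ?powR_ge0 ?invr_ge0 ?(ltW r10)//.
  rewrite ler_wpM2l ?invr_ge0 ?(ltW r10)// ge0_ler_powR ?nnegrE ?(ltW r10)// ltW//.
Qed.

Lemma powR_seq_cvg0 {R : realType} (r : R) (u : nat -> R) : 0 < r ->
  (forall n, 0 < u n) -> u @ \oo --> (0 : R) -> (fun n => u n `^ r) @ \oo --> (0 : R).
Proof.
move=> r0 u0 cu; have /cvg_at_rightP := powR_cvg0 r0.
by apply.
Qed.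

(** * Beta weights *)

Definition betaw {R : realType} (gam s x t : R) : R := (x ^+ 2 - t ^+ 2) `^ gam * t `^ s.

Lemma is_derive_powR_comp {R : realType} (f : R -> R) (r t df : R) :
  0 < f t -> is_derive t 1 f df ->
  is_derive t 1 (fun z => f z `^ r) (r * f t `^ (r - 1) * df).
Proof.
move=> ft dft; have d := @is_derive1_powR R r (f t) ft.
exact: (is_derive1_comp d dft).
Qed.

Lemma onem_powR_integrable {R : realType} (r x : R) : -1 < r -> 0 < x ->
  mu.-integrable `]0, x[ (EFin \o (fun t => (x - t) `^ r)).
Proof.
move=> r1 x0; have r10 : 0 < r + 1 by lra.
apply: (@exhausts_integrable _ _ _ _ (fun t => - (r + 1)^-1 * (x - t) `^ (r + 1)) _ ((r + 1)^-1 * x `^ (r + 1)) (exhausts_bounded x0)).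
- move=> t /=; rewrite in_itv/= => /andP[t0 tx].
  have xt : 0 < x - t by rewrite subr_gt0.
  have d0 : is_derive t (1 : R) (fun z : R => x - z) (- 1).
    by apply: is_derive_eq; ring.
  have d := @is_derive_powR_comp R _ (r + 1) t _ xt d0.
  have dd : is_derive t (1 : R) ((- (r + 1)^-1) \*: (fun z : R => (x - z) `^ (r + 1))) _ := is_deriveZ _ d.
  apply: (is_derive_eq dd).
  by rewrite addrK /GRing.scale/=; field; rewrite gt_eqF.
- move=> t /=; rewrite in_itv/= => /andP[t0 tx].
  have xt : 0 < x - t by rewrite subr_gt0.
  have d0 : is_derive t (1 : R) (fun z : R => x - z) (- 1).
    by apply: is_derive_eq; ring.
  have [dd _] := @is_derive_powR_comp R _ r t _ xt d0.
  exact/differentiable_continuous/derivable1_diffP.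
- by move=> t _; exact: powR_ge0.
- move=> t /=; rewrite in_itv/= => /andP[t0 tx].
  rewrite mulNr normrN ger0_norm ?mulr_ge0 ?powR_ge0 ?invr_ge0 ?(ltW r10)//.
  by rewrite ler_wpM2l ?invr_ge0 ?(ltW r10)// ge0_ler_powR ?nnegrE ?(ltW r10)//; lra.
Qed.

Lemma is_derive_sq {R : realType} (x t : R) :
  is_derive t 1 (fun z : R => x ^+ 2 - z ^+ 2) (- (2 * t)).
Proof.
by apply: is_derive_eq; rewrite /GRing.scale/=; ring.
Qed.

Lemma betaw_derivable {R : realType} (gam s x t : R) : 0 < t < x ->
  is_derive t 1 (betaw gam s x)
    (gam * (x ^+ 2 - t ^+ 2) `^ (gam - 1) * (- (2 * t)) * t `^ s
     + (x ^+ 2 - t ^+ 2) `^ gam * (s * t `^ (s - 1))).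
Proof.
move=> /andP[t0 tx].
have p : 0 < x ^+ 2 - t ^+ 2 by nra.
have d1 := @is_derive_powR_comp R _ gam t _ p (is_derive_sq x t).
have d2 := @is_derive1_powR R s t t0.
have dd : is_derive t (1 : R) ((fun z => (x ^+ 2 - z ^+ 2) `^ gam) * (fun z => z `^ s)) _ := is_deriveM d1 d2.
apply: (is_derive_eq dd); rewrite /GRing.scale/=; ring.
Qed.

Lemma betaw_continuous {R : realType} (gam s x t : R) : 0 < t < x ->
  {for t, continuous (betaw gam s x)}.
Proof.
move=> h; have [d _] := betaw_derivable gam s h.
exact/differentiable_continuous/derivable1_diffP.
Qed.

Lemma betaw_ge0 {R : realType} (gam s x t : R) : 0 <= betaw gam s x t.
Proof. by rewrite mulr_ge0 ?powR_ge0. Qed.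

Lemma betaw_measurable {R : realType} (gam s x : R) :
  measurable_fun `]0, x[ (betaw gam s x).
Proof.
apply: open_continuous_measurable_fun; first exact: interval_open.
by move=> t; rewrite inE/= in_itv/=; exact: betaw_continuous.
Qed.

(** The two endpoint singularities are separated at t = x/2. *)
Lemma betaw_integrable {R : realType} (gam s x : R) : -1 < gam -> -1 < s -> 0 < x ->
  mu.-integrable `]0, x[ (EFin \o betaw gam s x).
Proof.
move=> g1 s1 x0.
pose C1 := (x ^+ 2 * (3 / 4)) `^ gam + (x ^+ 2) `^ gam.
pose C2 := (x / 2) `^ s + x `^ s.
pose C3 := x `^ gam + (2 * x) `^ gam.
apply: (@integrable_ge0_le R _ _ (fun t => C1 * t `^ s + C2 * C3 * (x - t) `^ gam)).
- exact: measurable_itv.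
- exact: betaw_measurable.
- move=> t /=; rewrite in_itv/= => /andP[t0 tx]; rewrite ger0_norm ?betaw_ge0//.
  have C10 : 0 <= C1 by rewrite addr_ge0 ?powR_ge0.
  have C20 : 0 <= C2 by rewrite addr_ge0 ?powR_ge0.
  have C30 : 0 <= C3 by rewrite addr_ge0 ?powR_ge0.
  have [th|th] := leP t (x / 2).
    apply: (@le_trans _ _ (C1 * t `^ s)); last first.
      by rewrite lerDl !mulr_ge0 ?powR_ge0.
    by rewrite ler_wpM2r ?powR_ge0// powR_between//; nra.
  apply: (@le_trans _ _ (C2 * C3 * (x - t) `^ gam)); last first.
    by rewrite lerDr !mulr_ge0 ?powR_ge0.
  rewrite /betaw (_ : x ^+ 2 - t ^+ 2 = (x + t) * (x - t)); last by ring.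
  have xt : 0 < x - t by rewrite subr_gt0.
  rewrite powRM ?(ltW xt)//; last by rewrite addr_ge0// ltW.
  rewrite mulrAC ler_wpM2r ?powR_ge0// mulrC ler_pM ?powR_ge0//.
    by rewrite powR_between// ?divr_gt0//; apply/andP; split; exact: ltW.
  by rewrite powR_between//; apply/andP; split; lra.
- apply: integrable_lin; first exact: measurable_itv.
    exact: powR_integrable.
  exact: onem_powR_integrable.
Qed.

Lemma betaw_succ {R : realType} (gam s x t : R) : 0 < t ->
  betaw gam (s + 2) x t = t ^+ 2 * betaw gam s x t.
Proof.
move=> t0; rewrite /betaw powRD; last by rewrite (gt_eqF t0)/= implybT.
by rewrite (powR_mulrn 2 (ltW t0)); ring.
Qed.

(** Integrate the derivative of (x^2-t^2)^(gam+1) t^(s+1), which vanishes at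
    both ends. *)
Lemma betaw_moment_succ {R : realType} (gam s x : R) : -1 < gam -> -1 < s -> 0 < x ->
  (s + 1 + 2 * (gam + 1)) * \int[mu]_(t in `]0, x[) betaw gam (s + 2) x t
  = (s + 1) * x ^+ 2 * \int[mu]_(t in `]0, x[) betaw gam s x t.
Proof.
move=> g1 s1 x0.
have mD : measurable (`]0, x[%classic : set R) by exact: measurable_itv.
have i1 := betaw_integrable g1 s1 x0.
have s3 : -1 < s + 2 by lra.
have i2 := betaw_integrable g1 s3 x0.
have g10 : 0 < gam + 1 by lra.
have s10 : 0 < s + 1 by lra.
pose g t := (s + 1) * x ^+ 2 * betaw gam s x t + - (s + 1 + 2 * (gam + 1)) * betaw gam (s + 2) x t.
have ig : mu.-integrable `]0, x[ (EFin \o g) by exact: integrable_lin.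
suff : \int[mu]_(t in `]0, x[) g t = 0 - 0.
  rewrite /g Rintegral_lin// subr0 mulNr => /eqP; rewrite subr_eq0 => /eqP e.
  by rewrite e.
apply: (@exhausts_FTC R _ _ _ (betaw (gam + 1) (s + 1) x) g 0 0 (exhausts_bounded x0) ig).
- move=> t /=; rewrite in_itv/= => t0x; have /andP[t0 tx] := t0x.
  apply: (is_derive_eq (betaw_derivable _ _ t0x)).
  rewrite /g betaw_succ// /betaw !addrK.
  have p : 0 < x ^+ 2 - t ^+ 2 by nra.
  have tn : t != 0 by rewrite gt_eqF.
  have e1 : (x ^+ 2 - t ^+ 2) `^ (gam + 1) = (x ^+ 2 - t ^+ 2) `^ gam * (x ^+ 2 - t ^+ 2).
    by rewrite powRD ?(gt_eqF p)/= ?implybT// powRr1 ?(ltW p).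
  have e2 : t `^ (s + 1) = t `^ s * t.
    by rewrite powRD ?(gt_eqF t0)/= ?implybT// powRr1 ?(ltW t0).
  by rewrite e1 e2; ring.
- move=> t /=; rewrite in_itv/= => t0x.
  by apply: cvgD; apply: cvgMl_tmp; exact: betaw_continuous.
- have h : (fun n => (x ^+ 2) `^ (gam + 1) * (x / (n + 3)%:R) `^ (s + 1)) @ \oo --> (0 : R).
    rewrite -[X in _ --> X](mulr0 ((x ^+ 2) `^ (gam + 1))); apply: cvgMl_tmp.
    apply: powR_seq_cvg0 => //; last exact: cvg_inv_succ.
    by move=> n; rewrite divr_gt0// ltr0n addn_gt0 orbT.
  apply: (@squeeze_cvgr _ _ _ _ (fun=> 0) _ _ _ _ _ h); last exact: cvg_cst.
  near=> n; rewrite /= betaw_ge0/= ler_wpM2r ?powR_ge0//.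
  have [/(_ n) h1 _ _ _] := exhausts_bounded x0.
  have h2 : 0 < x / (n + 3)%:R by rewrite divr_gt0// ltr0n addn_gt0 orbT.
  by apply: ge0_ler_powR; rewrite ?nnegrE ?(ltW g10)//; nra.
- have h : (fun n => (2 * x * (x / (n + 3)%:R)) `^ (gam + 1) * x `^ (s + 1)) @ \oo --> (0 : R).
    rewrite -[X in _ --> X](mul0r (x `^ (s + 1))); apply: cvgMr_tmp.
    apply: powR_seq_cvg0 => // [n|].
      by rewrite !mulr_gt0// invr_gt0 ltr0n addn_gt0 orbT.
    rewrite -[X in _ --> X](mulr0 (2 * x)); apply: cvgMl_tmp; exact: cvg_inv_succ.
  apply: (@squeeze_cvgr _ _ _ _ (fun=> 0) _ _ _ _ _ h); last exact: cvg_cst.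
  near=> n; rewrite /= betaw_ge0/=.
  have [/(_ n) h1 _ _ _] := exhausts_bounded x0.
  have h2 : 0 < x / (n + 3)%:R by rewrite divr_gt0// ltr0n addn_gt0 orbT.
  set y := x / (n + 3)%:R in h1 h2 *.
  apply: ler_pM; rewrite ?powR_ge0//; apply: ge0_ler_powR; rewrite ?nnegrE ?(ltW g10) ?(ltW s10)//; nra.
Unshelve. all: by end_near.
Qed.

Definition beta_mass {R : realType} (gam s x : R) : R :=
  \int[mu]_(t in `]0, x[) betaw gam s x t.

Lemma beta_mass_gt0 {R : realType} (gam s x : R) : -1 < gam -> -1 < s -> 0 < x ->
  0 < beta_mass gam s x.
Proof.
move=> g1 s1 x0.
have i1 := betaw_integrable g1 s1 x0.
pose C := ((x ^+ 2 * (1 / 4)) `^ (- gam) + (x ^+ 2) `^ (- gam))^-1 * ((x / 2) `^ (- s) + x `^ (- s))^-1.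
have x2 : 0 < x / 2 by rewrite divr_gt0.
have xx : 0 < x ^+ 2 * (1 / 4) by rewrite mulr_gt0 ?exprn_gt0// divr_gt0.
have p1 : 0 < (x ^+ 2 * (1 / 4)) `^ (- gam) + (x ^+ 2) `^ (- gam).
  by rewrite addr_gt0 ?powR_gt0// exprn_gt0.
have p2 : 0 < (x / 2) `^ (- s) + x `^ (- s) by rewrite addr_gt0 ?powR_gt0.
have C0 : 0 < C by rewrite mulr_gt0 ?invr_gt0.
apply: (@lt_le_trans _ _ (C * (3 / 4 * x - x / 2))).
  by rewrite mulr_gt0// subr_gt0; lra.
apply: Rintegral_ge_sub => //.
- by move=> t _; exact: betaw_ge0.
- by lra.
- exact: ltW.
- move=> t /andP[h1 h2]; split; first by rewrite /= in_itv/=; apply/andP; split; lra.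
  have e (y r : R) : y `^ r = (y `^ (- r))^-1 by rewrite -powRN opprK.
  have t0 : 0 < t by lra.
  have q : 0 < x ^+ 2 - t ^+ 2 by nra.
  rewrite /C /betaw (e (x ^+ 2 - t ^+ 2)) (e t).
  apply: ler_pM; rewrite ?invr_ge0 ?(ltW p1) ?(ltW p2)// lef_pV2 ?posrE ?powR_gt0//; apply: powR_between => //.
    by apply/andP; split; nra.
  by apply/andP; split; lra.
Qed.

(** With u = (s+1)/2, multiplication by t^2 multiplies the mass by
    x^2 u/(u+gam+1). *)
Lemma beta_moment {R : realType} (gam s x : R) k : -1 < gam -> -1 < s -> 0 < x ->
  mu.-integrable `]0, x[ (EFin \o (fun t => betaw gam s x t * (t ^+ 2) ^+ k)) /\
  \int[mu]_(t in `]0, x[) (betaw gam s x t * (t ^+ 2) ^+ k) =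
  poch ((s + 1) / 2) k / poch ((s + 1) / 2 + gam + 1) k * (x ^+ 2) ^+ k * beta_mass gam s x.
Proof.
move=> g1 s1 x0.
have e j t : t \in `]0, x[%classic -> betaw gam s x t * (t ^+ 2) ^+ j = betaw gam (s + 2 * j%:R) x t.
  rewrite inE/= in_itv/= => /andP[t0 _]; elim: j => [|j IH].
    by rewrite expr0 mulr1 mulr0 addr0.
  rewrite exprS mulrCA IH -betaw_succ//; congr (betaw _ _ _ _).
  by rewrite -natr1; ring.
have sj (j : nat) : -1 < s + 2 * j%:R by have := ler0n R j; lra.
split.
  apply: (@eq_integrableR _ _ (betaw gam (s + 2 * k%:R) x)); first exact: measurable_itv.
    by move=> t tx; rewrite e// inE.
  exact: betaw_integrable.
have -> : \int[mu]_(t in `]0, x[) (betaw gam s x t * (t ^+ 2) ^+ k) =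
  \int[mu]_(t in `]0, x[) betaw gam (s + 2 * k%:R) x t.
  by apply: eq_Rintegral => t; exact: e.
elim: k => [|k IH].
  by rewrite !poch0 expr0 mulr0 addr0 divr1 !mul1r.
have := betaw_moment_succ g1 (sj k) x0; rewrite IH.
have -> : s + 2 * k%:R + 2 = s + 2 * k.+1%:R by rewrite -natr1; ring.
have k0 := ler0n R k.
have h : s + 2 * k%:R + 1 + 2 * (gam + 1) != 0 by rewrite gt_eqF//; lra.
move=> h'; apply: (mulfI h); rewrite h' !pochS (exprS (x ^+ 2)).
have p1 : poch ((s + 1) / 2 + gam + 1) k != 0 by rewrite poch_neq0//; lra.
have p2 : (s + 1) / 2 + gam + 1 + k%:R != 0 by rewrite gt_eqF//; lra.
by field; rewrite p1/= gt_eqF//; lra.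
Qed.

(** * Power series integrated against beta weights *)

Definition psum {R : realType} (g : nat -> R) (y : R) : R :=
  limn (series (fun k => g k * y ^+ k)).

Lemma psum_cvg {R : realType} (g : nat -> R) (y : R) : growth 0 1 g ->
  series (fun k => g k * y ^+ k) @ \oo --> psum g y.
Proof.
move=> gg; have [C [K [_ _ h]]] := growth_expdom (growthM gg (growth_pow y)).
exact: expdom_cvg h.
Qed.

Lemma growth_cvg_norm {R : realType} (g : nat -> R) : growth 0 1 g ->
  cvgn (series (fun k => `|g k|)).
Proof.
move=> /growth_expdom[C [K [_ _ h]]]; apply: (@expdom_cvg R C K) => n.
by rewrite normr_id.
Qed.

(** Integration against a weight multiplies the coefficients of a power series
    by the moments. *)
Lemma weighted_transform {R : realType} (D : set R) (w ph : R -> R) (m : nat -> R)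
    (g : nat -> R) (y : R) :
  measurable D -> (forall t, D t -> 0 <= w t) -> (forall t, D t -> 0 <= ph t) ->
  (forall k, mu.-integrable D (EFin \o (fun t => w t * ph t ^+ k)) /\
     \int[mu]_(t in D) (w t * ph t ^+ k) = m k) ->
  growth 0 1 g -> growth 0 1 (fun k => g k * m k) ->
  mu.-integrable D (EFin \o (fun t => w t * psum g (y * ph t))) /\
  \int[mu]_(t in D) (w t * psum g (y * ph t)) = psum (fun k => g k * m k) y.
Proof.
move=> mD w0 ph0 hm gg ggm.
pose gn n t := (g n * y ^+ n) * (w t * ph t ^+ n).
have zl (c : R) (f : R -> R) : mu.-integrable D (EFin \o f) ->
    mu.-integrable D (EFin \o (fun t => c * f t)) /\
    \int[mu]_(t in D) (c * f t) = c * \int[mu]_(t in D) f t.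
  move=> fi; split; last exact: RintegralZl.
  have -> : EFin \o (fun x => c * f x) = (fun x => c%:E * (EFin \o f) x)%E by [].
  exact: integrableZl.
have ig n : mu.-integrable D (EFin \o gn n) by have [i _] := hm n; have [] := zl (g n * y ^+ n) _ i.
have iv n : \int[mu]_(t in D) gn n t = (g n * m n) * y ^+ n.
  by have [i <-] := hm n; have [_ ->] := zl (g n * y ^+ n) _ i; rewrite mulrAC.
have ia n : \int[mu]_(t in D) `|gn n t| = `|(g n * m n) * y ^+ n|.
  have [i e] := hm n; have [_ h] := zl `|g n * y ^+ n| _ i.
  have m0 : 0 <= m n by rewrite -e; apply: Rintegral_ge0 => t Dt; rewrite mulr_ge0 ?exprn_ge0 ?w0 ?ph0.
  rewrite mulrAC normrM (ger0_norm m0) -e -h; apply: eq_Rintegral => t; rewrite inE => Dt.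
  by rewrite /gn normrM (@ger0_norm _ (w t * _))// mulr_ge0 ?exprn_ge0 ?w0 ?ph0.
have [] := @Rintegral_series R D gn (fun t => w t * psum g (y * ph t)) mD ig.
- under eq_fun do rewrite ia; apply: growth_cvg_norm.
  exact: (growthM ggm (growth_pow y)).
- move=> t Dt.
  rewrite (_ : gn ^~ t = fun n => w t * (g n * (y * ph t) ^+ n)).
    by apply: cvg_seriesZ; exact: psum_cvg.
  by apply/funext => n; rewrite /gn exprMn; ring.
move=> i c; split => //.
have c2 := @psum_cvg R _ y ggm.
apply: (cvg_unique (@Rhausdorff R) c).
by rewrite (_ : (fun n => \int[mu]_(t in D) gn n t) = (fun n => (g n * m n) * y ^+ n))//; apply/funext.
Qed.

Lemma psumZ {R : realType} (g : nat -> R) (c y : R) : growth 0 1 g ->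
  psum (fun k => c * g k) y = c * psum g y.
Proof.
move=> gg; apply: cvg_lim; first exact: Rhausdorff.
rewrite (_ : (fun k => _) = fun k => c * (g k * y ^+ k)).
  by apply: cvg_seriesZ; exact: psum_cvg.
by apply/funext => k; rewrite mulrA.
Qed.

Lemma psum_scale {R : realType} (g : nat -> R) (c y : R) :
  psum (fun k => g k * c ^+ k) y = psum g (y * c).
Proof.
by rewrite /psum; congr (limn (series _)); apply/funext => k; rewrite exprMn; ring.
Qed.

Lemma eq_psum {R : realType} (g h : nat -> R) (y : R) :
  g =1 h -> psum g y = psum h y.
Proof. by move=> e; rewrite (_ : g = h)//; apply/funext. Qed.

Lemma growthZ {R : realFieldType} s t (c : R) (u : nat -> R) :
  growth s t u -> growth s t (fun k => c * u k).
Proof.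
move=> [C [K [C0 K0 h]]]; exists (`|c| * C), K; split; rewrite ?mulr_ge0// => n.
by rewrite normrM -!mulrA ler_wpM2l// !mulrA.
Qed.

(** In the language of hypergeometric series: a beta average adds one
    numerator and one denominator index. *)
Lemma beta_transform {R : realType} (gam s x y : R) (g : nat -> R) :
  -1 < gam -> -1 < s -> 0 < x -> growth 0 1 g ->
  mu.-integrable `]0, x[ (EFin \o (fun t => betaw gam s x t * psum g (y * t ^+ 2))) /\
  \int[mu]_(t in `]0, x[) (betaw gam s x t * psum g (y * t ^+ 2)) =
  beta_mass gam s x *
    psum (fun k => g k * (poch ((s + 1) / 2) k / poch ((s + 1) / 2 + gam + 1) k)) (y * x ^+ 2).
Proof.
move=> g1 s1 x0 gg.
have p0 : 0 < (s + 1) / 2 + gam + 1 by lra.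
have gr : growth 0 1 (fun k => g k * (poch ((s + 1) / 2) k / poch ((s + 1) / 2 + gam + 1) k)).
  by apply: growthS; exact: (growthM gg (growthM (poch_growth _) (inv_poch_growth p0))).
have gr2 : growth 0 1 (fun k => g k * (poch ((s + 1) / 2) k / poch ((s + 1) / 2 + gam + 1) k * (x ^+ 2) ^+ k * beta_mass gam s x)).
  have := growthZ (beta_mass gam s x) (growthM gr (growth_pow (x ^+ 2))).
  by apply: eq_growth => k; ring.
have [||i ->] := @weighted_transform R `]0, x[ (betaw gam s x) (fun t => t ^+ 2)
  _ g y (measurable_itv _) _ _ (fun k => beta_moment k g1 s1 x0) gg gr2.
- by move=> t _; exact: betaw_ge0.
- by move=> t _; exact: sqr_ge0.
split => //; rewrite -psumZ// -psum_scale; apply: eq_psum => k; ring.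
Qed.

(** * An algebraic majorant with an explicit primitive *)

Lemma expR_powR_bound {R : realType} (k : R) :
  exists2 C : R, 0 < C & forall z, 0 <= z -> expR (- z) <= C * (1 + z) `^ (- k).
Proof.
pose n := (Num.trunc k).+1.
have kn : k <= n%:R by exact/ltW/truncnS_gt.
exists (n`!%:R * expR 1); first by rewrite mulr_gt0 ?expR_gt0// ltr0n fact_gt0.
move=> z z0; have z1 : 0 < 1 + z by lra.
have z1' : 1 <= 1 + z by lra.
apply: (@le_trans _ _ (n`!%:R * expR 1 * (1 + z) `^ (- n%:R))); last first.
  rewrite ler_wpM2l ?mulr_ge0 ?expR_ge0//.
  by apply: ler_powR => //; rewrite lerN2.
rewrite powRN powR_mulrn ?(ltW z1)// ler_pdivlMr ?exprn_gt0//.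
rewrite -(ler_pM2l (expR_gt0 z)) mulrA -expRD subrr expR0 mul1r.
have -> : expR z * (n`!%:R * expR 1) = n`!%:R * expR (1 + z) by rewrite addrC expRD; ring.
rewrite -ler_pdivrMl ?ltr0n ?fact_gt0// mulrC.
apply: (@le_trans _ _ (series (exp_coeff (1 + z)) n.+1)).
  rewrite /series/= big_nat_recr//= lerDr sumr_ge0// => i _.
  by rewrite divr_ge0// exprn_ge0// ltW.
apply: nondecreasing_cvgn_le; last exact: is_cvg_series_exp_coeff.
by apply: nondecreasing_series => i _ _; exact: exp_coeff_ge0 (ltW z1).
Qed.

(** A substitute for t^(r-1) e^(-th t) that decays fast enough and has the
    elementary primitive (t/(1+th t))^r / r. *)
Definition majw {R : realType} (r th t : R) : R := t `^ (r - 1) * (1 + th * t) `^ (- (r + 1)).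

Definition majw_prim {R : realType} (r th t : R) : R := r^-1 * (t / (1 + th * t)) `^ r.

Lemma majw_prim_derive {R : realType} (r th t : R) : 0 < r -> 0 <= th -> 0 < t ->
  is_derive t 1 (majw_prim r th) (majw r th t).
Proof.
move=> r0 th0 t0.
have q : 0 < 1 + th * t by rewrite ltr_pwDl// mulr_ge0// ltW.
have qt : 0 < t / (1 + th * t) by rewrite divr_gt0.
have dq : is_derive t (1 : R) (fun z : R => 1 + th * z) th.
  by apply: is_derive_eq; rewrite /GRing.scale/=; ring.
have dV := is_deriveV (negbT (gt_eqF q) : (fun z : R => 1 + th * z) t != 0) dq.
have dd : is_derive t (1 : R) (fun z : R => z / (1 + th * z)) ((1 + th * t) ^- 2).
  have dM : is_derive t (1 : R) ((fun z : R => z) * (fun z : R => (1 + th * z)^-1)) _ := is_deriveM (is_derive_id t (1 : R)) dV.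
  apply: (is_derive_eq dM); rewrite /GRing.scale/=.
  by field; rewrite gt_eqF.
have d := @is_derive_powR_comp R _ r t _ qt dd.
have d2 : is_derive t (1 : R) (r^-1 \*: (fun z : R => (z / (1 + th * z)) `^ r)) _ := is_deriveZ _ d.
apply: (is_derive_eq d2); rewrite /GRing.scale/= /majw.
rewrite !mulrA mulVf ?gt_eqF// mul1r.
rewrite powRM ?(ltW t0) ?invr_ge0 ?(ltW q)// -mulrA; congr (_ * _).
rewrite -powR_invn ?(ltW q)// -[X in X `^ (r - 1) * _]powR_inv1 ?(ltW q)// -powRrM -powRD.
  by congr (_ `^ _); ring.
by rewrite (gt_eqF q) implybT.
Qed.

Lemma majw_continuous {R : realType} (r th t : R) : 0 <= th -> 0 < t ->
  {for t, continuous (majw r th)}.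
Proof.
move=> th0 t0.
have q : 0 < 1 + th * t by rewrite ltr_pwDl// mulr_ge0// ltW.
have dq : is_derive t (1 : R) (fun z : R => 1 + th * z) th.
  by apply: is_derive_eq; rewrite /GRing.scale/=; ring.
have [d _] := @is_derive_powR_comp R _ (- (r + 1)) t _ q dq.
have c : {for t, continuous (fun z : R => (1 + th * z) `^ (- (r + 1)))}.
  exact/differentiable_continuous/derivable1_diffP.
by apply: cvgM => //; exact: powR_continuous.
Qed.

Lemma majw_ge0 {R : realType} (r th t : R) : 0 <= majw r th t.
Proof. by rewrite mulr_ge0 ?powR_ge0. Qed.

Lemma majw_prim_ge0 {R : realType} (r th t : R) : 0 < r -> 0 <= majw_prim r th t.
Proof. by move=> r0; rewrite mulr_ge0 ?powR_ge0// invr_ge0 ltW. Qed.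

Lemma majw_prim_le {R : realType} (r th t : R) : 0 < r -> 0 < th -> 0 < t ->
  majw_prim r th t <= r^-1 * th `^ (- r).
Proof.
move=> r0 th0 t0; have q : 0 < 1 + th * t by rewrite ltr_pwDl// mulr_ge0// ltW.
rewrite ler_wpM2l ?invr_ge0 ?(ltW r0)//.
have -> : th `^ (- r) = (th^-1) `^ r.
  by rewrite -(powR_inv1 (ltW th0)) -powRrM mulN1r.
apply: ge0_ler_powR; rewrite ?nnegrE ?(ltW r0) ?divr_ge0 ?invr_ge0 ?(ltW t0) ?(ltW q) ?(ltW th0)//.
by rewrite ler_pdivrMr// mulrDr mulr1 mulKf ?gt_eqF// lerDr invr_ge0 ltW.
Qed.

Lemma majw_prim_le_powR {R : realType} (r th t : R) : 0 < r -> 0 <= th -> 0 < t ->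
  majw_prim r th t <= r^-1 * t `^ r.
Proof.
move=> r0 th0 t0; have q : 0 < 1 + th * t by rewrite ltr_pwDl// mulr_ge0// ltW.
rewrite ler_wpM2l ?invr_ge0 ?(ltW r0)//.
apply: ge0_ler_powR; rewrite ?nnegrE ?(ltW r0) ?divr_ge0 ?(ltW t0) ?(ltW q)//.
by rewrite ler_pdivrMr// ler_peMr ?(ltW t0)// lerDl mulr_ge0// ltW.
Qed.

Lemma majw_integrable {R : realType} (r th : R) : 0 < r -> 0 < th ->
  mu.-integrable `]0, +oo[ (EFin \o majw r th).
Proof.
move=> r0 th0.
apply: (@exhausts_integrable _ _ _ _ (majw_prim r th) _ (r^-1 * th `^ (- r)) (exhausts_ray (ltr01))).
- by move=> t /=; rewrite in_itv/= andbT => t0; apply: majw_prim_derive => //; exact: ltW.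
- by move=> t /=; rewrite in_itv/= andbT => t0; apply: majw_continuous => //; exact: ltW.
- by move=> t _; exact: majw_ge0.
- move=> t /=; rewrite in_itv/= andbT => t0.
  by rewrite ger0_norm ?majw_prim_ge0// majw_prim_le.
Qed.

Lemma majw_prim_cvg0 {R : realType} (r th : R) : 0 < r -> 0 <= th ->
  (fun n => majw_prim r th (1 / (n + 3)%:R)) @ \oo --> (0 : R).
Proof.
move=> r0 th0.
have p (n : nat) : 0 < 1 / (n + 3)%:R :> R by rewrite divr_gt0// ltr0n addn_gt0 orbT.
have h : (fun n => r^-1 * (1 / (n + 3)%:R) `^ r) @ \oo --> (0 : R).
  rewrite -[X in _ --> X](mulr0 r^-1); apply: cvgMl_tmp; apply: powR_seq_cvg0 => //.
  exact: cvg_inv_succ.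
apply: (@squeeze_cvgr _ _ _ _ (fun=> 0) _ _ _ _ _ h); last exact: cvg_cst.
by near=> n; rewrite majw_prim_ge0//= majw_prim_le_powR.
Unshelve. all: by end_near.
Qed.

Lemma majw_prim_cvg1 {R : realType} (r th : R) : 0 < r -> 0 <= th ->
  (fun n => majw_prim r th (1 - 1 / (n + 3)%:R)) @ \oo --> majw_prim r th 1.
Proof.
move=> r0 th0.
have [d _] := @majw_prim_derive R r th 1 r0 th0 ltr01.
have c : {for 1, continuous (majw_prim r th)}.
  exact/differentiable_continuous/derivable1_diffP.
apply: continuous_cvg; first exact: c.
rewrite -[X in _ --> X]subr0; apply: cvgB; first exact: cvg_cst.
exact: cvg_inv_succ.
Qed.

Lemma majw01 {R : realType} (r th : R) : 0 < r -> 0 < th ->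
  mu.-integrable `]0, 1[ (EFin \o majw r th) /\
  \int[mu]_(t in `]0, 1[) majw r th t <= r^-1 * th `^ (- r).
Proof.
move=> r0 th0; have ex := @exhausts_bounded R 1 ltr01.
have i : mu.-integrable `]0, 1[ (EFin \o majw r th).
  apply: (@integrable_sub R `]0, +oo[); [exact: measurable_itv|exact: measurable_itv| |exact: majw_integrable].
  by move=> t /=; rewrite !in_itv/= andbT => /andP[].
split => //.
have -> : \int[mu]_(t in `]0, 1[) majw r th t = majw_prim r th 1 - 0;
  last by rewrite subr0 majw_prim_le.
apply: (@exhausts_FTC R _ _ _ (majw_prim r th) _ 0 (majw_prim r th 1) ex i).
- by move=> t /=; rewrite in_itv/= => /andP[t0 _]; apply: majw_prim_derive => //; exact: ltW.
- by move=> t /=; rewrite in_itv/= => /andP[t0 _]; apply: majw_continuous => //; exact: ltW.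
- exact: majw_prim_cvg0 (ltW th0).
- exact: majw_prim_cvg1 (ltW th0).
Qed.

Lemma majw01_rev {R : realType} (r th : R) : 0 < r -> 0 < th ->
  mu.-integrable `]0, 1[ (EFin \o (fun t => majw r th (1 - t))) /\
  \int[mu]_(t in `]0, 1[) majw r th (1 - t) <= r^-1 * th `^ (- r).
Proof.
move=> r0 th0; have ex := @exhausts_bounded R 1 ltr01.
have dG (t : R) : `]0, 1[%classic t ->
    is_derive t (1 : R) (fun z => - majw_prim r th (1 - z)) (majw r th (1 - t)).
  rewrite /= in_itv/= => /andP[t0 t1].
  have t1' : 0 < 1 - t by rewrite subr_gt0.
  have d1 := majw_prim_derive r0 (ltW th0) t1'.
  have d0 : is_derive t (1 : R) (fun z : R => 1 - z) (- 1).
    by apply: is_derive_eq; ring.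
  have d : is_derive t (1 : R) (- (majw_prim r th \o (fun z => 1 - z))) _ := is_deriveN (@is_derive1_comp R (majw_prim r th) (fun z : R => 1 - z) t _ _ d1 d0).
  by apply: (is_derive_eq d); rewrite mulrN1 opprK.
have cg (t : R) : `]0, 1[%classic t -> {for t, continuous (fun z : R => majw r th (1 - z))}.
  rewrite /= in_itv/= => /andP[t0 t1].
  have t1' : 0 < 1 - t by rewrite subr_gt0.
  apply: continuous_cvg; first exact: majw_continuous (ltW th0) t1'.
  by apply: cvgB; [exact: cvg_cst | exact: cvg_id].
have i : mu.-integrable `]0, 1[ (EFin \o (fun t => majw r th (1 - t))).
  apply: (exhausts_integrable (M := r^-1 * th `^ (- r)) ex dG cg).
    by move=> t _; exact: majw_ge0.
  move=> t /=; rewrite in_itv/= => /andP[t0 t1].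
  by rewrite normrN ger0_norm ?majw_prim_ge0// majw_prim_le// subr_gt0.
split => //.
have -> : \int[mu]_(t in `]0, 1[) majw r th (1 - t) = - 0 - - majw_prim r th 1;
  last by rewrite opprK oppr0 add0r majw_prim_le.
apply: (@exhausts_FTC R _ _ _ (fun z => - majw_prim r th (1 - z)) _ (- majw_prim r th 1) (- 0) ex i dG cg).
- apply: cvgN; exact: majw_prim_cvg1 (ltW th0).
- apply: cvgN; rewrite (_ : (fun n => _) = (fun n => majw_prim r th (1 / (n + 3)%:R))).
    exact: majw_prim_cvg0 (ltW th0).
  by apply/funext => n /=; congr majw_prim; ring.
Qed.

(** * Gamma weights *)

Definition gammaw {R : realType} (r s t : R) : R := t `^ (r - 1) * expR (- (s * t)).

Lemma gammaw_ge0 {R : realType} (r s t : R) : 0 <= gammaw r s t.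
Proof. by rewrite mulr_ge0 ?powR_ge0 ?expR_ge0. Qed.

Lemma gammaw_derive {R : realType} (r s t : R) : 0 < t ->
  is_derive t 1 (gammaw (r + 1) s) (r * gammaw r s t - s * gammaw (r + 1) s t).
Proof.
move=> t0; have d1 := @is_derive1_powR R r t t0.
have d0 : is_derive t (1 : R) (fun z : R => - (s * z)) (- s).
  by apply: is_derive_eq; rewrite /GRing.scale/=; ring.
have d2 := @is_derive1_comp R expR (fun z : R => - (s * z)) t _ _ (is_derive_expR _) d0.
have dd : is_derive t (1 : R) ((fun z : R => z `^ r) * (expR \o (fun z : R => - (s * z)))) _ := is_deriveM d1 d2.
rewrite /gammaw addrK; apply: (is_derive_eq dd); rewrite /GRing.scale/=; ring.
Qed.

Lemma gammaw_continuous {R : realType} (r s t : R) : 0 < t ->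
  {for t, continuous (gammaw r s)}.
Proof.
move=> t0; have [d _] := @gammaw_derive R (r - 1) s t t0.
rewrite subrK in d; exact/differentiable_continuous/derivable1_diffP.
Qed.

Lemma gammaw_le_majw {R : realType} (r s : R) : 0 < s ->
  exists2 C : R, 0 < C & forall t, 0 < t -> gammaw r s t <= C * majw r s t.
Proof.
move=> s0; have [C C0 h] := @expR_powR_bound R (r + 1).
by exists C => // t t0; rewrite /majw mulrCA ler_wpM2l ?powR_ge0// h// mulr_ge0 ?(ltW s0) ?(ltW t0).
Qed.

Lemma gammaw_integrable {R : realType} (r s : R) : 0 < r -> 0 < s ->
  mu.-integrable `]0, +oo[ (EFin \o gammaw r s).
Proof.
move=> r0 s0; have [C C0 h] := @gammaw_le_majw R r s s0.
apply: (@integrable_ge0_le R _ _ (fun t => C * majw r s t + 0 * majw r s t)).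
- exact: measurable_itv.
- apply: open_continuous_measurable_fun; first exact: interval_open.
  by move=> t; rewrite inE/= in_itv/= andbT; exact: gammaw_continuous.
- move=> t /=; rewrite in_itv/= andbT => t0; rewrite ger0_norm ?gammaw_ge0//.
  by rewrite mul0r addr0 h.
- by apply: integrable_lin; [exact: measurable_itv | exact: majw_integrable | exact: majw_integrable].
Qed.

Definition gamma_mass {R : realType} (r s : R) : R :=
  \int[mu]_(t in `]0, +oo[) gammaw r s t.

Lemma gamma_mass_succ {R : realType} (r s : R) : 0 < r -> 0 < s ->
  s * gamma_mass (r + 1) s = r * gamma_mass r s.
Proof.
move=> r0 s0; have mD : measurable (`]0, +oo[%classic : set R) by exact: measurable_itv.
have r10 : 0 < r + 1 by rewrite ltr_wpDr.
have i1 := gammaw_integrable r0 s0; have i2 := gammaw_integrable r10 s0.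
pose g t := r * gammaw r s t + (- s) * gammaw (r + 1) s t.
have ig : mu.-integrable `]0, +oo[ (EFin \o g) by exact: integrable_lin.
suff : \int[mu]_(t in `]0, +oo[) g t = 0 - 0.
  rewrite /g Rintegral_lin// subr0 mulNr => /eqP; rewrite subr_eq0 => /eqP e.
  by rewrite /gamma_mass -e.
apply: (@exhausts_FTC R _ _ _ (gammaw (r + 1) s) g 0 0 (exhausts_ray ltr01) ig).
- move=> t /=; rewrite in_itv/= andbT => t0.
  by rewrite /g mulNr; exact: gammaw_derive.
- move=> t /=; rewrite in_itv/= andbT => t0.
  by apply: cvgD; apply: cvgMl_tmp; exact: gammaw_continuous.
- have p (n : nat) : 0 < 1 / (n + 2)%:R :> R by rewrite divr_gt0// ltr0n addn_gt0 orbT.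
  have h : (fun n => (1 / (n + 2)%:R) `^ r) @ \oo --> (0 : R).
    by apply: powR_seq_cvg0 => //; exact: cvg_inv_succ.
  apply: (@squeeze_cvgr _ _ _ _ (fun=> 0) _ _ _ _ _ h); last exact: cvg_cst.
  near=> n; rewrite /= gammaw_ge0/= /gammaw addrK ler_piMr ?powR_ge0//.
  by rewrite -expR0 ler_expR oppr_le0 mulr_ge0 ?(ltW s0)// ltW.
- have [C C0 hC] := @gammaw_le_majw R (r + 1) s s0.
  pose K := C * (s `^ (- r)) / s.
  have h : (fun n => K / (n + 2)%:R) @ \oo --> (0 : R) by exact: cvg_inv_succ.
  apply: (@squeeze_cvgr _ _ _ _ (fun=> 0) _ _ _ _ _ h); last exact: cvg_cst.
  near=> n; rewrite /= gammaw_ge0/= mul1r.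
  set t := (n + 2)%:R : R.
  have t0 : 0 < t by rewrite ltr0n addn_gt0 orbT.
  apply: (le_trans (hC t t0)); rewrite /K -!mulrA ler_wpM2l ?(ltW C0)//.
  have q : 0 < 1 + s * t by rewrite ltr_pwDl// mulr_ge0// ltW.
  have -> : majw (r + 1) s t = r * majw_prim r s t * (1 + s * t)^-1 / (1 + s * t).
    rewrite /majw /majw_prim addrK powRM ?(ltW t0) ?invr_ge0 ?(ltW q)//.
    rewrite !mulrA mulfV ?gt_eqF// mul1r -!mulrA; congr (_ * _).
    have -> : - (r + 1 + 1) = - r - 2%:R by ring.
    rewrite powRD ?(gt_eqF q) ?implybT// powR_invn ?(ltW q)//.
    rewrite -[X in _ = X `^ r * _]powR_inv1 ?(ltW q)// -powRrM mulN1r.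
    by rewrite -invfM -expr2.
  have h1 := majw_prim_le r0 s0 t0.
  apply: (@le_trans _ _ (r * (r^-1 * s `^ (- r)) * (1 + s * t)^-1)).
    apply: (@le_trans _ _ (r * majw_prim r s t * (1 + s * t)^-1)).
      rewrite ler_piMr//; last by rewrite invf_le1// lerDl mulr_ge0// ltW.
      by rewrite mulr_ge0 ?invr_ge0 ?(ltW q)// mulr_ge0 ?majw_prim_ge0// ltW.
    by rewrite ler_wpM2r ?invr_ge0 ?(ltW q)// ler_wpM2l// ltW.
  rewrite mulVKf ?gt_eqF// ler_wpM2l ?powR_ge0// -invfM.
  by rewrite lef_pV2 ?posrE ?mulr_gt0// lerDr.
Unshelve. all: by end_near.
Qed.

Lemma gamma_mass_gt0 {R : realType} (r s : R) : 0 < r -> 0 < s -> 0 < gamma_mass r s.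
Proof.
move=> r0 s0.
pose c := (1 `^ (- (r - 1)) + 2 `^ (- (r - 1)))^-1 * expR (- (s * 2)).
have p : 0 < 1 `^ (- (r - 1)) + 2 `^ (- (r - 1)) :> R by rewrite addr_gt0 ?powR_gt0.
have c0 : 0 < c by rewrite mulr_gt0 ?invr_gt0 ?expR_gt0.
apply: (@lt_le_trans _ _ (c * (2 - 1))); first by rewrite mulr_gt0//; lra.
have i1 := gammaw_integrable r0 s0.
apply: Rintegral_ge_sub => //.
- by move=> t _; exact: gammaw_ge0.
- by lra.
- exact: ltW.
- move=> t /andP[h1 h2]; have t0 : 0 < t by lra.
  split; first by rewrite /= in_itv/= andbT.
  rewrite /c /gammaw -[X in _ <= X * _]invrK -powRN.
  apply: ler_pM; rewrite ?invr_ge0 ?expR_ge0 ?(ltW p)//.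
    by rewrite lef_pV2 ?posrE ?powR_gt0// powR_between// h1.
  by rewrite ler_expR lerN2 ler_wpM2l// ltW.
Qed.

Lemma gamma_moment {R : realType} (r s : R) k : 0 < r -> 0 < s ->
  mu.-integrable `]0, +oo[ (EFin \o (fun t => gammaw r s t * t ^+ k)) /\
  \int[mu]_(t in `]0, +oo[) (gammaw r s t * t ^+ k) =
  poch r k * s^-1 ^+ k * gamma_mass r s.
Proof.
move=> r0 s0.
have e (j : nat) t : `]0, +oo[%classic t -> gammaw (r + j%:R) s t = gammaw r s t * t ^+ j.
  rewrite /= in_itv/= andbT => t0; rewrite /gammaw.
  rewrite (_ : r + j%:R - 1 = (r - 1) + j%:R); last by ring.
  rewrite (@powRD _ t (r - 1) j%:R) ?(gt_eqF t0)/= ?implybT//.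
  by rewrite powR_mulrn ?(ltW t0)//; ring.
have rj (j : nat) : 0 < r + j%:R by rewrite ltr_pwDl.
split.
  apply: (@eq_integrableR _ _ (gammaw (r + k%:R) s)); [exact: measurable_itv|exact: e|].
  exact: gammaw_integrable.
have -> : \int[mu]_(t in `]0, +oo[) (gammaw r s t * t ^+ k) = gamma_mass (r + k%:R) s.
  by apply: eq_Rintegral => t; rewrite inE => h; rewrite e.
elim: k => [|k IH]; first by rewrite addr0 poch0 expr0 !mul1r.
have := gamma_mass_succ (rj k) s0; rewrite IH -natr1 addrA => h.
have sn : s != 0 by rewrite gt_eqF.
by apply: (mulfI sn); rewrite h pochS exprS; field.
Qed.

(** The Laplace transform of a power series multiplies its coefficients by
    rising factorials. *)
Lemma gamma_transform {R : realType} (r s y : R) (g : nat -> R) :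
  0 < r -> 0 < s -> growth 0 2 g ->
  mu.-integrable `]0, +oo[ (EFin \o (fun t => gammaw r s t * psum g (y * t))) /\
  \int[mu]_(t in `]0, +oo[) (gammaw r s t * psum g (y * t)) =
  gamma_mass r s * psum (fun k => g k * poch r k) (y / s).
Proof.
move=> r0 s0 gg.
have gr : growth 0 1 (fun k => g k * poch r k).
  by apply: growthS; exact: (growthM gg (poch_growth r)).
have gr2 : growth 0 1 (fun k => g k * (poch r k * s^-1 ^+ k * gamma_mass r s)).
  have := growthZ (gamma_mass r s) (growthM gr (growth_pow s^-1)).
  by apply: eq_growth => k; ring.
have [||i ->] := @weighted_transform R `]0, +oo[ (gammaw r s) (fun t => t)
  _ g y (measurable_itv _) _ _ (fun k => gamma_moment k r0 s0) (growth_weak gg) gr2.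
- by move=> t _; exact: gammaw_ge0.
- by move=> t /=; rewrite in_itv/= andbT => /ltW.
split => //; rewrite -psumZ// -psum_scale; apply: eq_psum => k; ring.
Qed.

Lemma GammaE {R : realType} (r : R) : Gamma r = gamma_mass r 1.
Proof. by apply: eq_Rintegral => t _; rewrite /gammaw mul1r. Qed.

Lemma Gamma_poch {R : realType} (r : R) k : 0 < r -> Gamma (r + k%:R) = poch r k * Gamma r.
Proof.
move=> r0; elim: k => [|k IH]; first by rewrite addr0 poch0 mul1r.
have rk : 0 < r + k%:R by rewrite ltr_pwDl.
have := gamma_mass_succ rk (@ltr01 R); rewrite -!GammaE IH mul1r -natr1 addrA => ->.
by rewrite pochS; ring.
Qed.

Lemma Gamma_gt0 {R : realType} (r : R) : 0 < r -> 0 < Gamma r.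
Proof. by move=> r0; rewrite GammaE gamma_mass_gt0. Qed.

(** * The Bessel integral as a hypergeometric function *)

Definition bessel_coef {R : realType} (alpha : R) (k : nat) : R :=
  (k`!%:R * poch (alpha + 1) k)^-1.

Lemma bessel_coef_growth {R : realType} (alpha : R) : -1 < alpha -> growth 0 1 (bessel_coef alpha).
Proof.
move=> a1; have p : 0 < alpha + 1 by lra.
apply: growth_weak; have := growthM inv_fact_growth (inv_poch_growth p).
by apply: eq_growth => k; rewrite /bessel_coef invfM.
Qed.

(** Gamma(k+alpha+1) is Gamma(alpha+1) times a rising factorial. *)
Lemma besselJ_psum {R : realType} (alpha t : R) : -1 < alpha -> 0 < t ->
  besselJ alpha t = (2 `^ alpha * Gamma (alpha + 1))^-1 * t `^ alpha *
    psum (bessel_coef alpha) (- (1 / 4) * t ^+ 2).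
Proof.
move=> a1 t0; have p : 0 < alpha + 1 by lra.
have g0 := Gamma_gt0 p.
rewrite /besselJ -psumZ; last exact: bessel_coef_growth.
congr (limn (series _)); apply/funext => k; rewrite /besselJ_coeff /bessel_coef /=.
have -> : k%:R + alpha + 1 = (alpha + 1) + k%:R by ring.
rewrite (Gamma_poch _ p).
have t2 : 0 < t / 2 by rewrite divr_gt0.
rewrite (@powRD _ (t / 2) k.*2%:R alpha) ?(gt_eqF t2)/= ?implybT//.
rewrite (powR_mulrn _ (ltW t2)) powRM ?(ltW t0)//.
rewrite (_ : (2^-1 `^ alpha) = (2 `^ alpha)^-1); last first.
  by rewrite -powR_inv1// powRAC powR_inv1// powR_ge0.
have -> : - (1 / 4) * t ^+ 2 = - 1 * (t / 2) ^+ 2 by field.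
rewrite (exprMn _ (- 1)) -exprM mul2n.
have h1 := @fact_neq0 R k; have h2 := poch_gt0 k p; have h3 : 0 < 2 `^ alpha :> R by rewrite powR_gt0.
by field; rewrite h1/= !gt_eqF.
Qed.

(** Termwise integration of the Bessel series against the weight
    (x^2-t^2)^gamma t^(alpha-beta). *)
Lemma bessel_integral_hyp1F2 {R : realType} (alpha beta gamma x : R) :
  -1 < alpha -> -1 < gamma -> beta < alpha + 1 -> 0 < x ->
  bessel_integral alpha beta gamma x =
  (2 `^ alpha * Gamma (alpha + 1))^-1 * beta_mass gamma (alpha - beta) x *
  hyp1F2 ((alpha - beta + 1) / 2) (alpha + 1) ((alpha - beta + 1) / 2 + gamma + 1) (x ^+ 2 / 4).
Proof.
move=> a1 g1 ba x0; have s1 : -1 < alpha - beta by lra.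
have [i e] := beta_transform (- (1 / 4)) g1 s1 x0 (bessel_coef_growth a1).
rewrite -mulrA; set K := _^-1.
have -> : hyp1F2 ((alpha - beta + 1) / 2) (alpha + 1) ((alpha - beta + 1) / 2 + gamma + 1) (x ^+ 2 / 4) =
   psum (fun k => bessel_coef alpha k * (poch ((alpha - beta + 1) / 2) k / poch ((alpha - beta + 1) / 2 + gamma + 1) k)) (- (1 / 4) * x ^+ 2).
  rewrite /hyp1F2 -[- (x ^+ 2 / 4)](_ : - (1 / 4) * x ^+ 2 = _); last by field.
  by apply: eq_psum => k; rewrite /hyp1F2_coef /bessel_coef !invfM; ring.
rewrite -e -RintegralZl; [|exact: measurable_itv|exact: i].
apply: eq_Rintegral => t; rewrite inE/= in_itv/= => /andP[t0 tx].
rewrite (besselJ_psum a1 t0) /betaw powRD ?(gt_eqF t0)/= ?implybT// -/K; ring.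
Qed.

Lemma bessel_integral_sign {R : realType} (alpha beta gamma x : R) :
  -1 < alpha -> -1 < gamma -> beta < alpha + 1 -> 0 < x ->
  exists2 K : R, 0 < K & bessel_integral alpha beta gamma x = K *
  hyp1F2 ((alpha - beta + 1) / 2) (alpha + 1) ((alpha - beta + 1) / 2 + gamma + 1) (x ^+ 2 / 4).
Proof.
move=> a1 g1 ba x0; rewrite (bessel_integral_hyp1F2 a1 g1 ba x0); eexists; last by [].
by rewrite mulr_gt0 ?invr_gt0 ?mulr_gt0 ?powR_gt0 ?Gamma_gt0 ?beta_mass_gt0//; lra.
Qed.

(** With a = (alpha-beta+1)/2, b = alpha+1, c = a+gamma+1, the two lower bounds
    in the definition of the region are b+c >= 3a+1/2 and
    (b-a)(c-a) >= a/2. *)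
Lemma Sstar_positive {R : realType} (gamma alpha beta : R) :
  -1 < gamma -> Sstar gamma (alpha, beta) ->
  (forall x : R, 0 < x -> 0 <= bessel_integral alpha beta gamma x) /\
  (~ ((alpha = gamma + 1 / 2 /\ beta = - (gamma + 1 / 2)) \/
      (gamma = - (1 / 2) /\ beta = 0)) ->
   forall x : R, 0 < x -> 0 < bessel_integral alpha beta gamma x).
Proof.
move=> g1 [a1]; rewrite ge_max => /andP[/andP[h1 h2] h3].
have g3 : 0 < 2 * gamma + 3 by lra.
have h2' : - (2 * gamma + 1) * (alpha + 1) <= beta * (2 * gamma + 3).
  by rewrite -ler_pdivrMr// mulrAC mulNr.
have h4 : - alpha - 1 < beta.
  rewrite -(ltr_pM2r g3); apply: lt_le_trans h2'.
  by rewrite -subr_gt0; have -> : - (2 * gamma + 1) * (alpha + 1) - (- alpha - 1) * (2 * gamma + 3) = 2 * (alpha + 1); [ring|lra].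
have h5 : (alpha - beta + 1) / 2 / 2 <= (alpha + 1 - (alpha - beta + 1) / 2) * ((alpha - beta + 1) / 2 + gamma + 1 - (alpha - beta + 1) / 2).
  rewrite -subr_ge0.
  have -> : (alpha + 1 - (alpha - beta + 1) / 2) * ((alpha - beta + 1) / 2 + gamma + 1 - (alpha - beta + 1) / 2) - (alpha - beta + 1) / 2 / 2 = (beta * (2 * gamma + 3) - - (2 * gamma + 1) * (alpha + 1)) / 4 by field.
  by rewrite divr_ge0// subr_ge0.
have main (x : R) : 0 < x -> 0 <= bessel_integral alpha beta gamma x /\
  (~ ((alpha = gamma + 1 / 2 /\ beta = - (gamma + 1 / 2)) \/
           (gamma = - (1 / 2) /\ beta = 0)) -> 0 < bessel_integral alpha beta gamma x).
  move=> x0; have [K K0 ->] := bessel_integral_sign a1 g1 h3 x0.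
  have y0 : 0 < x ^+ 2 / 4 by rewrite divr_gt0// exprn_gt0.
  have [||||p1 p2] := @hyp1F2_positive R ((alpha - beta + 1) / 2) (alpha + 1)
     ((alpha - beta + 1) / 2 + gamma + 1) (x ^+ 2 / 4) _ _ _ _ h5 y0; try lra.
  split; first by rewrite mulr_ge0// ltW.
  move=> ne; rewrite mulr_gt0//; apply: p2 => -[[e1 e2]|[e1 e2]]; apply: ne; [left|right]; split; lra.
by split=> [x x0|ne x x0]; have [u v] := main x x0; [exact: u|exact: v].
Qed.

(** * Gaussian estimates for beta and gamma weights *)

Lemma Rintegral_le {R : realType} (D : set R) (f g : R -> R) :
  measurable D -> mu.-integrable D (EFin \o f) ->
  mu.-integrable D (EFin \o g) ->
  (forall x, D x -> f x <= g x) ->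
  \int[mu]_(x in D) f x <= \int[mu]_(x in D) g x.
Proof. by move=> mD fi gi h; exact: le_Rintegral. Qed.

Lemma integrableZ {R : realType} (D : set R) (f : R -> R) (c : R) :
  measurable D -> mu.-integrable D (EFin \o f) ->
  mu.-integrable D (EFin \o (fun x => c * f x)).
Proof.
move=> mD fi; apply: (@eq_integrableR _ _ (fun x => c * f x + 0 * f x)) => //.
  by move=> x _; rewrite mul0r addr0.
exact: integrable_lin.
Qed.

Lemma RintegralZ {R : realType} (D : set R) (f : R -> R) (c : R) :
  measurable D -> mu.-integrable D (EFin \o f) ->
  \int[mu]_(x in D) (c * f x) = c * \int[mu]_(x in D) f x.
Proof. by move=> mD fi; exact: RintegralZl. Qed.

Lemma le_powR_neg {R : realType} (x y k : R) : 0 < x -> x <= y -> 0 <= k ->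
  y `^ (- k) <= x `^ (- k).
Proof.
move=> x0 xy k0; have y0 := lt_le_trans x0 xy.
by rewrite !powRN lef_pV2 ?posrE ?powR_gt0// ge0_ler_powR ?nnegrE ?(ltW x0) ?(ltW y0).
Qed.

(** Since z <= 1 + z^2, a Gaussian is at most e times an exponential. *)
Lemma gauss_bound {R : realType} (k : R) :
  exists2 C : R, 0 < C & forall z, 0 <= z -> expR (- z ^+ 2) <= C * (1 + z) `^ (- k).
Proof.
have [C C0 h] := @expR_powR_bound R k.
exists (expR 1 * C); first by rewrite mulr_gt0 ?expR_gt0.
move=> z z0; apply: (@le_trans _ _ (expR 1 * expR (- z))).
  by rewrite -expRD ler_expR; nra.
by rewrite -mulrA ler_wpM2l ?expR_ge0// h.
Qed.

Lemma gauss_powR {R : realType} (k : R) : 0 <= k ->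
  exists2 C : R, 0 < C & forall th, 0 < th -> expR (- (th / 2) ^+ 2) <= C * th `^ (- k).
Proof.
move=> k0; have [C C0 h] := @gauss_bound R k.
exists (C * 2 `^ k); first by rewrite mulr_gt0 ?powR_gt0.
move=> th th0; have t2 : 0 <= th / 2 by rewrite divr_ge0// ltW.
apply: (le_trans (h _ t2)); rewrite -mulrA ler_wpM2l ?(ltW C0)//.
apply: (@le_trans _ _ ((th / 2) `^ (- k))).
  by apply: le_powR_neg; rewrite ?divr_gt0// lerDr.
rewrite powRM ?(ltW th0) ?invr_ge0// mulrC -powR_inv1// -powRrM mulN1r opprK//.
Qed.

(** The mass is Gamma(r) s^(-r); the majorant gives this order without a change of variables. *)
Lemma gamma_mass_le {R : realType} (r : R) : 0 < r ->
  exists2 C : R, 0 < C & forall s, 0 < s -> gamma_mass r s <= C * s `^ (- r).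
Proof.
move=> r0; have [C C0 h] := @expR_powR_bound R (r + 1).
exists (C * r^-1); first by rewrite mulr_gt0// invr_gt0.
move=> s s0; have mD : measurable (`]0, +oo[%classic : set R) by exact: measurable_itv.
have im := majw_integrable r0 s0.
apply: (@le_trans _ _ (\int[mu]_(t in `]0, +oo[) (C * majw r s t))).
  apply: Rintegral_le => //; [exact: gammaw_integrable|exact: integrableZ|].
  move=> t /=; rewrite in_itv/= andbT => t0.
  by rewrite /majw mulrCA ler_wpM2l ?powR_ge0// h// mulr_ge0 ?(ltW s0) ?(ltW t0).
rewrite RintegralZ// -mulrA ler_wpM2l ?(ltW C0)//.
have cv := exhausts_cvg (@exhausts_ray R 1 ltr01) im.
rewrite -(cvg_lim (@Rhausdorff R) cv); apply: limr_le; first by apply/cvg_ex; eexists; exact: cv.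
apply: nearW => n.
have n0 : 0 < (n + 2)%:R :> R by rewrite ltr0n addn_gt0 orbT.
have p1 : 0 < 1 * (n + 2)%:R^-1 :> R by rewrite mul1r invr_gt0.
have [/(_ n) lt _ _ _] := @exhausts_ray R 1 ltr01.
apply: (@le_trans _ _ (majw_prim r s (1 * (n + 2)%:R) - majw_prim r s (1 * (n + 2)%:R^-1))).
  rewrite le_eqVlt; apply/orP; left; apply/eqP; apply: FTC_itv => // t /andP[h1 _].
    have t0 := lt_le_trans p1 h1.
    by apply: majw_prim_derive => //; exact: ltW.
  have t0 := lt_le_trans p1 h1.
  by apply: majw_continuous => //; exact: ltW.
apply: (@le_trans _ _ (majw_prim r s (1 * (n + 2)%:R))).
  by rewrite lerBlDr lerDl majw_prim_ge0.
by apply: majw_prim_le => //; rewrite mul1r.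
Qed.

Lemma gamma_mass_ge {R : realType} (r : R) : 0 < r ->
  exists2 C : R, 0 < C & forall s, 0 < s -> C * s `^ (- r) <= gamma_mass r s.
Proof.
move=> r0; pose d : R := 1 `^ (- (r - 1)) + 2 `^ (- (r - 1)).
have d0 : 0 < d by rewrite addr_gt0 ?powR_gt0.
exists (d^-1 * expR (- 2)); first by rewrite mulr_gt0 ?invr_gt0 ?expR_gt0.
move=> s s0; have sn : s != 0 by rewrite gt_eqF.
have -> : d^-1 * expR (- 2) * s `^ (- r) = d^-1 * expR (- 2) * s `^ (1 - r) * (2 / s - 1 / s).
  rewrite -[RHS]mulrA; congr (_ * _).
  have -> : 2 / s - 1 / s = s `^ (- 1) by rewrite powR_inv1 ?(ltW s0)//; ring.
  by rewrite -powRD ?sn ?implybT//; congr (_ `^ _); ring.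
apply: Rintegral_ge_sub => //; first exact: gammaw_integrable.
- by move=> t _; exact: gammaw_ge0.
- by rewrite ler_pM2r ?invr_gt0// ler1n.
- by rewrite !mulr_ge0 ?expR_ge0 ?powR_ge0// invr_ge0 ltW.
move=> t /andP[h1 h2].
have t0 : 0 < t by apply: lt_le_trans h1; rewrite divr_gt0.
split; first by rewrite /= in_itv/= andbT.
have st1 : 1 <= s * t by rewrite mulrC -ler_pdivrMr.
have st2 : s * t <= 2 by rewrite mulrC -ler_pdivlMr.
have -> : gammaw r s t = (s * t) `^ (r - 1) * expR (- (s * t)) * s `^ (1 - r).
  rewrite powRM ?(ltW s0) ?(ltW t0)// /gammaw.
  have e : s `^ (r - 1) * s `^ (1 - r) = 1.
    rewrite -powRD ?sn ?implybT// (_ : r - 1 + (1 - r) = 0) ?powRr0//; ring.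
  by rewrite -[LHS]mul1r -[X in X * _ = _]e; ring.
rewrite ler_wpM2r ?powR_ge0// ler_pM ?invr_ge0 ?expR_ge0 ?(ltW d0)//; last first.
  by rewrite ler_expR lerN2.
rewrite -[X in _ <= X]invrK -powRN lef_pV2 ?posrE ?powR_gt0 ?(lt_le_trans ltr01 st1)//.
by apply: powR_between => //; rewrite st1.
Qed.

Lemma betawM_integrable {R : realType} (g s : R) (h : R -> R) : -1 < g -> -1 < s ->
  continuous h -> (forall t, 0 < t < 1 -> 0 <= h t <= 1) ->
  mu.-integrable `]0, 1[ (EFin \o (fun t => betaw g s 1 t * h t)).
Proof.
move=> g1 s1 ch h01.
apply: (@integrable_ge0_le R _ _ (betaw g s 1)); first exact: measurable_itv.
- apply: measurable_funM; first exact: betaw_measurable.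
  apply: measurable_funTS; exact: continuous_measurable_fun.
- move=> t; rewrite /= in_itv/= => /h01/andP[h0 h1].
  rewrite ger0_norm; last by apply: mulr_ge0 => //; exact: betaw_ge0.
  by rewrite (ler_piMr (betaw_ge0 _ _ _ _) h1).
- exact: betaw_integrable.
Qed.

Lemma gauss_continuous {R : realType} (u v : R) :
  continuous (fun t : R => expR (- (u * t + v) ^+ 2)).
Proof.
move=> t.
have [d _] : is_derive t (1 : R) (fun z : R => - (u * z + v) ^+ 2) (- (2 * u * (u * t + v))).
  by apply: is_derive_eq; rewrite /GRing.scale/=; ring.
have c : {for t, continuous (fun z : R => - (u * z + v) ^+ 2)}.
  exact/differentiable_continuous/derivable1_diffP.
apply: (@continuous_comp _ _ _ (fun z : R => - (u * z + v) ^+ 2) expR) => //.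
exact: continuous_expR.
Qed.

Lemma beta_gauss_integrable {R : realType} (g s u v : R) : -1 < g -> -1 < s ->
  mu.-integrable `]0, 1[
    (EFin \o (fun t => betaw g s 1 t * expR (- (u * t + v) ^+ 2))).
Proof.
move=> g1 s1; apply: betawM_integrable => //; first exact: gauss_continuous.
by move=> t _; rewrite expR_ge0/= -expR0 ler_expR oppr_le0 sqr_ge0.
Qed.

(** For t <= 1/2 the weight is comparable with t^s and the Gaussian with the
    majorant; for t >= 1/2 the Gaussian is smaller than any power of th. *)
Lemma beta_gauss0 {R : realType} (g s : R) : -1 < g -> -1 < s ->
  exists2 C : R, 0 < C & forall th, 0 < th ->
    \int[mu]_(t in `]0, 1[) (betaw g s 1 t * expR (- (th * t) ^+ 2))
      <= C * th `^ (- (s + 1)).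
Proof.
move=> g1 s1; have s10 : 0 < s + 1 by lra.
have [C1 C10 h1] := @gauss_bound R (s + 1 + 1).
have [C2 C20 h2] := gauss_powR (ltW s10).
pose Cg : R := (3 / 4) `^ g + 1 `^ g.
have Cg0 : 0 < Cg by rewrite addr_gt0 ?powR_gt0// divr_gt0.
exists (Cg * C1 * (s + 1)^-1 + C2 * beta_mass g s 1).
  by rewrite addr_gt0 ?mulr_gt0 ?invr_gt0 ?beta_mass_gt0.
move=> th th0; have mD : measurable (`]0, 1[%classic : set R) by exact: measurable_itv.
have ib := betaw_integrable g1 s1 (@ltr01 R).
have [im lem] := majw01 s10 th0.
apply: (@le_trans _ _ (\int[mu]_(t in `]0, 1[)
   ((Cg * C1) * majw (s + 1) th t + (C2 * th `^ (- (s + 1))) * betaw g s 1 t))).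
  apply: Rintegral_le => //; [|exact: integrable_lin|].
    apply: (@eq_integrableR _ _ (fun t => betaw g s 1 t * expR (- (th * t + 0) ^+ 2))) => //.
      by move=> t _; rewrite addr0.
    exact: beta_gauss_integrable.
  move=> t /=; rewrite in_itv/= => /andP[t0 t1].
  have [th2|th2] := leP t (1 / 2).
    rewrite -[leLHS]addr0 lerD ?mulr_ge0 ?powR_ge0 ?(ltW C20)//.
    rewrite /betaw /majw addrK expr1n.
    have -> : Cg * C1 * (t `^ s * (1 + th * t) `^ (- (s + 1 + 1))) =
      Cg * t `^ s * (C1 * (1 + th * t) `^ (- (s + 1 + 1))) by ring.
    apply: ler_pM; rewrite ?mulr_ge0 ?powR_ge0 ?expR_ge0//.
      by rewrite ler_wpM2r ?powR_ge0// powR_between//; nra.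
    by apply: h1; rewrite mulr_ge0// ltW.
  rewrite -[leLHS]add0r lerD ?mulr_ge0 ?powR_ge0 ?(ltW Cg0) ?(ltW C10)//.
  rewrite mulrC ler_wpM2r ?betaw_ge0//; apply: le_trans (h2 _ th0).
  by rewrite ler_expR lerN2 ler_sqr ?nnegrE; nra.
rewrite Rintegral_lin// [leRHS]mulrDl lerD//.
  by rewrite -!mulrA ler_wpM2l ?(ltW Cg0)// ler_wpM2l ?(ltW C10)//.
by rewrite /beta_mass mulrAC.
Qed.

(** The same concentration at the other end point, where the weight is comparable with (1-t)^g. *)
Lemma beta_gauss1 {R : realType} (g s : R) : -1 < g -> -1 < s ->
  exists2 C : R, 0 < C & forall th, 0 < th ->
    \int[mu]_(t in `]0, 1[) (betaw g s 1 t * expR (- (th * (1 - t)) ^+ 2))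
      <= C * th `^ (- (g + 1)).
Proof.
move=> g1 s1; have s10 : 0 < g + 1 by lra.
have [C1 C10 h1] := @gauss_bound R (g + 1 + 1).
have [C2 C20 h2] := gauss_powR (ltW s10).
pose Cg : R := (1 `^ g + 2 `^ g) * ((1 / 2) `^ s + 1 `^ s).
have Cg0 : 0 < Cg by rewrite mulr_gt0 ?addr_gt0 ?powR_gt0// divr_gt0.
exists (Cg * C1 * (g + 1)^-1 + C2 * beta_mass g s 1).
  by rewrite addr_gt0 ?mulr_gt0 ?invr_gt0 ?beta_mass_gt0.
move=> th th0; have mD : measurable (`]0, 1[%classic : set R) by exact: measurable_itv.
have ib := betaw_integrable g1 s1 (@ltr01 R).
have [im lem] := majw01_rev s10 th0.
apply: (@le_trans _ _ (\int[mu]_(t in `]0, 1[)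
   ((Cg * C1) * majw (g + 1) th (1 - t) + (C2 * th `^ (- (g + 1))) * betaw g s 1 t))).
  apply: Rintegral_le => //; [|exact: (@integrable_lin R _ (fun t => majw (g + 1) th (1 - t)))|].
    apply: (@eq_integrableR _ _ (fun t => betaw g s 1 t * expR (- ((- th) * t + th) ^+ 2))) => //.
      by move=> t _; congr (_ * expR (- _ ^+ 2)); ring.
    exact: beta_gauss_integrable.
  move=> t /=; rewrite in_itv/= => /andP[t0 t1].
  have [th2|th2] := leP (1 / 2) t.
    rewrite -[leLHS]addr0 lerD ?mulr_ge0 ?powR_ge0 ?(ltW C20)//.
    have t10 : 0 < 1 - t by lra.
    rewrite /betaw /majw addrK expr1n (_ : 1 - t ^+ 2 = (1 + t) * (1 - t)); last by ring.
    rewrite powRM ?(ltW t10)//; last by lra.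
    have -> : Cg * C1 * ((1 - t) `^ g * (1 + th * (1 - t)) `^ (- (g + 1 + 1))) =
      (Cg * (1 - t) `^ g) * (C1 * (1 + th * (1 - t)) `^ (- (g + 1 + 1))) by ring.
    apply: ler_pM; rewrite ?mulr_ge0 ?powR_ge0 ?expR_ge0//.
      rewrite mulrAC ler_wpM2r ?powR_ge0//; apply: ler_pM; rewrite ?powR_ge0//.
        by apply: powR_between; lra.
      by apply: powR_between; lra.
    by apply: h1; rewrite mulr_ge0// ltW.
  rewrite -[leLHS]add0r lerD ?mulr_ge0 ?powR_ge0 ?(ltW Cg0) ?(ltW C10)//.
  rewrite mulrC ler_wpM2r ?betaw_ge0//; apply: le_trans (h2 _ th0).
  by rewrite ler_expR lerN2 ler_sqr ?nnegrE; nra.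
rewrite (@Rintegral_lin R _ (fun t => majw (g + 1) th (1 - t)))// [leRHS]mulrDl lerD//.
  rewrite -[leRHS]mulrA; apply: (ler_wpM2l _ lem).
  by rewrite mulr_ge0 ?(ltW Cg0) ?(ltW C10).
by rewrite /beta_mass mulrAC.
Qed.

(** * First necessary condition: a Laplace transform *)

Lemma expR_psum {R : realType} (z : R) : psum (fun k => k`!%:R^-1) z = expR z.
Proof.
rewrite /psum /expR; congr (limn (series _)); apply/funext => k.
by rewrite /exp_coeff/= mulrC.
Qed.

Lemma hyp1F2_psum {R : realType} (a b c y : R) :
  hyp1F2 a b c y = psum (hyp1F2_coef a b c) (-1 * y).
Proof. by rewrite mulN1r. Qed.

Lemma beta_exp {R : realType} (a c T : R) : 0 < a -> a < c ->
  \int[mu]_(t in `]0, 1[) (betaw (c - a - 1) (2 * a - 1) 1 t * expR (- T * t ^+ 2)) =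
  beta_mass (c - a - 1) (2 * a - 1) 1 *
    psum (fun k => poch a k / (k`!%:R * poch c k)) (- T).
Proof.
move=> a0 ac; have g1 : -1 < c - a - 1 by lra.
have s1 : -1 < 2 * a - 1 by lra.
have [_] := beta_transform (- T) g1 s1 (@ltr01 R) (@inv_fact_growth R).
under eq_Rintegral do rewrite expR_psum.
move=> ->; rewrite expr1n mulr1; congr (_ * _); apply: eq_psum => k.
have -> : (2 * a - 1 + 1) / 2 = a by field.
have -> : a + (c - a - 1) + 1 = c by ring.
by rewrite invfM; ring.
Qed.

(** Weighting by y^(b-1) cancels the index b, and the remaining series
    1F1(a;c;-1/s) is a beta average of exponentials. *)
Lemma laplace_hyp1F2 {R : realType} (a b c s : R) : 0 < a -> 0 < b -> a < c -> 0 < s ->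
  mu.-integrable `]0, +oo[ (EFin \o (fun y => gammaw b s y * hyp1F2 a b c y)) /\
  \int[mu]_(y in `]0, +oo[) (gammaw b s y * hyp1F2 a b c y) =
  gamma_mass b s * (beta_mass (c - a - 1) (2 * a - 1) 1)^-1 *
  \int[mu]_(t in `]0, 1[) (betaw (c - a - 1) (2 * a - 1) 1 t * expR (- s^-1 * t ^+ 2)).
Proof.
move=> a0 b0 ac s0; have c0 : 0 < c by exact: lt_trans ac.
have [i e] := gamma_transform (-1) b0 s0 (hyp1F2_coef_growth a b0 c0).
split.
  apply: (eq_integrableR _ _ i); [exact: measurable_itv | by move=> y _; rewrite hyp1F2_psum].
under eq_Rintegral do rewrite hyp1F2_psum.
rewrite e beta_exp// -[RHS]mulrA mulKf; last by rewrite gt_eqF// beta_mass_gt0//; lra.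
rewrite mulN1r; congr (_ * _); apply: eq_psum => k; rewrite /hyp1F2_coef.
have h1 := gt_eqF (poch_gt0 k b0); have h2 := gt_eqF (poch_gt0 k c0).
by field; rewrite h1 h2/= pnatr_eq0 -lt0n fact_gt0.
Qed.

(** The beta average concentrates at t = 0, at scale the square root of s. *)
Lemma laplace_upper {R : realType} (a b c : R) : 0 < a -> 0 < b -> a < c ->
  exists2 C : R, 0 < C & forall s, 0 < s ->
  \int[mu]_(y in `]0, +oo[) (gammaw b s y * hyp1F2 a b c y) <= C * s `^ (a - b).
Proof.
move=> a0 b0 ac; have g1 : -1 < c - a - 1 by lra.
have s1 : -1 < 2 * a - 1 by lra.
have [C1 C10 h1] := gamma_mass_le b0; have [C2 C20 h2] := beta_gauss0 g1 s1.
have B0 := beta_mass_gt0 g1 s1 (@ltr01 R).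
exists (C1 * (beta_mass (c - a - 1) (2 * a - 1) 1)^-1 * C2).
  by rewrite !mulr_gt0 ?invr_gt0.
move=> s s0; have [_ ->] := laplace_hyp1F2 a0 b0 ac s0.
have sn : s != 0 by rewrite gt_eqF.
(* The Gaussian bound is applied with th^2 = 1/s. *)
pose th := s `^ (- (1 / 2)).
have th0 : 0 < th by rewrite powR_gt0.
have e2 : th ^+ 2 = s^-1.
  rewrite -powR_mulrn ?(ltW th0)// -powRrM -(powR_inv1 (ltW s0)).
  by rewrite (_ : - (1 / 2) * 2%:R = - 1)//; field.
have e3 : th `^ (- (2 * a - 1 + 1)) = s `^ a.
  by rewrite -powRrM (_ : - (1 / 2) * - (2 * a - 1 + 1) = a)//; field.
have e4 : s `^ (a - b) = s `^ (- b) * s `^ a by rewrite -powRD ?sn ?implybT// addrC.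
have := h2 _ th0; rewrite e3.
have -> : \int[mu]_(t in `]0, 1[) (betaw (c - a - 1) (2 * a - 1) 1 t * expR (- (th * t) ^+ 2)) =
  \int[mu]_(t in `]0, 1[) (betaw (c - a - 1) (2 * a - 1) 1 t * expR (- s^-1 * t ^+ 2)).
  by apply: eq_Rintegral => t _; rewrite exprMn e2 -mulNr.
move=> h2'; rewrite e4.
have -> : C1 * (beta_mass (c - a - 1) (2 * a - 1) 1)^-1 * C2 * (s `^ (- b) * s `^ a) =
  (C1 * s `^ (- b) * (beta_mass (c - a - 1) (2 * a - 1) 1)^-1) * (C2 * s `^ a) by ring.
apply: ler_pM => //.
- by rewrite mulr_ge0 ?invr_ge0 ?(ltW B0)// ltW// gamma_mass_gt0.
- by apply: Rintegral_ge0 => t _; rewrite mulr_ge0 ?expR_ge0 ?betaw_ge0.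
- by rewrite ler_wpM2r ?invr_ge0 ?(ltW B0)// h1.
Qed.

Lemma powR_small {R : realType} (C d e : R) : 0 < C -> 0 < d -> 0 < e ->
  exists2 s : R, 0 < s <= 1 & C * s `^ e < d.
Proof.
move=> C0 d0 e0; pose x := d / (C + d + d).
have q : 0 < C + d + d by rewrite !addr_gt0.
have x0 : 0 < x by rewrite divr_gt0.
have x1 : x <= 1 by rewrite ler_pdivrMr// mul1r; lra.
exists (x `^ e^-1).
  have h1 : 1 `^ e^-1 = 1 :> R by rewrite powR1.
  rewrite powR_gt0//= -[leRHS]h1 ge0_ler_powR ?nnegrE ?invr_ge0 ?(ltW e0) ?(ltW x0)//.
rewrite -powRrM mulVf ?gt_eqF// powRr1 ?(ltW x0)// mulrA ltr_pdivrMr//; nra.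
Qed.

(** For a nonnegative f the Laplace integral can only grow as s decreases.  If
    b < a it would be O(s^(a-b)), hence tend to 0.  If b = a the function is
    0F1(c;-y), and with the weight y^(c-1) the integral is
    Gamma(c) s^(-c) e^(-1/s), which also tends to 0. *)
Lemma hyp1F2_ge0_lt {R : realType} (a b c : R) : 0 < a -> 0 < b -> a < c ->
  (forall y, 0 < y -> 0 <= hyp1F2 a b c y) -> a < b.
Proof.
move=> a0 b0 ac f0; have c0 : 0 < c by exact: lt_trans ac.
have g1 : -1 < c - a - 1 by lra.
have s1 : -1 < 2 * a - 1 by lra.
rewrite ltNge; apply/negP => ba.
have mD : measurable (`]0, +oo[%classic : set R) by exact: measurable_itv.
have mono r s : 0 < s <= 1 ->
  (forall s, 0 < s -> mu.-integrable `]0, +oo[ (EFin \o (fun y => gammaw r s y * hyp1F2 a b c y))) ->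
  \int[mu]_(y in `]0, +oo[) (gammaw r 1 y * hyp1F2 a b c y) <=
  \int[mu]_(y in `]0, +oo[) (gammaw r s y * hyp1F2 a b c y).
  move=> /andP[s0 s1'] i; apply: Rintegral_le => //; [exact: i|exact: i|].
  move=> y /=; rewrite in_itv/= andbT => y0; rewrite ler_wpM2r ?f0//.
  rewrite ler_wpM2l ?powR_ge0// ler_expR lerN2 mul1r ler_piMl//; exact: ltW.
move: ba; rewrite le_eqVlt => /orP[/eqP eba|ba].
  have v (s : R) : 0 < s -> mu.-integrable `]0, +oo[ (EFin \o (fun y => gammaw c s y * hyp1F2 a b c y)) /\
    \int[mu]_(y in `]0, +oo[) (gammaw c s y * hyp1F2 a b c y) = gamma_mass c s * expR (- s^-1).
    move=> s0; have [i e] := gamma_transform (-1) c0 s0 (hyp1F2_coef_growth a b0 c0).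
    split.
  apply: (eq_integrableR _ _ i); [exact: measurable_itv | by move=> y _; rewrite hyp1F2_psum].
    under eq_Rintegral do rewrite hyp1F2_psum.
    rewrite e mulN1r -expR_psum; congr (_ * _); apply: eq_psum => k; rewrite /hyp1F2_coef eba.
    have h1 := gt_eqF (poch_gt0 k a0); have h2 := gt_eqF (poch_gt0 k c0).
    by field; rewrite h1 h2/= pnatr_eq0 -lt0n fact_gt0.
  have [_ v1] := v 1 ltr01.
  have p1 : 0 < gamma_mass c 1 * expR (- 1^-1) by rewrite mulr_gt0 ?expR_gt0 ?gamma_mass_gt0.
  have [C1 C10 h1] := gamma_mass_le c0; have [C2 C20 h2] := @expR_powR_bound R (c + 1).
  have [s /andP[s0 s1q]] := powR_small (mulr_gt0 C10 C20) p1 (@ltr01 R).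
  apply/negP; rewrite -leNgt -v1.
  apply: (le_trans (mono c s _ (fun s h => (v s h).1))); first by rewrite s0.
  have [_ ->] := v s s0.
  have -> : C1 * C2 * s `^ 1 = (C1 * s `^ (- c)) * (C2 * s `^ (c + 1)).
    have -> : s `^ 1 = s `^ (- c) * s `^ (c + 1).
      by rewrite -powRD ?(gt_eqF s0) ?implybT//; congr (_ `^ _); ring.
    by ring.
  apply: ler_pM; rewrite ?expR_ge0 ?h1//; first by rewrite ltW// gamma_mass_gt0.
  have si : 0 <= s^-1 by rewrite invr_ge0 ltW.
  apply: (le_trans (h2 _ si)); rewrite ler_wpM2l ?(ltW C20)//.
  apply: (@le_trans _ _ (s^-1 `^ (- (c + 1)))).
    by apply: le_powR_neg; rewrite ?invr_gt0// ?lerDr//; lra.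
  by rewrite -(powR_inv1 (ltW s0)) -powRrM mulN1r opprK.
have [C C0 h] := laplace_upper a0 b0 ac.
have [i1 e1] := laplace_hyp1F2 a0 b0 ac (@ltr01 R).
have B0 := beta_mass_gt0 g1 s1 (@ltr01 R).
have p1 : 0 < \int[mu]_(y in `]0, +oo[) (gammaw b 1 y * hyp1F2 a b c y).
  rewrite e1 !mulr_gt0 ?gamma_mass_gt0 ?invr_gt0//.
  apply: (@lt_le_trans _ _ (expR (- 1) * beta_mass (c - a - 1) (2 * a - 1) 1)).
    by rewrite mulr_gt0 ?expR_gt0.
  have ib := betaw_integrable g1 s1 (@ltr01 R).
  have m01 : measurable (`]0, 1[%classic : set R) by exact: measurable_itv.
  rewrite /beta_mass -(RintegralZ (expR (- 1)) m01 ib).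
  apply: Rintegral_le; [exact: measurable_itv|apply: integrableZ => //; exact: measurable_itv| |].
    apply: (@eq_integrableR _ _ (fun t => betaw (c - a - 1) (2 * a - 1) 1 t * expR (- (1 * t + 0) ^+ 2))).
    - exact: measurable_itv.
    - by move=> t _; rewrite invr1 mul1r addr0 mulN1r.
    - exact: beta_gauss_integrable.
  move=> t; rewrite /= in_itv/= => /andP[t0 t1].
  rewrite mulrC ler_wpM2l ?betaw_ge0// ler_expR invr1 mulN1r lerN2.
  by rewrite expr_le1// ?(ltW t0) ?(ltW t1).
have abp : 0 < a - b by rewrite subr_gt0.
have [s /andP[s0 s1'] hs] := powR_small C0 p1 abp.
move: hs; apply/negP; rewrite -leNgt; apply: le_trans (h _ s0).
apply: mono; first by rewrite s0.
by move=> z z0; have [] := laplace_hyp1F2 a0 b0 ac z0.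
Qed.

(** * Double sums under two successive averages *)

Lemma eq_Rint {R : realType} (D : set R) (f g : R -> R) : (forall t, f t = g t) ->
  \int[mu]_(t in D) f t = \int[mu]_(t in D) g t.
Proof. by move=> e; apply: eq_Rintegral => t _. Qed.

Definition dterm {R : realType} (A : nat -> nat -> R) (y : R) (k : nat) : R :=
  \sum_(j < k.+1) A k j * y ^+ j.

(** A series in k of polynomials in y.  Keeping the two indices apart lets two
    beta averages act on the inner one while the series in k converges
    uniformly on [0,1]. *)
Definition dsum {R : realType} (A : nat -> nat -> R) (y : R) : R :=
  limn (series (dterm A y)).

Definition dabs {R : realType} (A : nat -> nat -> R) (k : nat) : R :=
  \sum_(j < k.+1) `|A k j|.

Lemma dterm_le {R : realType} (A : nat -> nat -> R) (y : R) k : 0 <= y <= 1 ->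
  `|dterm A y k| <= dabs A k.
Proof.
move=> /andP[y0 y1]; apply: (le_trans (ler_norm_sum _ _ _)); apply: ler_sum => j _.
by rewrite normrM (ger0_norm (exprn_ge0 _ y0)) ler_piMr// exprn_ile1.
Qed.

Lemma dsum_cvg {R : realType} (C K : R) (A : nat -> nat -> R) (y : R) : expdom C K (dabs A) ->
  0 <= y <= 1 -> series (dterm A y) @ \oo --> dsum A y.
Proof.
move=> h y01; apply: (@expdom_cvg R C K) => k; apply: le_trans (h k).
by apply: (le_trans (dterm_le _ _ y01)); exact: ler_norm.
Qed.

Lemma dabs_mul {R : realType} (C K c : R) (A : nat -> nat -> R) (m : nat -> R) :
  (forall j, `|m j| <= c) -> expdom C K (dabs A) ->
  expdom (c * C) K (dabs (fun k j => A k j * m j)).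
Proof.
move=> mc h k; have c0 : 0 <= c by exact: le_trans (mc 0%N).
rewrite -mulrA; apply: le_trans (ler_wpM2l c0 (h k)).
rewrite !ger0_norm ?sumr_ge0// mulr_sumr; apply: ler_sum => j _.
by rewrite normrM mulrC ler_wpM2r.
Qed.

Lemma dsum_transform {R : realType} (w : R -> R) (m : nat -> R) (C K c x : R)
    (A : nat -> nat -> R) :
  (forall t, 0 <= w t) -> (forall j, `|m j| <= c) ->
  (forall k, mu.-integrable `]0, 1[ (EFin \o (fun t => w t * (t ^+ 2) ^+ k)) /\
     \int[mu]_(t in `]0, 1[) (w t * (t ^+ 2) ^+ k) = m k) ->
  expdom C K (dabs A) -> 0 <= x <= 1 ->
  mu.-integrable `]0, 1[ (EFin \o (fun t => w t * dsum A (x * t ^+ 2))) /\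
  \int[mu]_(t in `]0, 1[) (w t * dsum A (x * t ^+ 2)) =
    dsum (fun k j => A k j * m j) x.
Proof.
move=> w0 mc hm hA x01; have /andP[x0 x1] := x01.
have mD : measurable (`]0, 1[%classic : set R) by exact: measurable_itv.
have c0 : 0 <= c by exact: le_trans (mc 0%N).
have lin (N : nat) (al : nat -> R) :
  mu.-integrable `]0, 1[ (EFin \o (fun t => w t * \sum_(j < N) al j * (t ^+ 2) ^+ j)) /\
  \int[mu]_(t in `]0, 1[) (w t * \sum_(j < N) al j * (t ^+ 2) ^+ j) = \sum_(j < N) al j * m j.
  have [i e] := @Rintegral_sum R _ (fun j t => al j * (w t * (t ^+ 2) ^+ j)) N mD
    (fun j => integrableZ _ mD (hm j).1).
  have ee t : \sum_(j < N) al j * (w t * (t ^+ 2) ^+ j) = w t * \sum_(j < N) al j * (t ^+ 2) ^+ j.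
    by rewrite mulr_sumr; apply: eq_bigr => j _; ring.
  split; first by apply: (eq_integrableR mD _ i) => t _; exact: ee.
  rewrite -(eq_Rint _ ee) e; apply: eq_bigr => j _.
  by rewrite RintegralZ ?(hm j).2//; have [] := hm j.
pose gk k t := w t * dterm A (x * t ^+ 2) k.
have ek k t : gk k t = w t * \sum_(j < k.+1) (A k j * x ^+ j) * (t ^+ 2) ^+ j.
  by rewrite /gk /dterm; congr (_ * _); apply: eq_bigr => j _; rewrite exprMn mulrA.
have ig k : mu.-integrable `]0, 1[ (EFin \o gk k).
  by apply: (eq_integrableR mD _ (lin k.+1 (fun j => A k j * x ^+ j)).1) => t _; rewrite ek.
have iv k : \int[mu]_(t in `]0, 1[) gk k t = dterm (fun k j => A k j * m j) x k.
  rewrite (eq_Rint _ (ek k)) (lin k.+1 (fun j => A k j * x ^+ j)).2.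
  by apply: eq_bigr => j _; ring.
have ia k : `|\int[mu]_(t in `]0, 1[) `|gk k t| | <= c * C * (K ^+ k / k`!%:R).
  rewrite ger0_norm; last by apply: Rintegral_ge0 => t _.
  have iw : mu.-integrable `]0, 1[ (EFin \o w).
    by apply: (eq_integrableR mD _ (hm 0%N).1) => t _; rewrite expr0 mulr1.
  have ew : \int[mu]_(t in `]0, 1[) w t = m 0%N.
    by rewrite -(hm 0%N).2; apply: eq_Rintegral => t _; rewrite expr0 mulr1.
  apply: (@le_trans _ _ (\int[mu]_(t in `]0, 1[) (dabs A k * w t))).
    apply: Rintegral_le => //; [|exact: integrableZ|].
      have := integrable_norm (ig k); exact: eq_integrableR.
    move=> t /=; rewrite in_itv/= => /andP[t0 t1].
    rewrite normrM (ger0_norm (w0 t)) mulrC ler_wpM2r// dterm_le//.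
    by rewrite mulr_ge0 ?sqr_ge0//= mulr_ile1 ?sqr_ge0// expr_le1// ltW.
  rewrite RintegralZ// ew.
  have d0 : 0 <= dabs A k by exact: sumr_ge0.
  apply: (@le_trans _ _ (dabs A k * c)).
    by rewrite ler_wpM2l// (le_trans (ler_norm _)).
  rewrite mulrC -mulrA ler_wpM2l//; exact: le_trans (ler_norm _) (hA k).
have [] := @Rintegral_series R `]0, 1[ gk (fun t => w t * dsum A (x * t ^+ 2)) mD ig.
- exact: (@expdom_cvg R (c * C) K).
- move=> t /=; rewrite in_itv/= => /andP[t0 t1].
  apply: cvg_seriesZ; apply: (dsum_cvg hA).
  by rewrite mulr_ge0 ?sqr_ge0//= mulr_ile1 ?sqr_ge0// expr_le1// ltW.
move=> i cv; split => //.
have c2 := dsum_cvg (dabs_mul mc hA) x01.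
apply: (cvg_unique (@Rhausdorff R) cv).
by rewrite (_ : (fun n => \int[mu]_(t in `]0, 1[) gk n t) = dterm (fun k j => A k j * m j) x)//; apply/funext.
Qed.

(** * The binomial sums behind the cosine transform *)

Lemma poch_one {R : realFieldType} n : poch (1 : R) n = n`!%:R.
Proof.
elim: n => [|n IH]; first by rewrite poch0.
by rewrite pochS IH nat1r factS natrM mulrC.
Qed.

Lemma poch_half {R : realFieldType} k :
  k.*2`!%:R = 4 ^+ k * (k`!%:R * poch (1 / 2) k) :> R.
Proof.
rewrite -poch_one -addnn; have := @poch_double R (1 / 2) k.
have -> : 2 * (1 / 2) = 1 :> R by field.
have -> : 1 / 2 + 1 / 2 = 1 :> R by field.
by move=> ->; rewrite poch_one; ring.
Qed.

Lemma even_part {R : realFieldType} (F : nat -> R) (x : R) n :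
  \sum_(i < n.*2.+1) F i * (x ^+ i + (- x) ^+ i) =
  2 * \sum_(j < n.+1) F j.*2 * (x ^+ 2) ^+ j.
Proof.
elim: n => [|n IH]; first by rewrite !big_ord1 !expr0; ring.
rewrite doubleS 2!big_ord_recr/= IH [RHS]mulrC [in RHS]big_ord_recr/= mulrDl.
rewrite -addrA [X in _ + X = _](_ : _ = F n.+1.*2 * (x ^+ 2) ^+ n.+1 * 2).
  by ring.
have od : odd n.*2.+1 by rewrite /= odd_double.
have eo : (- x) ^+ n.*2.+1 = - x ^+ n.*2.+1 by rewrite exprNn -signr_odd od expr1 mulN1r.
have ee : (- x) ^+ n.*2.+2 = x ^+ n.*2.+2 by rewrite exprNn -signr_odd /= odd_double mul1r.
rewrite eo ee subrr mulr0 add0r -doubleS -mul2n exprM; ring.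
Qed.

Lemma binomial_sum {R : realFieldType} (x : R) n :
  \sum_(i < n.+1) 'C(n, i)%:R * x ^+ i = (1 + x) ^+ n.
Proof.
by rewrite exprDn; apply: eq_bigr => i _; rewrite expr1n mul1r mulr_natl.
Qed.

Lemma binomial_moment {R : realFieldType} (x : R) n :
  (1 + x) * \sum_(i < n.+1) i%:R * 'C(n, i)%:R * x ^+ i = n%:R * x * (1 + x) ^+ n.
Proof.
case: n => [|n]; first by rewrite big_ord1 !mul0r mulr0.
rewrite big_ord_recl/= !mul0r add0r.
have -> : \sum_(i < n.+1) (bump 0 i)%:R * 'C(n.+1, bump 0 i)%:R * x ^+ bump 0 i =
   n.+1%:R * x * \sum_(i < n.+1) 'C(n, i)%:R * x ^+ i.
  rewrite mulr_sumr; apply: eq_bigr => i _; rewrite /bump/= add1n.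
  by rewrite -natrM -mul_bin_diag natrM exprS/=; ring.
by rewrite binomial_sum exprS; ring.
Qed.

(** Coefficients of the cosine transform after both averages have been taken
    off; the factor 1+j/b stems from 1/(b)_j = (1+j/b)/(b+1)_j. *)
Definition dcoef {R : realFieldType} (T b : R) (k j : nat) : R :=
  (- T) ^+ k / k`!%:R * 'C(k.*2, j.*2)%:R * (1 + j%:R / b).

(** The sums over even binomial coefficients are even parts of (1+w)^(2k) and
    of its moment, so they split into contributions of 1+w and 1-w. *)
Lemma dterm_dcoef {R : realType} (T b w : R) k : 0 < b -> 0 < w < 1 ->
  dterm (dcoef T b) (w ^+ 2) k =
   (1 / 2 + w / (2 * b * (1 + w)) * k%:R) * ((- (T * (1 + w) ^+ 2)) ^+ k / k`!%:R)
   + (1 / 2 - w / (2 * b * (1 - w)) * k%:R) * ((- (T * (1 - w) ^+ 2)) ^+ k / k`!%:R).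
Proof.
move=> b0 /andP[w0 w1].
have p1 : 1 + w != 0 by rewrite gt_eqF//; lra.
have p2 : 1 - w != 0 by rewrite gt_eqF//; lra.
have bn : b != 0 by rewrite gt_eqF.
pose F i : R := 'C(k.*2, i)%:R + (i%:R * 'C(k.*2, i)%:R) / (2 * b).
have -> : dterm (dcoef T b) (w ^+ 2) k = (- T) ^+ k / k`!%:R * \sum_(j < k.+1) F j.*2 * (w ^+ 2) ^+ j.
  rewrite mulr_sumr; apply: eq_bigr => j _; rewrite /dcoef /F -(mul2n j) (natrM _ 2 j).
  by field; rewrite bn fact_neq0.
have -> : \sum_(j < k.+1) F j.*2 * (w ^+ 2) ^+ j = (\sum_(i < k.*2.+1) F i * (w ^+ i + (- w) ^+ i)) / 2.
  by rewrite even_part mulrC mulKf.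
have e x : 1 + x != 0 -> \sum_(i < k.*2.+1) F i * x ^+ i = (1 + x) ^+ k.*2 + k.*2%:R * x * (1 + x) ^+ k.*2 / (1 + x) / (2 * b).
  move=> x1; rewrite -binomial_moment (mulrC (1 + x)) mulfK// -binomial_sum mulr_suml -big_split/=.
  by apply: eq_bigr => i _; rewrite /F; ring.
have -> : \sum_(i < k.*2.+1) F i * (w ^+ i + (- w) ^+ i) =
   \sum_(i < k.*2.+1) F i * w ^+ i + \sum_(i < k.*2.+1) F i * (- w) ^+ i.
  by rewrite -big_split/=; apply: eq_bigr => i _; rewrite mulrDr.
rewrite !e// -[k.*2]mul2n !exprM -!mulNr !exprMn natrM.
by field; rewrite bn p1 p2 fact_neq0.
Qed.

Lemma cvg_affine_exp {R : realType} (al be z : R) :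
  series (fun k => (al + be * k%:R) * (z ^+ k / k`!%:R)) @ \oo --> (al + be * z) * expR z.
Proof.
have h1 : series (fun k => k%:R * (z ^+ k / k`!%:R)) @ \oo --> z * expR z.
  rewrite -cvg_shiftS.
  rewrite (_ : [sequence _]_n = fun n => z * series (fun k => z ^+ k / k`!%:R) n).
    by apply: cvgMl_tmp; exact: cvg_series_exp.
  apply/funext => n; rewrite /series/= !big_mkord big_ord_recl/= mul0r add0r mulr_sumr.
  apply: eq_bigr => i _; rewrite /bump/= add1n exprS factS natrM.
  by field; rewrite fact_neq0 nat1r pnatr_eq0.
rewrite (_ : (al + be * z) * expR z = al * expR z + be * (z * expR z)); last by ring.
have -> : series (fun k => (al + be * k%:R) * (z ^+ k / k`!%:R)) =
  series (fun k => al * (z ^+ k / k`!%:R)) \+ series (fun k => be * (k%:R * (z ^+ k / k`!%:R))).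
  by apply/funext => n; rewrite /series/= -big_split/=; apply: eq_bigr => i _; ring.
by apply: cvgD; apply: cvg_seriesZ => //; exact: cvg_series_exp.
Qed.

(** At w = 1 the second Gaussian does not decay in T: the frequency of the
    cosine equals that of the oscillation of 1F2. *)
Definition resonance {R : realType} (T b w : R) : R :=
  (expR (- (T * (1 + w) ^+ 2)) + expR (- (T * (1 - w) ^+ 2))) / 2 +
  w * T / (2 * b) * ((1 - w) * expR (- (T * (1 - w) ^+ 2)) - (1 + w) * expR (- (T * (1 + w) ^+ 2))).

Lemma dsum_dcoef {R : realType} (T b w : R) : 0 < b -> 0 < w < 1 ->
  dsum (dcoef T b) (w ^+ 2) = resonance T b w.
Proof.
move=> b0 w01; have /andP[w0 w1] := w01.
have p1 : 1 + w != 0 by rewrite gt_eqF//; lra.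
have p2 : 1 - w != 0 by rewrite gt_eqF//; lra.
have bn : b != 0 by rewrite gt_eqF.
apply: cvg_lim; first exact: Rhausdorff.
have -> : resonance T b w =
  (1 / 2 + w / (2 * b * (1 + w)) * - (T * (1 + w) ^+ 2)) * expR (- (T * (1 + w) ^+ 2)) +
  (1 / 2 + - (w / (2 * b * (1 - w))) * - (T * (1 - w) ^+ 2)) * expR (- (T * (1 - w) ^+ 2)).
  by rewrite /resonance; field; rewrite bn p1 p2.
have -> : series (dterm (dcoef T b) (w ^+ 2)) =
  series (fun k => (1 / 2 + w / (2 * b * (1 + w)) * k%:R) * ((- (T * (1 + w) ^+ 2)) ^+ k / k`!%:R)) \+
  series (fun k => (1 / 2 + - (w / (2 * b * (1 - w))) * k%:R) * ((- (T * (1 - w) ^+ 2)) ^+ k / k`!%:R)).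
  apply/funext => n; rewrite /series/= -big_split/=; apply: eq_bigr => i _.
  by rewrite dterm_dcoef// mulNr.
by apply: cvgD; exact: cvg_affine_exp.
Qed.

Lemma dcoef_expdom {R : realType} (T b : R) : 0 < b -> 0 <= T ->
  expdom (1 + b^-1) (8 * T) (dabs (dcoef T b)).
Proof.
move=> b0 T0 k; rewrite ger0_norm ?sumr_ge0//.
have k1 : k%:R <= 2 ^+ k :> R by rewrite -natrX ler_nat ltnW// ltn_expl.
have k2 : 1 <= 2 ^+ k :> R by rewrite exprn_ege1// ler1n.
have bi : 0 < b^-1 by rewrite invr_gt0.
apply: (@le_trans _ _ (\sum_(j < k.+1) (T ^+ k / k`!%:R * ((1 + b^-1) * 2 ^+ k)) * 'C(k.*2, j.*2)%:R)).
  apply: ler_sum => j _; rewrite /dcoef !normrM normrX normrN (ger0_norm T0) normfV !normr_nat.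
  rewrite [leRHS]mulrAC ler_wpM2l// ?mulr_ge0 ?invr_ge0 ?exprn_ge0//.
  have jk : j%:R <= k%:R :> R by rewrite ler_nat -ltnS.
  rewrite ger0_norm; last by rewrite addr_ge0// divr_ge0// ltW.
  rewrite mulrDl mul1r lerD// mulrC ler_wpM2l ?(ltW bi)//; exact: le_trans k1.
rewrite -mulr_sumr.
have h : \sum_(j < k.+1) 'C(k.*2, j.*2)%:R <= 4 ^+ k :> R.
  have ev := @even_part R (fun i => 'C(k.*2, i)%:R) 1 k.
  have e1 : \sum_(i < k.*2.+1) 'C(k.*2, i)%:R * (1 ^+ i + (- 1) ^+ i) = 4 ^+ k + 0 ^+ k.*2 :> R.
    have -> : 4 ^+ k = (1 + 1) ^+ k.*2 :> R by rewrite -mul2n exprM; congr (_ ^+ _); ring.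
    have -> : 0 ^+ k.*2 = (1 + - 1) ^+ k.*2 :> R by rewrite subrr.
    rewrite -!binomial_sum -big_split/=; apply: eq_bigr => i _; ring.
  have e2 : \sum_(j < k.+1) 'C(k.*2, j.*2)%:R * (1 ^+ 2) ^+ j = \sum_(j < k.+1) 'C(k.*2, j.*2)%:R :> R.
    by apply: eq_bigr => j _; rewrite !expr1n mulr1.
  have c4 : 1 <= 4 ^+ k :> R by rewrite exprn_ege1// ler1n.
  have z01 : 0 ^+ k.*2 <= 1 :> R by rewrite exprn_ile1.
  by rewrite e1 e2 in ev; lra.
apply: (@le_trans _ _ (T ^+ k / k`!%:R * ((1 + b^-1) * 2 ^+ k) * 4 ^+ k)).
  by rewrite ler_wpM2l// !mulr_ge0 ?invr_ge0 ?exprn_ge0 ?addr_ge0 ?(ltW bi).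
have -> : (8 * T) ^+ k = 2 ^+ k * 4 ^+ k * T ^+ k by rewrite -!exprMn; congr (_ ^+ _); ring.
by rewrite le_eqVlt; apply/orP; left; apply/eqP; ring.
Qed.

(** * The Laplace transform of the product with a cosine *)

Lemma bin_le_exp n m : ('C(n, m) <= 2 ^ n)%N.
Proof.
elim: n m => [|n IH] [|m]; rewrite ?bin0 ?bin0n ?expn_gt0//.
by rewrite binS expnS mul2n -addnn leq_add.
Qed.

(** Squared binomial coefficients are at most 4^n. *)
Lemma conv_growth2 {R : realFieldType} (u v : nat -> R) :
  growth 0 2 u -> growth 0 2 v -> growth 0 2 (conv u v).
Proof.
move=> gu gv.
pose u' n : R := `|u n| * n`!%:R ^+ 2; pose v' n : R := `|v n| * n`!%:R ^+ 2.
have gn (w : nat -> R) : growth 0 2 w -> growth 0 0 (fun n => `|w n| * n`!%:R ^+ 2).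
  move=> [C [K [C0 K0 h]]]; exists C, K; split => // n; have := h n.
  by rewrite !expr0 !mulr1 => hn; rewrite ger0_norm// mulr_ge0.
have [C [K [C0 K0 h]]] := conv_growth (gn _ gu) (gn _ gv).
exists C, (4 * K); split; rewrite ?mulr_ge0// => n.
have := h n; rewrite !expr0 !mulr1.
rewrite ger0_norm; last by apply: sumr_ge0 => i _; rewrite !mulr_ge0.
move=> hn; rewrite exprMn [leRHS]mulrCA.
apply: (@le_trans _ _ (4 ^+ n * conv u' v' n)); last by rewrite ler_wpM2l// exprn_ge0.
apply: (@le_trans _ _ (\sum_(i < n.+1) `|u i * v (n - i)%N| * n`!%:R ^+ 2)).
  by rewrite -mulr_suml ler_wpM2r// ?exprn_ge0//; exact: ler_norm_sum.
rewrite /conv mulr_sumr; apply: ler_sum => i _.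
have i_n : (i <= n)%N by rewrite -ltnS.
rewrite -(bin_fact i_n) !natrM normrM /u' /v'.
have -> : `|u i| * `|v (n - i)%N| * ('C(n, i)%:R * (i`!%:R * (n - i)`!%:R)) ^+ 2 =
  'C(n, i)%:R ^+ 2 * (`|u i| * i`!%:R ^+ 2 * (`|v (n - i)%N| * (n - i)`!%:R ^+ 2)) :> R by ring.
rewrite ler_wpM2r ?mulr_ge0//.
have -> : 4 ^+ n = (2 ^+ n) ^+ 2 :> R by rewrite -exprM mulnC exprM; congr (_ ^+ _); ring.
rewrite ler_sqr ?nnegrE ?exprn_ge0// -natrX ler_nat.
exact: bin_le_exp.
Qed.

Lemma psum_mul {R : realType} (u v : nat -> R) (y : R) : growth 0 1 u -> growth 0 1 v ->
  psum u y * psum v y = psum (conv u v) y.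
Proof.
move=> gu gv.
have [C [K [C0 K0 hu]]] := growth_expdom (growthM gu (growth_pow y)).
have [D [L [D0 L0 hv]]] := growth_expdom (growthM gv (growth_pow y)).
have weak (B k0 M : R) w : 0 <= B -> 0 <= k0 <= M -> expdom B k0 w -> expdom B M w.
  move=> c0 /andP[k00 km] h n; apply: (le_trans (h n)); rewrite ler_wpM2l// ler_wpM2r ?invr_ge0//.
  by rewrite lerXn2r// nnegrE// (le_trans k00).
have hu' : expdom C (K + L) (fun n => u n * y ^+ n) by apply: weak hu; rewrite // K0 lerDl.
have hv' : expdom D (K + L) (fun n => v n * y ^+ n) by apply: weak hv; rewrite // L0 lerDr.
have cv := cauchy_product hu' hv'.
apply/esym/cvg_lim; first exact: Rhausdorff.
rewrite (_ : (fun k => conv u v k * y ^+ k) = conv (fun n => u n * y ^+ n) (fun n => v n * y ^+ n))//.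
apply/funext => n; rewrite /conv mulr_suml; apply: eq_bigr => i _.
have i_n : (i <= n)%N by rewrite -ltnS.
have -> : y ^+ n = y ^+ i * y ^+ (n - i) by rewrite -exprD subnKC.
by ring.
Qed.

Definition cos_coef {R : realFieldType} (k : nat) : R := (k`!%:R * poch (1 / 2) k)^-1.

Lemma half_gt0 {R : realFieldType} : 0 < 1 / 2 :> R.
Proof. by rewrite divr_gt0. Qed.

Lemma cos_coef_growth {R : realFieldType} : growth 0 2 (@cos_coef R).
Proof.
have := growthM (@inv_fact_growth R) (inv_poch_growth (@half_gt0 R)).
by apply: eq_growth => k; rewrite /cos_coef invfM.
Qed.

Lemma cos_psum {R : realType} (y : R) : 0 < y ->
  cos (2 * Num.sqrt y) = psum cos_coef (-1 * y).
Proof.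
move=> y0; rewrite -(cvg_lim (@Rhausdorff R) (@cvg_cos_coeff' R (2 * Num.sqrt y))).
congr (limn (series _)); apply/funext => k; rewrite /cos_coeff' /cos_coef.
rewrite -exprnP poch_half -mul2n exprM (exprMn 2) sqr_sqrtr ?(ltW y0)//.
have h1 := fact_neq0 (R := R) k; have h2 : poch (1 / 2) k != 0 :> R by rewrite gt_eqF// poch_gt0// half_gt0.
have h4 : 4 ^+ k != 0 :> R by rewrite expf_neq0.
have -> : 2 ^+ 2 * y = 4 * y by ring.
by rewrite !exprMn; field; rewrite h1 h2 h4.
Qed.

Lemma poch_le {R : realFieldType} (u v : R) k : 0 < u -> u <= v -> poch u k <= poch v k.
Proof.
move=> u0 uv; elim: k => [|k IH]; first by rewrite !poch0.
rewrite !pochS ler_pM ?lerD2r//; first exact/ltW/poch_gt0.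
by rewrite addr_ge0// ltW.
Qed.

(** The binomial coefficient C(2k,2j) collects the rising factorials of 1/2.
    Passing from b to b+1 turns (1/2)_j/(b+1)_j into a moment of a beta weight
    for every b > 0, where (1/2)_j/(b)_j would require b > 1/2. *)
Lemma conv_cos_hyp1F2 {R : realType} (a b c T : R) k : 0 < a -> 0 < b -> 0 < c ->
  conv cos_coef (hyp1F2_coef a b c) k * poch (1 / 2) k * (- T) ^+ k =
  \sum_(j < k.+1) dcoef T b k j * (poch (1 / 2) j / poch (b + 1) j) * (poch a j / poch c j).
Proof.
move=> a0 b0 c0; rewrite convC /conv !mulr_suml; apply: eq_bigr => j _.
have j_k : (j <= k)%N by rewrite -ltnS.
have h n : poch (1 / 2) n != 0 :> R by rewrite gt_eqF// poch_gt0// half_gt0.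
have f n := fact_neq0 (R := R) n.
have b1 : 0 < b + 1 by rewrite addr_gt0.
have pb : poch b j != 0 by rewrite gt_eqF// poch_gt0.
have pc : poch c j != 0 by rewrite gt_eqF// poch_gt0.
have pb1 : poch (b + 1) j != 0 by rewrite gt_eqF// poch_gt0.
have bn : b != 0 by rewrite gt_eqF.
have bj : b + j%:R != 0 by rewrite gt_eqF// ltr_pwDl.
have eb : poch (b + 1) j = poch b j * (b + j%:R) / b.
  by apply: (mulfI bn); rewrite -pochSl pochS; field.
have ec : 'C(k.*2, j.*2)%:R * (j`!%:R * poch (1 / 2) j) * ((k - j)`!%:R * poch (1 / 2) (k - j)) = k`!%:R * poch (1 / 2) k :> R.
  have h4 n : 4 ^+ n != 0 :> R by rewrite expf_neq0.
  apply: (mulfI (h4 k)); rewrite -poch_half -(bin_fact (_ : j.*2 <= k.*2)%N) ?leq_double//.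
  have -> : 4 ^+ k = 4 ^+ j * 4 ^+ (k - j) :> R by rewrite -exprD subnKC.
  rewrite !natrM -doubleB !poch_half; ring.
have ek : poch (1 / 2) k = 'C(k.*2, j.*2)%:R * (j`!%:R * poch (1 / 2) j) * ((k - j)`!%:R * poch (1 / 2) (k - j)) / k`!%:R :> R.
  by apply: (mulfI (f k)); rewrite [RHS]mulrCA mulfV// mulr1; exact: esym ec.
rewrite ek eb /hyp1F2_coef /cos_coef /dcoef.
by field; rewrite bn bj pb pc !h !f.
Qed.

Lemma beta_moment1 {R : realType} (g s : R) : -1 < g -> -1 < s ->
  let u := (s + 1) / 2 in let m k := poch u k / poch (u + g + 1) k * beta_mass g s 1 in
  (forall k, `|m k| <= beta_mass g s 1) /\
  (forall k, mu.-integrable `]0, 1[ (EFin \o (fun t => betaw g s 1 t * (t ^+ 2) ^+ k)) /\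
     \int[mu]_(t in `]0, 1[) (betaw g s 1 t * (t ^+ 2) ^+ k) = m k).
Proof.
move=> g1 s1 u m; have u0 : 0 < u by rewrite divr_gt0//; lra.
have v0 : 0 < u + g + 1 by lra.
have B0 := beta_mass_gt0 g1 s1 (@ltr01 R).
split=> k.
  rewrite ger0_norm; last by rewrite mulr_ge0 ?(ltW B0)// divr_ge0// ltW// poch_gt0.
  rewrite ger_pMl// ler_pdivrMr ?poch_gt0// mul1r poch_le//; lra.
have [i e] := beta_moment k g1 s1 (@ltr01 R); split=> //.
by rewrite e /m /u !expr1n mulr1.
Qed.

(** The Laplace transform of y^(-1/2) cos(2 sqrt y) 1F2(a;b,c;-y) as an average
    of [resonance] over w = t1 t2, with t1 and t2 distributed by two beta
    weights. *)
Lemma cos_laplace {R : realType} (a b c s : R) : 0 < a -> 0 < b -> a < c -> 0 < s ->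
  let w1 := betaw (b - 1 / 2) 0 1 in
  let w2 := betaw (c - a - 1) (2 * a - 1) 1 in
  let inner t2 := \int[mu]_(t1 in `]0, 1[) (w1 t1 * resonance s^-1 b (t1 * t2)) in
  [/\ mu.-integrable `]0, +oo[
        (EFin \o (fun y => gammaw (1 / 2) s y * (cos (2 * Num.sqrt y) * hyp1F2 a b c y))),
      forall t2, 0 < t2 < 1 -> mu.-integrable `]0, 1[
        (EFin \o (fun t1 => w1 t1 * resonance s^-1 b (t1 * t2))),
      mu.-integrable `]0, 1[ (EFin \o (fun t2 => w2 t2 * inner t2)) &
      \int[mu]_(y in `]0, +oo[) (gammaw (1 / 2) s y * (cos (2 * Num.sqrt y) * hyp1F2 a b c y)) =
      gamma_mass (1 / 2) s * (beta_mass (b - 1 / 2) 0 1 * beta_mass (c - a - 1) (2 * a - 1) 1)^-1 *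
        \int[mu]_(t2 in `]0, 1[) (w2 t2 * inner t2)].
Proof.
move=> a0 b0 ac s0 w1 w2 inner; have c0 : 0 < c by exact: lt_trans ac.
have mD : measurable (`]0, 1[%classic : set R) by exact: measurable_itv.
have mR : measurable (`]0, +oo[%classic : set R) by exact: measurable_itv.
have T0 : 0 < s^-1 by rewrite invr_gt0.
have g1 : -1 < b - 1 / 2 by lra.
have z1 : -1 < 0 :> R by lra.
have g2 : -1 < c - a - 1 by lra.
have s2 : -1 < 2 * a - 1 by lra.
have B1 := beta_mass_gt0 g1 z1 (@ltr01 R); have B2 := beta_mass_gt0 g2 s2 (@ltr01 R).
have [m1c m1] := beta_moment1 g1 z1; have [m2c m2] := beta_moment1 g2 s2.
move: m1c m1 m2c m2.
have -> : (0 + 1) / 2 = 1 / 2 :> R by rewrite add0r.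
have -> : 1 / 2 + (b - 1 / 2) + 1 = b + 1 by ring.
have -> : (2 * a - 1 + 1) / 2 = a by field.
have -> : a + (c - a - 1) + 1 = c by ring.
pose mu1 k : R := poch (1 / 2) k / poch (b + 1) k * beta_mass (b - 1 / 2) 0 1.
pose mu2 k : R := poch a k / poch c k * beta_mass (c - a - 1) (2 * a - 1) 1.
move=> m1c m1 m2c m2.
have hA := dcoef_expdom b0 (ltW T0).
have hA1 := dabs_mul (m := mu1) m1c hA.
have sq01 (t : R) : 0 < t < 1 -> 0 <= t ^+ 2 <= 1.
  by move=> /andP[t0 t1]; rewrite sqr_ge0/= expr_le1// ltW.
have w0 (g s' t : R) : 0 <= betaw g s' 1 t by exact: betaw_ge0.
have inn t2 : 0 < t2 < 1 -> mu.-integrable `]0, 1[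
        (EFin \o (fun t1 => w1 t1 * resonance s^-1 b (t1 * t2))) /\
   inner t2 = dsum (fun k j => dcoef s^-1 b k j * mu1 j) (t2 ^+ 2).
  move=> t01; have /andP[t0 t1] := t01.
  have [i e] := dsum_transform (m := mu1) (w0 _ _) m1c m1 hA (sq01 _ t01).
  have ee t : `]0, 1[%classic t -> betaw (b - 1 / 2) 0 1 t * dsum (dcoef s^-1 b) (t2 ^+ 2 * t ^+ 2) =
     w1 t * resonance s^-1 b (t * t2).
    rewrite /= in_itv/= => /andP[u0 u1]; rewrite -dsum_dcoef//; first by rewrite exprMn mulrC -mulrC (mulrC (t ^+ 2)).
    by rewrite mulr_gt0//= mulr_ilt1// ltW.
  split; first exact: (eq_integrableR mD ee i).
  by rewrite -e; apply: eq_Rintegral => t; rewrite inE => /ee.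
have o01 : 0 <= (1 : R) <= 1 by rewrite ler01 lexx.
have [i2 e2] := dsum_transform (m := mu2) (w0 _ _) m2c m2 hA1 o01.
have ee2 t : `]0, 1[%classic t -> betaw (c - a - 1) (2 * a - 1) 1 t * dsum (fun k j => dcoef s^-1 b k j * mu1 j) (1 * t ^+ 2) =
  w2 t * inner t.
  by rewrite /= in_itv/= => /inn[_ ->]; rewrite mul1r.
have gh := conv_growth2 (@cos_coef_growth R) (hyp1F2_coef_growth a b0 c0).
have [i3 e3] := gamma_transform (-1) (@half_gt0 R) s0 gh.
have ee3 y : `]0, +oo[%classic y -> gammaw (1 / 2) s y * psum (conv cos_coef (hyp1F2_coef a b c)) (- 1 * y) =
  gammaw (1 / 2) s y * (cos (2 * Num.sqrt y) * hyp1F2 a b c y).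
  rewrite /= in_itv/= andbT => y0; rewrite cos_psum// hyp1F2_psum psum_mul//.
    exact: growth_weak (@cos_coef_growth R).
  exact: growth_weak (hyp1F2_coef_growth a b0 c0).
split.
- exact: (eq_integrableR mR ee3 i3).
- by move=> t2 /inn[].
- exact: (eq_integrableR mD ee2 i2).
have -> : \int[mu]_(t2 in `]0, 1[) (w2 t2 * inner t2) =
   dsum (fun k j => dcoef s^-1 b k j * mu1 j * mu2 j) 1.
  by rewrite -e2; apply: eq_Rintegral => t; rewrite inE => /ee2.
have -> : \int[mu]_(y in `]0, +oo[) (gammaw (1 / 2) s y * (cos (2 * Num.sqrt y) * hyp1F2 a b c y)) =
  gamma_mass (1 / 2) s * psum (fun k => conv cos_coef (hyp1F2_coef a b c) k * poch (1 / 2) k) (- 1 / s).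
  by rewrite -e3; apply: eq_Rintegral => t; rewrite inE => /ee3.
have gr : growth 0 1 (fun k => conv cos_coef (hyp1F2_coef a b c) k * poch (1 / 2) k).
  by apply: growthS; exact: (growthM gh (poch_growth _)).
have -> : dsum (fun k j => dcoef s^-1 b k j * mu1 j * mu2 j) 1 =
  (beta_mass (b - 1 / 2) 0 1 * beta_mass (c - a - 1) (2 * a - 1) 1) *
   psum (fun k => conv cos_coef (hyp1F2_coef a b c) k * poch (1 / 2) k) (- 1 / s).
  rewrite -psumZ//; congr (limn (series _)); apply/funext => k.
  rewrite mulN1r -[RHS]mulrA (conv_cos_hyp1F2 _ _ a0 b0 c0) mulr_sumr.
  by apply: eq_bigr => j _; rewrite expr1n /mu1 /mu2; ring.
by rewrite -mulrA mulKf// gt_eqF// mulr_gt0.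
Qed.

(** * Two-sided bounds for the cosine transform *)

(** The quantity tested against positivity.  As s = th^(-2) tends to 0 it has
    exact order th^(-(b+c-a-3/2)). *)
Definition coslap {R : realType} (a b c s : R) : R :=
  \int[mu]_(y in `]0, +oo[)
    (gammaw (1 / 2) s y * (cos (2 * Num.sqrt y) * hyp1F2 a b c y)).

(** Since 1 - u v is at least 1-u and 1-v, the Gaussian in 1 - u v is at most a
    product of Gaussians in 1-u and in 1-v. *)
Lemma resonance_upper {R : realType} (b th u v : R) : 0 < b -> 1 <= th ->
  0 < u < 1 -> 0 < v < 1 ->
  `|resonance (th ^+ 2) b (u * v)| <=
    (1 + 3 / (2 * b)) * th * (expR (- (th / 2 * (1 - u)) ^+ 2) * expR (- (th / 2 * (1 - v)) ^+ 2)).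
Proof.
move=> b0 th1 /andP[u0 u1] /andP[v0 v1]; pose w := u * v.
have w0 : 0 < w by rewrite mulr_gt0.
have w1 : w < 1 by rewrite /w mulr_ilt1// ltW.
pose G := expR (- (th ^+ 2 * (1 - w) ^+ 2 / 2)).
have G0 : 0 < G by exact: expR_gt0.
have GG : G <= expR (- (th / 2 * (1 - u)) ^+ 2) * expR (- (th / 2 * (1 - v)) ^+ 2).
  rewrite -expRD ler_expR.
  have h1 : (1 - u) ^+ 2 <= (1 - w) ^+ 2 by rewrite ler_sqr ?nnegrE /w; nra.
  have h2 : (1 - v) ^+ 2 <= (1 - w) ^+ 2 by rewrite ler_sqr ?nnegrE /w; nra.
  have t0 : 0 <= th ^+ 2 by exact: sqr_ge0.
  have -> : - (th / 2 * (1 - u)) ^+ 2 + - (th / 2 * (1 - v)) ^+ 2 =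
     - (th ^+ 2 * (((1 - u) ^+ 2 + (1 - v) ^+ 2) / 2) / 2) by field.
  by rewrite lerN2 ler_wpM2r// ler_wpM2l//; lra.
apply: (@le_trans _ _ ((1 + 3 / (2 * b)) * th * G)); last first.
  rewrite ler_wpM2l// mulr_ge0//; last by lra.
  by rewrite addr_ge0// divr_ge0// mulr_ge0// ltW.
rewrite /resonance -/w; set em := expR (- (_ * (1 - w) ^+ 2)); set ep := expR (- (_ * (1 + w) ^+ 2)).
clearbody w; clear GG.
have em0 : 0 < em by exact: expR_gt0.
have ep0 : 0 < ep by exact: expR_gt0.
have T0 : 0 <= th ^+ 2 by exact: sqr_ge0.
have emG : em <= G.
  by rewrite ler_expR lerN2 ler_pdivrMr// ler_peMr ?mulr_ge0 ?sqr_ge0//; lra.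
have epem : ep <= em.
  by rewrite ler_expR lerN2 ler_wpM2l//; nra.
have h1 : th * (1 - w) * em <= G.
  have -> : em = G * G by rewrite -expRD; congr expR; field.
  rewrite mulrA ger_pMl//; pose x := th * (1 - w); rewrite -/x.
  have -> : G = (expR (x ^+ 2 / 2))^-1 by rewrite -expRN /G /x; congr expR; field.
  rewrite ler_pdivrMr ?expR_gt0// mul1r; apply: le_trans (expR_ge1Dx _); nra.
have h2 : th ^+ 2 * ep <= G.
  have e1 : ep <= G * expR (- (th ^+ 2 / 2)).
    rewrite -expRD ler_expR.
    have -> : - (th ^+ 2 * (1 - w) ^+ 2 / 2) + - (th ^+ 2 / 2) = - (th ^+ 2 * (((1 - w) ^+ 2 + 1) / 2)) by field.
    by rewrite lerN2 ler_wpM2l//; nra.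
  apply: (le_trans (ler_wpM2l T0 e1)); rewrite mulrCA ger_pMr// expRN ler_pdivrMr ?expR_gt0// mul1r.
  have -> : expR (th ^+ 2 / 2) = expR (th ^+ 2 / 4) ^+ 2 by rewrite -expRM_natl; congr expR; field.
  rewrite ler_sqr ?nnegrE ?expR_ge0//; last by lra.
  by apply: le_trans (expR_ge1Dx _); have := sqr_ge0 (1 - th / 2); nra.
have bi : 0 < b^-1 by rewrite invr_gt0.
have k1 : (em + ep) / 2 <= th * G by nra.
have k2 : `|w * th ^+ 2 / (2 * b) * ((1 - w) * em - (1 + w) * ep)| <= 3 / (2 * b) * (th * G).
  have -> : w * th ^+ 2 / (2 * b) * ((1 - w) * em - (1 + w) * ep) =
     (w * (th * (th * (1 - w) * em) - (1 + w) * (th ^+ 2 * ep))) / (2 * b) by field; rewrite gt_eqF.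
  rewrite normrM (@ger0_norm _ (2 * b)^-1); last by rewrite invr_ge0 mulr_ge0// ltW.
  rewrite [leRHS]mulrAC ler_wpM2r// ?invr_ge0 ?mulr_ge0 ?(ltW b0)//.
  have A0 : 0 <= th * (1 - w) * em by rewrite !mulr_ge0 ?(ltW em0)//; lra.
  have B0 : 0 <= th ^+ 2 * ep by rewrite mulr_ge0// ltW.
  move: A0 B0 h1 h2; set X := th * (1 - w) * em; set Y := th ^+ 2 * ep => A0 B0 h1 h2.
  have tX : th * X <= th * G by rewrite ler_wpM2l//; lra.
  have tX0 : 0 <= th * X by rewrite mulr_ge0//; lra.
  have tG : G <= th * G by rewrite ler_peMl// ltW.
  have wY : 0 <= (1 + w) * Y <= 2 * Y by rewrite mulr_ge0//=; [rewrite ler_wpM2r//; lra|lra].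
  rewrite normrM (gtr0_norm w0) -[leRHS]mul1r ler_pM//; first exact: ltW.
    exact: ltW.
  by rewrite ler_norml; case/andP: wY => y0 y1; apply/andP; split; lra.
apply: (le_trans (ler_normD _ _)); rewrite ger0_norm; last first.
  by rewrite divr_ge0// addr_ge0// ltW.
have -> : (1 + 3 / (2 * b)) * th * G = th * G + 3 / (2 * b) * (th * G) by ring.
by rewrite (addrC ep) lerD.
Qed.

(** Both averages concentrate at 1, at scale 1/th. *)
Lemma coslap_upper {R : realType} (a b c : R) : 0 < a -> 0 < b -> a < c ->
  exists2 C : R, 0 < C & forall th, 1 <= th ->
    `|coslap a b c (th ^- 2)| <= C * th `^ (- (b + c - a - 3 / 2)).
Proof.
move=> a0 b0 ac.
have g1 : -1 < b - 1 / 2 by lra.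
have z1 : -1 < 0 :> R by lra.
have g2 : -1 < c - a - 1 by lra.
have s2 : -1 < 2 * a - 1 by lra.
have B1 := beta_mass_gt0 g1 z1 (@ltr01 R); have B2 := beta_mass_gt0 g2 s2 (@ltr01 R).
pose M := beta_mass (b - 1 / 2) 0 1 * beta_mass (c - a - 1) (2 * a - 1) 1.
have M0 : 0 < M by rewrite mulr_gt0.
have [C0 C00 hC0] := gamma_mass_le (@half_gt0 R).
have [C1 C10 hC1] := beta_gauss1 g1 z1; have [C2 C20 hC2] := beta_gauss1 g2 s2.
pose K := 1 + 3 / (2 * b); have K0 : 0 < K by rewrite addr_gt0// divr_gt0// mulr_gt0.
pose P := 2 `^ (b - 1 / 2 + 1) * 2 `^ (c - a - 1 + 1); have P0 : 0 < P by rewrite mulr_gt0 ?powR_gt0.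
exists (C0 * M^-1 * (K * C1 * C2) * P); first by rewrite !mulr_gt0// invr_gt0.
move=> th th1; have th0 : 0 < th by exact: lt_le_trans th1.
have s0 : 0 < th ^- 2 by rewrite invr_gt0 exprn_gt0.
have [_ ii io e] := cos_laplace a0 b0 ac s0.
have mD : measurable (`]0, 1[%classic : set R) by exact: measurable_itv.
rewrite /coslap e invrK; move: ii io; rewrite invrK => ii io {e}.
set I := \int[mu]_(t2 in `]0, 1[) _.
have t20 : 0 < th / 2 by rewrite divr_gt0.
have gi (g s : R) : -1 < g -> -1 < s -> mu.-integrable `]0, 1[ (EFin \o (fun t => betaw g s 1 t * expR (- (th / 2 * (1 - t)) ^+ 2))).
  move=> g1' s1'; apply: (@eq_integrableR _ _ (fun t => betaw g s 1 t * expR (- ((- (th / 2)) * t + th / 2) ^+ 2))) => //.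
    by move=> t _; congr (_ * expR (- _ ^+ 2)); ring.
  exact: beta_gauss_integrable.
have nle (f g : R -> R) : mu.-integrable `]0, 1[ (EFin \o f) ->
   mu.-integrable `]0, 1[ (EFin \o g) -> (forall t, 0 < t < 1 -> `|f t| <= g t) ->
   `|\int[mu]_(t in `]0, 1[) f t| <= \int[mu]_(t in `]0, 1[) g t.
  move=> fi gi' h; apply: (@le_trans _ _ (\int[mu]_(t in `]0, 1[) `|f t|)).
    exact: le_normr_Rintegral.
  apply: Rintegral_le => //; first exact: (integrable_norm fi).
pose J1 := \int[mu]_(t in `]0, 1[) (betaw (b - 1 / 2) 0 1 t * expR (- (th / 2 * (1 - t)) ^+ 2)).
pose J2 := \int[mu]_(t in `]0, 1[) (betaw (c - a - 1) (2 * a - 1) 1 t * expR (- (th / 2 * (1 - t)) ^+ 2)).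
have J10 : 0 <= J1 by apply: Rintegral_ge0 => t _; rewrite mulr_ge0 ?betaw_ge0 ?expR_ge0.
have J20 : 0 <= J2 by apply: Rintegral_ge0 => t _; rewrite mulr_ge0 ?betaw_ge0 ?expR_ge0.
have inn t2 : 0 < t2 < 1 -> `|\int[mu]_(t1 in `]0, 1[) (betaw (b - 1 / 2) 0 1 t1 * resonance (th ^+ 2) b (t1 * t2))|
   <= K * th * J1 * expR (- (th / 2 * (1 - t2)) ^+ 2).
  move=> h2; have -> : K * th * J1 * expR (- (th / 2 * (1 - t2)) ^+ 2) =
    \int[mu]_(t in `]0, 1[) ((K * th * expR (- (th / 2 * (1 - t2)) ^+ 2)) * (betaw (b - 1 / 2) 0 1 t * expR (- (th / 2 * (1 - t)) ^+ 2))).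
    rewrite (RintegralZ _ mD (gi _ _ g1 z1)) -/J1; exact: mulrAC.
  apply: nle; [exact: ii|apply: integrableZ => //; exact: gi|] => t1 h1.
  rewrite normrM (ger0_norm (betaw_ge0 _ _ _ _)) mulrCA ler_wpM2l ?betaw_ge0//.
  apply: (le_trans (resonance_upper b0 th1 h1 h2)).
  by rewrite le_eqVlt; apply/orP; left; apply/eqP; rewrite /K; ring.
have II : `|I| <= K * th * J1 * J2.
  rewrite /J2 -(RintegralZ _ mD (gi _ _ g2 s2)).
  apply: nle; [exact: io|apply: integrableZ => //; exact: gi|] => t2 h2.
  rewrite normrM (ger0_norm (betaw_ge0 _ _ _ _)) mulrCA ler_wpM2l ?betaw_ge0//; exact: inn.
have e1 (x y : R) : th `^ x * th `^ y = th `^ (x + y) by rewrite -powRD// (gt_eqF th0) implybT.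
have e2 (x : R) : (th / 2) `^ (- x) = th `^ (- x) * 2 `^ x.
  by rewrite powRM ?(ltW th0) ?invr_ge0// -(powR_inv1 (ler0n R 2)) -powRrM mulN1r opprK.
have hm : gamma_mass (1 / 2) (th ^- 2) <= C0 * th.
  have -> : C0 * th = C0 * (th ^- 2) `^ (- (1 / 2)).
    rewrite -(powR_inv1 (sqr_ge0 th)) -(powR_mulrn 2 (ltW th0)) -!powRrM.
    by rewrite (_ : 2%:R * (-1 * - (1 / 2)) = 1) ?powRr1 ?(ltW th0)//; field.
  exact: hC0.
rewrite !normrM (gtr0_norm (gamma_mass_gt0 (@half_gt0 R) s0)) -/M (@gtr0_norm _ M^-1) ?invr_gt0//.
have -> : C0 * M^-1 * (K * C1 * C2) * P * th `^ (- (b + c - a - 3 / 2)) =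
  (C0 * th) * M^-1 * (K * th * (C1 * (th / 2) `^ (- (b - 1 / 2 + 1))) * (C2 * (th / 2) `^ (- (c - a - 1 + 1)))).
  have -> : th `^ (- (b + c - a - 3 / 2)) = th `^ 1 * th `^ 1 * th `^ (- (b - 1 / 2 + 1)) * th `^ (- (c - a - 1 + 1)).
    by rewrite !e1; congr (_ `^ _); field.
  by rewrite !e2 powRr1 ?(ltW th0)// /P; ring.
have gm0 : 0 <= gamma_mass (1 / 2) (th ^- 2) by exact: ltW (gamma_mass_gt0 (@half_gt0 R) s0).
have Mi : 0 <= M^-1 by rewrite invr_ge0 ltW.
apply: ler_pM; [exact: mulr_ge0|exact: normr_ge0|exact: ler_wpM2r|].
have Kt : 0 <= K * th by rewrite mulr_ge0 ?(ltW K0) ?(ltW th0).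
apply: (le_trans II); apply: ler_pM; [exact: mulr_ge0|exact: J20| |exact: hC2].
by apply: ler_wpM2l => //; exact: hC1.
Qed.

Lemma betaw_lower {R : realType} (g s : R) :
  exists2 k : R, 0 < k & forall tau t, 0 < tau <= 1 / 2 -> 1 - tau <= t <= 1 - tau / 2 ->
    k * tau `^ g <= betaw g s 1 t.
Proof.
pose p : R := (1 / 2) `^ (- g) + 2 `^ (- g); pose q : R := (1 / 2) `^ (- s) + 1 `^ (- s).
have p0 : 0 < p by rewrite addr_gt0 ?powR_gt0// divr_gt0.
have q0 : 0 < q by rewrite addr_gt0 ?powR_gt0// divr_gt0.
exists (p^-1 * q^-1); first by rewrite mulr_gt0 ?invr_gt0.
move=> tau t /andP[tau0 tau2] /andP[t1 t2].
have t0 : 0 < t by lra.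
have e (y r : R) : y `^ r = (y `^ (- r))^-1 by rewrite -powRN opprK.
pose z := (1 - t ^+ 2) / tau.
have z1 : 1 / 2 <= z by rewrite ler_pdivlMr//; nra.
have z2 : z <= 2 by rewrite ler_pdivrMr//; nra.
have z0 : 0 < z by lra.
have -> : betaw g s 1 t = z `^ g * t `^ s * tau `^ g.
  rewrite /betaw expr1n (_ : 1 - t ^+ 2 = z * tau); last by rewrite /z divfK// gt_eqF.
  by rewrite powRM ?(ltW z0) ?(ltW tau0)//; ring.
rewrite ler_wpM2r ?powR_ge0// (e z) (e t).
apply: ler_pM; rewrite ?invr_ge0 ?(ltW p0) ?(ltW q0)// lef_pV2 ?posrE ?powR_gt0//; apply: powR_between; lra.
Qed.

(** Only the term with e^(-T (1+w)^2) is negative. *)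
Lemma resonance_lower {R : realType} (b T w : R) : 0 < b -> 0 <= T -> 0 < w < 1 ->
  w * T / (2 * b) * ((1 - w) * expR (- (T * (1 - w) ^+ 2))) - T / b * expR (- T)
    <= resonance T b w.
Proof.
move=> b0 T0 /andP[w0 w1]; rewrite /resonance.
set em := expR (- (_ * (1 - w) ^+ 2)); set ep := expR (- (_ * (1 + w) ^+ 2)).
have em0 : 0 < em by exact: expR_gt0.
have ep0 : 0 < ep by exact: expR_gt0.
have epT : ep <= expR (- T) by rewrite ler_expR lerN2 -[leLHS]mulr1 ler_wpM2l//; nra.
have h : w * T / (2 * b) * ((1 + w) * ep) <= T / b * expR (- T).
  have -> : w * T / (2 * b) * ((1 + w) * ep) = T / b * (w * (1 + w) / 2 * ep) by field; rewrite gt_eqF.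
  rewrite ler_wpM2l ?divr_ge0 ?(ltW b0)//; apply: le_trans epT.
  by rewrite ler_piMl ?(ltW ep0)//; nra.
rewrite mulrBr; lra.
Qed.

(** Only t1 and t2 within 1/th of 1 are kept; the possibly negative part of
    [resonance] is exponentially small. *)
Lemma coslap_lower {R : realType} (a b c k : R) : 0 < a -> 0 < b -> a < c -> 0 <= k ->
  exists2 d : R, 0 < d & exists2 D : R, 0 < D & forall th, 2 <= th ->
    d * th `^ (- (b + c - a - 3 / 2)) - D * th `^ (- k) <= coslap a b c (th ^- 2).
Proof.
move=> a0 b0 ac k0.
have g1 : -1 < b - 1 / 2 by lra.
have z1 : -1 < 0 :> R by lra.
have g2 : -1 < c - a - 1 by lra.
have s2 : -1 < 2 * a - 1 by lra.
have B1 := beta_mass_gt0 g1 z1 (@ltr01 R); have B2 := beta_mass_gt0 g2 s2 (@ltr01 R).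
set m1 := beta_mass (b - 1 / 2) 0 1 in B1; set m2 := beta_mass (c - a - 1) (2 * a - 1) 1 in B2.
have M0 : 0 < m1 * m2 by rewrite mulr_gt0.
have [C0 C00 hC0] := gamma_mass_le (@half_gt0 R).
have [c0 c00 hc0] := gamma_mass_ge (@half_gt0 R).
have [k1 k10 hk1] := @betaw_lower R (b - 1 / 2) 0.
have [k2 k20 hk2] := @betaw_lower R (c - a - 1) (2 * a - 1).
have [G G0 hG] := @gauss_bound R (k + 3).
pose d0 : R := expR (- 4) / (16 * b).
have d00 : 0 < d0 by rewrite divr_gt0 ?expR_gt0// mulr_gt0.
exists (c0 * (m1 * m2)^-1 * (k2 * (k1 * d0 / 2) / 2)).
  by do ?[exact: d00 | exact: k10 | exact: k20 | exact: c00 | exact: M0 | rewrite invr_gt0 | apply: mulr_gt0].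
exists (C0 * (b^-1 * G)); first by rewrite !mulr_gt0 ?invr_gt0.
move=> th th2; have th0 : 0 < th by lra.
have s0 : 0 < th ^- 2 by rewrite invr_gt0 exprn_gt0.
have [_ ii io e] := cos_laplace a0 b0 ac s0.
have mD : measurable (`]0, 1[%classic : set R) by exact: measurable_itv.
rewrite /coslap e invrK; move: ii io; rewrite invrK => ii io {e}; rewrite -/m1 -/m2.
pose inn t2 := \int[mu]_(t1 in `]0, 1[) (betaw (b - 1 / 2) 0 1 t1 * resonance (th ^+ 2) b (t1 * t2)).
set I := \int[mu]_(t2 in `]0, 1[) _.
pose N := th ^+ 2 / b * expR (- th ^+ 2).
have N0 : 0 <= N by rewrite mulr_ge0 ?expR_ge0// divr_ge0 ?sqr_ge0// ltW.
(* The rectangle is 1 - tau <= t <= 1 - tau/2 in both variables. *)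
pose tau := th^-1.
have tau0 : 0 < tau by rewrite invr_gt0.
have tt : th * tau = 1 by rewrite mulfV// gt_eqF.
have tau2 : tau <= 1 / 2 by rewrite /tau -(div1r th) ler_pdivrMr//; lra.
have tau02 : 0 < tau <= 1 / 2 by rewrite tau0.
have T0 : 0 <= th ^+ 2 by exact: sqr_ge0.
have r0 t1 t2 : 0 < t1 < 1 -> 0 < t2 < 1 -> 0 <= resonance (th ^+ 2) b (t1 * t2) + N.
  move=> /andP[u0 u1] /andP[v0 v1].
  have w0 : 0 < t1 * t2 by rewrite mulr_gt0.
  have w1 : t1 * t2 < 1 by rewrite mulr_ilt1// ltW.
  have w01 : 0 < t1 * t2 < 1 by rewrite w0.
  have := resonance_lower b0 T0 w01; rewrite -/N.
  have : 0 <= t1 * t2 * th ^+ 2 / (2 * b) * ((1 - t1 * t2) * expR (- (th ^+ 2 * (1 - t1 * t2) ^+ 2))).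
    apply: mulr_ge0; first by rewrite divr_ge0 ?mulr_ge0// ltW.
    by rewrite mulr_ge0 ?expR_ge0// subr_ge0 ltW.
  by lra.
have in01 t : 1 - tau <= t <= 1 - tau / 2 -> 0 < t < 1 by move=> /andP[h1 h2]; apply/andP; split; lra.
have rl t1 t2 : 1 - tau <= t1 <= 1 - tau / 2 -> 1 - tau <= t2 <= 1 - tau / 2 ->
    th * d0 <= resonance (th ^+ 2) b (t1 * t2) + N.
  move=> h1 h2; have /andP[u0 u1] := in01 _ h1; have /andP[v0 v1] := in01 _ h2.
  case/andP: h1 => h11 h12; case/andP: h2 => h21 h22.
  pose w := t1 * t2.
  have w0 : 0 < w by rewrite mulr_gt0.
  have w1 : w < 1 by rewrite /w mulr_ilt1// ltW.
  have w01 : 0 < w < 1 by rewrite w0.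
  have w4 : 1 / 4 <= w by rewrite /w; nra.
  have w5 : tau / 2 <= 1 - w by rewrite /w; nra.
  have w6 : 1 - w <= 2 * tau by rewrite /w; nra.
  have := resonance_lower b0 T0 w01; rewrite -/N -/w.
  clearbody w.
  suff : th * d0 <= w * th ^+ 2 / (2 * b) * ((1 - w) * expR (- (th ^+ 2 * (1 - w) ^+ 2))) by lra.
  have -> : th * d0 = (1 / 4 * th ^+ 2 / (2 * b)) * ((tau / 2) * expR (- 4)).
    rewrite /d0 /tau; field; rewrite !gt_eqF//.
  apply: ler_pM.
  - by rewrite divr_ge0 ?mulr_ge0 ?divr_ge0// ltW.
  - by rewrite mulr_ge0 ?expR_ge0// divr_ge0// ltW.
  - by rewrite ler_wpM2r ?invr_ge0 ?mulr_ge0 ?(ltW b0)// ler_wpM2r.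
  - apply: ler_pM; rewrite ?expR_ge0 ?divr_ge0 ?(ltW tau0)//.
    rewrite ler_expR lerN2 -exprMn.
    have x0 : 0 <= th * (1 - w) by rewrite mulr_ge0 ?(ltW th0)//; lra.
    have x2 : th * (1 - w) <= 2.
      by apply: (le_trans (ler_wpM2l (ltW th0) w6)); rewrite mulrCA tt mulr1.
    by nra.
clearbody d0.
have i1w := betaw_integrable g1 z1 (@ltr01 R); have i2w := betaw_integrable g2 s2 (@ltr01 R).
have dist (g s : R) (f : R -> R) : mu.-integrable `]0, 1[ (EFin \o betaw g s 1) ->
   mu.-integrable `]0, 1[ (EFin \o (fun t => betaw g s 1 t * f t)) -> forall n : R,
   mu.-integrable `]0, 1[ (EFin \o (fun t => betaw g s 1 t * (f t + n))) /\
   \int[mu]_(t in `]0, 1[) (betaw g s 1 t * (f t + n)) =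
   \int[mu]_(t in `]0, 1[) (betaw g s 1 t * f t) + n * beta_mass g s 1.
  move=> iw iwf n; have il := integrable_lin 1 n mD iwf iw.
  have ee t : 1 * (betaw g s 1 t * f t) + n * betaw g s 1 t = betaw g s 1 t * (f t + n) by ring.
  split; first by apply: (eq_integrableR mD _ il) => t _; exact: ee.
  by rewrite -(eq_Rint _ ee) Rintegral_lin// mul1r.
have inn0 t2 : 0 < t2 < 1 -> 0 <= inn t2 + N * m1.
  move=> h2; have [_ <-] := dist _ _ _ i1w (ii _ h2) N.
  by apply: Rintegral_ge0 => t1; rewrite /= in_itv/= => h1; rewrite mulr_ge0 ?r0// betaw_ge0.
have innl t2 : 1 - tau <= t2 <= 1 - tau / 2 -> k1 * tau `^ (b - 1 / 2) * (th * d0) * (tau / 2) <= inn t2 + N * m1.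
  move=> h2; have [id1 <-] := dist _ _ _ i1w (ii _ (in01 _ h2)) N.
  have -> : tau / 2 = (1 - tau / 2) - (1 - tau) by field.
  apply: Rintegral_ge_sub => //.
  - by move=> t1; rewrite /= in_itv/= => h1; rewrite mulr_ge0 ?betaw_ge0 ?r0// in01.
  - by lra.
  - by rewrite !mulr_ge0 ?powR_ge0 ?(ltW k10) ?(ltW th0) ?(ltW d00).
  - move=> t1 h1; split; first by rewrite /= in_itv/= in01.
    apply: ler_pM; rewrite ?mulr_ge0 ?powR_ge0 ?(ltW k10) ?(ltW th0) ?(ltW d00)//.
      exact: hk1.
    exact: rl.
have [id2 e2] := dist _ _ inn i2w io (N * m1).
have IL : k2 * tau `^ (c - a - 1) * (k1 * tau `^ (b - 1 / 2) * (th * d0) * (tau / 2)) * (tau / 2) <= I + N * m1 * m2.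
  rewrite -e2 -/m2.
  have -> : tau / 2 = (1 - tau / 2) - (1 - tau) by field.
  have p0 : 0 <= k1 * tau `^ (b - 1 / 2) * (th * d0) * ((1 - tau / 2) - (1 - tau)).
    by rewrite mulr_ge0 ?mulr_ge0 ?powR_ge0 ?(ltW k10) ?(ltW th0) ?(ltW d00)//; lra.
  apply: Rintegral_ge_sub => //.
  - by move=> t1; rewrite /= in_itv/= => h1; rewrite mulr_ge0 ?betaw_ge0// inn0.
  - by lra.
  - by rewrite mulr_ge0// mulr_ge0 ?powR_ge0// ltW.
  - move=> t1 h1; split; first by rewrite /= in_itv/= in01.
    apply: ler_pM => //; [by rewrite mulr_ge0 ?powR_ge0 ?(ltW k20)|exact: hk2|].
    have -> : (1 - tau / 2) - (1 - tau) = tau / 2 by field.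
    exact: innl.
set gm := gamma_mass _ _.
have e1 (x y : R) : th `^ x * th `^ y = th `^ (x + y) by rewrite -powRD// (gt_eqF th0) implybT.
have et (x : R) : tau `^ x = th `^ (- x).
  by rewrite /tau -(powR_inv1 (ltW th0)) -powRrM mulN1r.
have esq : (th ^- 2) `^ (- (1 / 2)) = th.
  rewrite -(powR_inv1 (sqr_ge0 th)) -(powR_mulrn 2 (ltW th0)) -!powRrM.
  by rewrite (_ : 2%:R * (-1 * - (1 / 2)) = 1) ?powRr1 ?(ltW th0)//; field.
have hm1 : gm <= C0 * th by rewrite -[X in _ * X]esq; exact: hC0.
have hm2 : c0 * th <= gm by rewrite -[X in _ * X]esq; exact: hc0.
have gm0 : 0 < gm by rewrite gamma_mass_gt0// half_gt0.
set L := k2 * _ * _ * _ in IL.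
have L0 : 0 <= L by rewrite !mulr_ge0 ?powR_ge0 ?invr_ge0 ?(ltW k20) ?(ltW k10) ?(ltW th0) ?(ltW d00) ?(ltW tau0).
have hI : L - N * m1 * m2 <= I by lra.
have step : gm / (m1 * m2) * (L - N * m1 * m2) <= gm / (m1 * m2) * I.
  by rewrite ler_wpM2l// divr_ge0// ltW.
apply: le_trans step.
have -> : gm / (m1 * m2) * (L - N * m1 * m2) = gm / (m1 * m2) * L - gm * N.
  by field; rewrite !gt_eqF.
apply: lerB.
  have -> : c0 / (m1 * m2) * (k2 * (k1 * d0 / 2) / 2) * th `^ (- (b + c - a - 3 / 2)) = c0 * th / (m1 * m2) * L.
    have -> : th `^ (- (b + c - a - 3 / 2)) = th `^ 1 * th `^ (- (c - a - 1)) * th `^ (- (b - 1 / 2)) * th `^ (- 1).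
      by rewrite !e1; congr (_ `^ _); field.
    rewrite /L !et powRr1 ?(ltW th0)// powR_inv1 ?(ltW th0)//.
    have -> : tau = th^-1 by [].
    by field; rewrite !gt_eqF.
  by rewrite ler_wpM2r// ler_wpM2r// invr_ge0 ltW.
apply: (@le_trans _ _ (C0 * th * N)); first by rewrite ler_wpM2r.
have hg : expR (- th ^+ 2) <= G * th `^ (- (k + 3)).
  apply: (le_trans (hG _ (ltW th0))); rewrite ler_wpM2l ?(ltW G0)//.
  by apply: le_powR_neg; rewrite ?lerDr//; lra.
have -> : C0 * (b^-1 * G) * th `^ (- k) = C0 * th * (th ^+ 2 / b * (G * th `^ (- (k + 3)))).
  have -> : th `^ (- k) = th `^ 3%:R * th `^ (- (k + 3)) by rewrite e1; congr (_ `^ _); ring.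
  by rewrite powR_mulrn ?(ltW th0)//; ring.
rewrite ler_wpM2l ?mulr_ge0 ?(ltW C00) ?(ltW th0)//.
by rewrite ler_wpM2l// divr_ge0// ltW.
Qed.

(** * Differences along dilations by four *)

(** The j-th step removes the geometric sequence 4^(-j n), that is, the power
    s^j from a function of s = 4^(-n). *)
Fixpoint scale_diff {R : pzRingType} (S : nat -> R) (j n : nat) : R :=
  if j is j'.+1 then scale_diff S j' n - 4 ^+ j' * scale_diff S j' n.+1 else S n.

Lemma le0_geometric {R : realType} (x K q : R) : 0 <= q < 1 ->
  (forall i : nat, x <= K * q ^+ i) -> x <= 0.
Proof.
move=> /andP[q0 q1] h.
have c : (fun i => K * q ^+ i) @ \oo --> (K * 0 : R).
  by apply: cvgMl_tmp; apply: cvg_expr; rewrite ger0_norm.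
rewrite -(mulr0 K) -(cvg_lim (@Rhausdorff R) c); apply: limr_ge; last exact: nearW.
by apply/cvg_ex; eexists; exact: c.
Qed.

Lemma scale_diff_bound {R : realType} (S : nat -> R) (C r : R) j : 0 <= r ->
  (forall n, `|S n| <= C * r ^+ n) -> exists C', forall n, `|scale_diff S j n| <= C' * r ^+ n.
Proof.
move=> r0 h; elim: j => [|j [C' h']]; first by exists C.
exists (C' + 4 ^+ j * (C' * r)) => n /=.
apply: (le_trans (ler_normB _ _)); rewrite mulrDl lerD//.
rewrite normrM ger0_norm ?exprn_ge0// -!mulrA ler_wpM2l ?exprn_ge0//.
by rewrite -exprS.
Qed.

(** Solve D_j(n) - 4^j D_j(n+1) = O(th^n).  When 4^j th > 1 the recursion is
    stable in the direction of increasing n; when 4^j r < 1 it is solved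
    backwards, the a priori bound r^n excluding the homogeneous solution. *)
Lemma scale_diff_step {R : realType} (S : nat -> R) (C r th : R) j : 0 < th -> th < r ->
  (exists C, forall n, `|S n| <= C * r ^+ n) ->
  4 ^+ j * r < 1 \/ 1 < 4 ^+ j * th ->
  (forall n, `|scale_diff S j.+1 n| <= C * th ^+ n) ->
  exists C', forall n, `|scale_diff S j n| <= C' * th ^+ n.
Proof.
move=> th0 thr [C0 h0] alt h; pose D := scale_diff S j.
have f0 : 0 < 4 ^+ j :> R by rewrite exprn_gt0.
have rec n : scale_diff S j.+1 n = D n - 4 ^+ j * D n.+1 by [].
have t0 n : 0 < th ^+ n by rewrite exprn_gt0.
have C_ge0 : 0 <= C by have := le_trans (normr_ge0 _) (h 0%N); rewrite expr0 mulr1.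
case: alt => alt.
  have [C1 h1] := scale_diff_bound j (ltW (lt_trans th0 thr)) h0.
  have p : 0 < 1 - 4 ^+ j * th.
    by rewrite subr_gt0; apply: lt_trans alt; rewrite ltr_pM2l.
  pose C' := C / (1 - 4 ^+ j * th); exists C'.
  have eC : C' = 4 ^+ j * (C' * th) + C by rewrite /C'; field; rewrite gt_eqF.
  pose x n := `|D n| - C' * th ^+ n.
  have xs n : x n <= 4 ^+ j * x n.+1.
    have e : D n = 4 ^+ j * D n.+1 + scale_diff S j.+1 n by rewrite rec; ring.
    have : `|D n| <= 4 ^+ j * `|D n.+1| + C * th ^+ n.
      rewrite {1}e; apply: (le_trans (ler_normD _ _)); rewrite lerD//.
      by rewrite normrM (gtr0_norm f0).
    rewrite /x exprS {1}eC => hh; lra.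
  have xi n i : x n <= (4 ^+ j) ^+ i * x (n + i)%N.
    elim: i => [|i IH]; first by rewrite expr0 mul1r addn0.
    apply: (le_trans IH); rewrite addnS exprSr -mulrA ler_wpM2l ?exprn_ge0 ?(ltW f0)//.
  move=> n; rewrite -subr_le0; apply: (@le0_geometric _ _ (C1 * r ^+ n) (4 ^+ j * r)).
    by rewrite alt mulr_ge0 ?(ltW f0)// ltW// (lt_trans th0).
  move=> i; apply: (le_trans (xi n i)).
  have -> : C1 * r ^+ n * (4 ^+ j * r) ^+ i = (4 ^+ j) ^+ i * (C1 * r ^+ (n + i)).
    by rewrite exprMn exprD; ring.
  rewrite ler_wpM2l ?exprn_ge0 ?(ltW f0)//.
  have C'0 : 0 <= C' by rewrite divr_ge0// ltW.
  apply: le_trans (h1 _); rewrite /x lerBlDr lerDl mulr_ge0// ltW//.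
have p : 0 < 4 ^+ j * th - 1 by rewrite subr_gt0.
(* Large enough for n = 0, and for the induction step C + C' <= 4^j th C'. *)
pose C' := `|D 0%N| + C / (4 ^+ j * th - 1); exists C'.
have hC : C + C' <= 4 ^+ j * th * C'.
  rewrite -subr_ge0 (_ : _ - _ = (4 ^+ j * th - 1) * `|D 0%N|); last first.
    by rewrite /C'; field; rewrite gt_eqF.
  by rewrite mulr_ge0// ltW.
elim=> [|n IH]; first by rewrite expr0 mulr1 lerDl divr_ge0// ltW.
rewrite -(ler_pM2l f0) -[X in X * `|_|](gtr0_norm f0) -normrM.
have -> : 4 ^+ j * scale_diff S j n.+1 = D n - scale_diff S j.+1 n by rewrite rec /D; ring.
apply: (le_trans (ler_normB _ _)); apply: (le_trans (lerD IH (h n))).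
have -> : 4 ^+ j * (C' * th ^+ n.+1) = 4 ^+ j * th * C' * th ^+ n by rewrite exprS; ring.
rewrite -mulrDl.
by rewrite ler_wpM2r ?(ltW (t0 _))// addrC.
Qed.

(** No power 4^(-j) may lie between th and r: such a term would be cancelled
    in the differences and yet be present in S. *)
Lemma scale_diff_regular {R : realType} (S : nat -> R) (r th : R) M : 0 < th -> th < r ->
  (exists C, forall n, `|S n| <= C * r ^+ n) ->
  (forall j, 4 ^+ j * r < 1 \/ 1 < 4 ^+ j * th) ->
  (exists C, forall n, `|scale_diff S M n| <= C * th ^+ n) ->
  exists C, forall n, `|S n| <= C * th ^+ n.
Proof.
move=> th0 thr hS alt; elim: M => [//|M IH] [C h].
by apply: IH; exact: scale_diff_step th0 thr hS (alt M) h.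
Qed.

(** The polynomials q_j for which the j-th difference of n |-> e^(-y/4^n) is
    q_j(e^(-y/4^(n+j))). *)
Fixpoint scale_poly (R : nzRingType) (j : nat) : {poly R} :=
  if j is j'.+1 then scale_poly R j' \Po 'X^4 - 4 ^+ j' *: scale_poly R j' else 'X.

(** Composition with x^4 keeps a zero of order j at 1 and scales it by 4^j,
    so the next difference gains one more order. *)
Lemma scale_poly_factor (R : fieldType) j : exists r : {poly R},
  scale_poly R j = 'X * ('X - 1) ^+ j * r.
Proof.
elim: j => [|j [r IH]]; first by exists 1; rewrite expr0 !mulr1.
(* X^4 - 1 = (X - 1) g, and g(1) = 4 cancels the factor 4^j. *)
pose g : {poly R} := 1 + 'X + 'X ^+ 2 + 'X ^+ 3.
pose p := 'X ^+ 3 * g ^+ j * (r \Po 'X^4) - 4 ^+ j *: r.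
have g1 : g.[1] = 4.
  by rewrite /g !hornerD !horner_exp !hornerX hornerC !expr1n; ring.
have : root p 1.
  rewrite /root /p hornerD hornerN hornerM hornerM hornerZ horner_comp !horner_exp !hornerX.
  by rewrite g1 !expr1n mul1r subrr.
move=> /factor_theorem[s es]; exists s; rewrite /= IH !comp_polyM rmorphXn/= comp_polyB comp_polyX comp_polyC.
have -> : 'X^4 - 1 = ('X - 1) * g :> {poly R} by rewrite /g; ring.
have -> : 'X * ('X - 1) ^+ j.+1 * s = 'X * ('X - 1) ^+ j * (s * ('X - 1)) by rewrite exprS; ring.
rewrite -[X in s * X](_ : 'X - 1%:P = _)// -es /p -mul_polyC.
by rewrite -[4 ^+ j *: r]mul_polyC exprMn; ring.
Qed.

Lemma poly_bounded (R : realFieldType) (p : {poly R}) :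
  exists2 C : R, 0 <= C & forall x, 0 <= x <= 1 -> `|p.[x]| <= C.
Proof.
elim/poly_ind: p => [|p c [C C0 h]]; first by exists 0 => // x _; rewrite horner0 normr0.
exists (C + `|c|); first by rewrite addr_ge0.
move=> x x01; rewrite !hornerE; apply: (le_trans (ler_normD _ _)); rewrite lerD2r.
by case/andP: (x01) => x0 x1; rewrite normrM (ger0_norm x0) (le_trans _ (h _ x01))// ler_piMr.
Qed.

Lemma scale_poly_bound (R : realFieldType) j :
  exists2 C : R, 0 <= C & forall x, 0 <= x <= 1 -> `|(scale_poly R j).[x]| <= C * (x * (1 - x) ^+ j).
Proof.
have [r ->] := @scale_poly_factor R j; have [C C0 h] := poly_bounded r; exists C => // x x01.
case/andP: (x01) => x0 x1.
have e : `|x - 1| = 1 - x by rewrite distrC ger0_norm ?subr_ge0.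
have -> : ('X * ('X - 1) ^+ j * r).[x] = x * (x - 1) ^+ j * r.[x].
  by rewrite hornerM hornerM horner_exp hornerX hornerD hornerN hornerX hornerC.
rewrite normrM normrM normrX e (ger0_norm x0) mulrC ler_wpM2r ?h//.
by rewrite mulr_ge0// exprn_ge0// subr_ge0.
Qed.

(** The zero of order M of the kernel at y = 0 may be traded for the power
    needed to compare with the Laplace weight y^(b-1). *)
Lemma cut_le_powR {R : realType} (p z : R) M : p <= M%:R -> -1 <= p -> 0 < z ->
  (1 - expR (- z)) ^+ M <= 2 * (z `^ p * expR (z / 2)).
Proof.
move=> pM p1 z0.
have w1 : 1 - expR (- z) <= 1 by rewrite lerBlDr lerDl expR_ge0.
have w0 : 0 <= 1 - expR (- z) by rewrite subr_ge0 -expR0 ler_expR oppr_le0 ltW.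
have wz : 1 - expR (- z) <= z by have := @expR_ge1Dx R (- z); lra.
have e1 : 1 + z / 2 <= expR (z / 2) by exact: expR_ge1Dx.
have pz : 0 < z `^ p by rewrite powR_gt0.
suff : (1 - expR (- z)) ^+ M <= z `^ p * (1 + z).
  move=> h; apply: (le_trans h); rewrite mulrCA ler_wpM2l ?(ltW pz)//; lra.
(* For z > 1 the power is bounded by 1 and z^p (1+z) exceeds z^(p+1). *)
have [z1|z1] := leP z 1.
  apply: (@le_trans _ _ (z `^ p)); last by rewrite ler_peMr ?(ltW pz)// lerDl ltW.
  apply: (@le_trans _ _ (z ^+ M)); first by rewrite lerXn2r ?nnegrE ?(ltW z0).
  rewrite -(powR_mulrn M (ltW z0)).
  by apply: ger_powR; rewrite // z0 z1.
apply: (@le_trans _ _ 1); first by rewrite exprn_ile1.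
apply: (@le_trans _ _ (z `^ p * z)); last by rewrite ler_wpM2l ?(ltW pz)// lerDr.
rewrite -[X in _ * X](powRr1 (ltW z0)) -powRD ?(gt_eqF z0) ?implybT//.
apply: (@le_trans _ _ (z `^ 0)); first by rewrite powRr0.
by apply: ler_powR; [exact: ltW | lra].
Qed.

(** * Second necessary condition *)

(** The integrand of [coslap] without its exponential. *)
Definition osc {R : realType} (a b c y : R) : R :=
  y `^ (1 / 2 - 1) * (cos (2 * Num.sqrt y) * hyp1F2 a b c y).

Lemma scale_diff_coslap {R : realType} (a b c : R) j n : 0 < a -> 0 < b -> a < c ->
  mu.-integrable `]0, +oo[
    (EFin \o (fun y => (scale_poly R j).[expR (- ((4 ^+ (n + j))^-1 * y))] * osc a b c y)) /\
  scale_diff (fun n => coslap a b c ((2 ^+ n) ^- 2)) j n =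
  \int[mu]_(y in `]0, +oo[)
    ((scale_poly R j).[expR (- ((4 ^+ (n + j))^-1 * y))] * osc a b c y).
Proof.
move=> a0 b0 ac; have mR : measurable (`]0, +oo[%classic : set R) by exact: measurable_itv.
elim: j n => [|j IH] n.
  have s0 : 0 < (2 ^+ n) ^- 2 :> R by rewrite invr_gt0 !exprn_gt0.
  have [i _ _ _] := cos_laplace a0 b0 ac s0.
  have ee (y : R) : gammaw (1 / 2) ((2 ^+ n) ^- 2) y * (cos (2 * Num.sqrt y) * hyp1F2 a b c y) =
     (scale_poly R 0).[expR (- ((4 ^+ (n + 0))^-1 * y))] * osc a b c y.
    rewrite /= hornerX addn0 (_ : (4 ^+ n)^-1 = (2 ^+ n) ^- 2); last first.
      by rewrite -exprM mulnC exprM; congr ((_ ^+ _)^-1); ring.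
    by rewrite /gammaw /osc; ring.
  split; first by apply: (eq_integrableR mR _ i) => y _; exact: ee.
  by rewrite /= /coslap (eq_Rint _ ee).
have [i1 e1] := IH n; have [i2 e2] := IH n.+1.
have ee (y : R) : 1 * ((scale_poly R j).[expR (- ((4 ^+ (n + j))^-1 * y))] * osc a b c y) +
   - 4 ^+ j * ((scale_poly R j).[expR (- ((4 ^+ (n.+1 + j))^-1 * y))] * osc a b c y) =
   (scale_poly R j.+1).[expR (- ((4 ^+ (n + j.+1))^-1 * y))] * osc a b c y.
  rewrite /= hornerD hornerN hornerZ horner_comp hornerXn addSnnS.
  have -> : expR (- ((4 ^+ (n + j.+1))^-1 * y)) ^+ 4 = expR (- ((4 ^+ (n + j))^-1 * y)).
    rewrite -expRM_natl; congr expR; rewrite addnS exprS.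
    have h : 4 ^+ (n + j) != 0 :> R by rewrite expf_neq0.
    by field; rewrite h.
  by ring.
split; first by apply: (eq_integrableR mR _ (integrable_lin 1 (- 4 ^+ j) mR i1 i2)) => y _; exact: ee.
by rewrite -(eq_Rint _ ee) Rintegral_lin//= e1 e2 mul1r mulNr.
Qed.

(** Here positivity of f enters: |cos| <= 1 bounds the difference by a Laplace
    integral of f itself, which has order s^(a-1/2). *)
Lemma scale_diff_coslap_bound {R : realType} (a b c : R) M : 0 < a -> 0 < b -> a < c ->
  (forall y, 0 < y -> 0 <= hyp1F2 a b c y) -> b - 1 / 2 <= M%:R ->
  exists C, forall n, `|scale_diff (fun n => coslap a b c ((2 ^+ n) ^- 2)) M n| <=
    C * (4 `^ (- (a - 1 / 2))) ^+ n.
Proof.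
move=> a0 b0 ac f0 bM; have mR : measurable (`]0, +oo[%classic : set R) by exact: measurable_itv.
have [C0 C00 h0] := @scale_poly_bound R M; have [C1 C10 h1] := laplace_upper a0 b0 ac.
exists (2 * C0 * C1 * 2 `^ (b - a) * (4 `^ (- (a - 1 / 2))) ^+ M) => n.
have [i ->] := scale_diff_coslap M n a0 b0 ac.
set sg := (4 ^+ (n + M))^-1.
have s0 : 0 < sg by rewrite invr_gt0 exprn_gt0.
have s20 : 0 < sg / 2 by rewrite divr_gt0.
have [il _] := laplace_hyp1F2 a0 b0 ac s20.
apply: (@le_trans _ _ (\int[mu]_(y in `]0, +oo[)
   `|(scale_poly R M).[expR (- (sg * y))] * osc a b c y|)); first exact: le_normr_Rintegral.
apply: (@le_trans _ _ (\int[mu]_(y in `]0, +oo[)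
   ((2 * C0 * sg `^ (b - 1 / 2)) * (gammaw b (sg / 2) y * hyp1F2 a b c y)))).
  apply: Rintegral_le => //; [exact: (integrable_norm i)|exact: integrableZ|].
  move=> y; rewrite /= in_itv/= andbT => y0.
  have sy : 0 < sg * y by rewrite mulr_gt0.
  have x01 : 0 <= expR (- (sg * y)) <= 1.
    by rewrite expR_ge0/= -expR0 ler_expR oppr_le0 ltW.
  have p1 : -1 <= b - 1 / 2 by lra.
  have hc := cut_le_powR bM p1 sy.
  rewrite normrM /osc !normrM (ger0_norm (powR_ge0 _ _)) (ger0_norm (f0 _ y0)).
  have cos1 : `|cos (2 * Num.sqrt y)| <= 1 by rewrite ler_norml cos_geN1 cos_le1.
  have -> : 2 * C0 * sg `^ (b - 1 / 2) * (gammaw b (sg / 2) y * hyp1F2 a b c y) =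
    (C0 * (expR (- (sg * y)) * (2 * ((sg * y) `^ (b - 1 / 2) * expR (sg * y / 2))))) *
      (y `^ (1 / 2 - 1) * (1 * hyp1F2 a b c y)).
    have ey : y `^ (b - 1) = y `^ (b - 1 / 2) * y `^ (1 / 2 - 1).
      by rewrite -powRD ?(gt_eqF y0) ?implybT//; congr (_ `^ _); field.
    have ex : expR (- (sg / 2 * y)) = expR (- (sg * y)) * expR (sg * y / 2).
      by rewrite -expRD; congr expR; field.
    by rewrite /gammaw ey ex powRM ?(ltW s0) ?(ltW y0)//; ring.
  apply: ler_pM; rewrite ?mulr_ge0 ?powR_ge0 ?f0//.
    apply: (le_trans (h0 _ x01)); rewrite ler_wpM2l// ler_wpM2l ?expR_ge0//.
  by rewrite ler_wpM2l ?powR_ge0// ler_wpM2r ?f0.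
rewrite RintegralZ//.
apply: (le_trans (ler_wpM2l _ (h1 _ s20))).
  by rewrite !mulr_ge0 ?powR_ge0.
have sn : sg != 0 by rewrite gt_eqF.
have -> : (sg / 2) `^ (a - b) = sg `^ (a - b) * 2 `^ (b - a).
  rewrite powRM ?(ltW s0) ?invr_ge0// -(powR_inv1 (ler0n R 2)) -powRrM mulN1r.
  by congr (_ * _ `^ _); ring.
have es : sg `^ (b - 1 / 2) * sg `^ (a - b) = (4 `^ (- (a - 1 / 2))) ^+ (n + M).
  rewrite -powRD ?sn ?implybT// (_ : b - 1 / 2 + (a - b) = a - 1 / 2); last by ring.
  have -> : sg = 4 `^ (- (n + M)%:R) by rewrite powRN powR_mulrn.
  rewrite -(powR_mulrn (n + M) (powR_ge0 4 _)) -!powRrM (_ : - (n + M)%:R * (a - 1 / 2) = - (a - 1 / 2) * (n + M)%:R)//.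
  by ring.
rewrite le_eqVlt; apply/orP; left; apply/eqP.
transitivity (2 * C0 * C1 * 2 `^ (b - a) * (sg `^ (b - 1 / 2) * sg `^ (a - b))); first by ring.
by rewrite es exprD; ring.
Qed.

(** A beta average of nonnegative functions is nonnegative. *)
Lemma hyp1F2_raise {R : realType} (a b c c' y : R) : 0 < b -> 0 < c -> c < c' ->
  (forall y, 0 < y -> 0 <= hyp1F2 a b c y) -> 0 < y -> 0 <= hyp1F2 a b c' y.
Proof.
move=> b0 c0 cc f0 y0.
have g1 : -1 < c' - c - 1 by lra.
have s1 : -1 < 2 * c - 1 by lra.
have [_ e] := beta_transform (- y) g1 s1 (@ltr01 R) (growth_weak (hyp1F2_coef_growth a b0 c0)).
have B0 := beta_mass_gt0 g1 s1 (@ltr01 R).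
have -> : hyp1F2 a b c' y = (beta_mass (c' - c - 1) (2 * c - 1) 1)^-1 *
  \int[mu]_(t in `]0, 1[) (betaw (c' - c - 1) (2 * c - 1) 1 t * psum (hyp1F2_coef a b c) (- y * t ^+ 2)).
  rewrite e mulKf ?gt_eqF// expr1n mulr1; apply: eq_psum => k.
  have -> : (2 * c - 1 + 1) / 2 = c by field.
  have -> : c + (c' - c - 1) + 1 = c' by ring.
  have pc := gt_eqF (poch_gt0 k c0); have pb := gt_eqF (poch_gt0 k b0).
  have pc' := gt_eqF (poch_gt0 k (lt_trans c0 cc)).
  by rewrite /hyp1F2_coef; field; rewrite pc pb pc' fact_neq0.
rewrite mulr_ge0 ?invr_ge0 ?(ltW B0)//; apply: Rintegral_ge0 => t; rewrite /= in_itv/= => /andP[t0 t1].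
rewrite mulr_ge0 ?betaw_ge0// mulNr; apply: f0.
by rewrite mulr_gt0// exprn_gt0.
Qed.

Lemma nat_gap {R : archiRealFieldType} (e : R) :
  exists2 m : R, m < e & forall j : nat, j%:R <= m \/ e <= j%:R.
Proof.
suff H N : e <= N%:R -> exists2 m : R, m < e & forall j : nat, j%:R <= m \/ e <= j%:R.
  by apply: (H (Num.trunc e).+1); exact/ltW/truncnS_gt.
elim: N => [|N IH] eN.
  exists (e - 1); first by lra.
  by move=> j; right; apply: (le_trans eN); rewrite ler_nat.
have [h|h] := leP e N%:R; first exact: IH.
exists N%:R => // j; have [jN|jN] := leqP j N; [left|right]; first by rewrite ler_nat.
by apply: (le_trans eN); rewrite ler_nat.
Qed.

Lemma powR_lt1 {R : realType} (x : R) : x < 0 -> 4 `^ x < 1.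
Proof.
move=> x0; rewrite -[x]opprK powRN invf_lt1 ?powR_gt0//.
have : (1 : R) `^ (- x) < 4 `^ (- x).
  by apply: gt0_ltr_powR; rewrite ?oppr_gt0 ?nnegrE ?ltr1n.
by rewrite powR1.
Qed.

(** Otherwise the cosine transform, of order s^rho with
    rho = (b+c-a-3/2)/2, is larger than the order s^e, e = a-1/2, permitted
    by positivity.  Positivity bounds only differences of the transform, so
    rho and e must have no natural number between them; this is arranged by
    raising c, which preserves positivity and increases rho. *)
Lemma hyp1F2_ge0_sum {R : realType} (a b c : R) : 0 < a -> 0 < b -> a < c ->
  (forall y, 0 < y -> 0 <= hyp1F2 a b c y) -> 3 * a + 1 / 2 <= b + c.
Proof.
move=> a0 b0 ac f0; rewrite leNgt; apply/negP => hlt.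
pose e := a - 1 / 2.
(* rho is pushed above its actual value and above the largest natural number below e. *)
have [m me hm] := nat_gap e.
pose rho := (Num.max ((b + c - a - 3 / 2) / 2) m + e) / 2.
have mx : Num.max ((b + c - a - 3 / 2) / 2) m < e.
  by rewrite gt_max me andbT /e; lra.
have re : rho < e by rewrite /rho; lra.
have mr : m < rho.
  have : m <= Num.max ((b + c - a - 3 / 2) / 2) m by rewrite le_max lexx orbT.
  by rewrite /rho; lra.
have rr : (b + c - a - 3 / 2) / 2 < rho.
  have : (b + c - a - 3 / 2) / 2 <= Num.max ((b + c - a - 3 / 2) / 2) m by rewrite le_max lexx.
  by rewrite /rho; lra.
clearbody rho.
pose e' := (rho + e) / 2.
have re' : rho < e' by rewrite /e'; lra.
have ee' : e' < e by rewrite /e'; lra.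
clearbody e'.
(* The value for which the cosine transform has order s^rho. *)
pose c' := 2 * rho + a + 3 / 2 - b.
have cc : c < c' by rewrite /c'; lra.
have c0 : 0 < c by exact: lt_trans ac.
have ac' : a < c' by exact: lt_trans cc.
have f0' y : 0 < y -> 0 <= hyp1F2 a b c' y by exact: hyp1F2_raise b0 c0 cc f0.
have ce : b + c' - a - 3 / 2 = 2 * rho by rewrite /c'; ring.
pose S n := coslap a b c' ((2 ^+ n) ^- 2).
pose r : R := 4 `^ (- rho); pose th : R := 4 `^ (- e').
have th0 : 0 < th by rewrite powR_gt0.
have r0 : 0 < r by rewrite powR_gt0.
have four (x : R) j : 4 ^+ j * 4 `^ x = 4 `^ (j%:R + x).
  by rewrite powRD ?powR_mulrn// pnatr_eq0 implybT.
have thr : th < r.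
  rewrite -(ltr_pM2r (powR_gt0 rho (_ : 0 < 4))) ?ltr0n//.
  rewrite /th /r -!powRD ?pnatr_eq0 ?implybT// addNr powRr0; apply: powR_lt1; lra.
have sw (x : R) n : (2 ^+ n) `^ (- (2 * x)) = (4 `^ (- x)) ^+ n.
  rewrite -(powR_mulrn n (powR_ge0 _ _)) -(powR_mulrn n (ler0n R 2)) -!powRrM.
  have -> : (4 : R) = 2 `^ 2%:R by rewrite powR_mulrn//; ring.
  by rewrite -powRrM; congr (_ `^ _); ring.
have t1 n : 1 <= 2 ^+ n :> R by rewrite exprn_ege1// ler1n.
have hS : exists C, forall n, `|S n| <= C * r ^+ n.
  have [C C0 h] := coslap_upper a0 b0 ac'; exists C => n.
  by rewrite /r -sw -ce; exact: h.
have alt j : 4 ^+ j * r < 1 \/ 1 < 4 ^+ j * th.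
  rewrite /r /th !four; have [h|h] := hm j; [left|right].
    by apply: powR_lt1; lra.
  rewrite -[X in 1 < 4 `^ X]opprK powRN invf_gt1 ?powR_gt0//.
  by apply: powR_lt1; lra.
have [C hC] : exists C, forall n, `|S n| <= C * th ^+ n.
  have hM : b - 1 / 2 <= (Num.trunc (b - 1 / 2)).+1%:R by exact/ltW/truncnS_gt.
  apply: (@scale_diff_regular R S r th (Num.trunc (b - 1 / 2)).+1 th0 thr hS alt).
  have [C h] := scale_diff_coslap_bound a0 b0 ac' f0' hM.
  exists `|C| => n; apply: (le_trans (h n)).
  apply: (@le_trans _ _ (`|C| * (4 `^ (- (a - 1 / 2))) ^+ n)).
    by rewrite ler_wpM2r ?ler_norm// exprn_ge0// powR_ge0.
  rewrite ler_wpM2l// lerXn2r ?nnegrE ?powR_ge0//.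
  by apply: ler_powR; rewrite ?ler1n// lerN2 ltW.
(* The exponentially small term is only needed to beat th^n. *)
have [d d0 [D D0 hd]] := coslap_lower a0 b0 ac' (normr_ge0 (2 * e')).
have main n : d <= (C + D) * (th / r) * (th / r) ^+ n.
  have h2 : 2 <= 2 ^+ n.+1 :> R by rewrite exprS ler_peMr.
  have := hd _ h2; rewrite ce sw -/r => h3.
  have h4 : coslap a b c' ((2 ^+ n.+1) ^- 2) <= C * th ^+ n.+1 by exact: le_trans (ler_norm _) (hC _).
  have h5 : (2 ^+ n.+1) `^ (- `|2 * e'|) <= th ^+ n.+1 :> R.
    rewrite /th -sw; apply: ler_powR => //.
    by rewrite lerN2 ler_norm.
  have h6 : d * r ^+ n.+1 <= (C + D) * th ^+ n.+1.
    have := ler_wpM2l (ltW D0) h5; lra.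
  have rp : 0 < r ^+ n.+1 by rewrite exprn_gt0.
  rewrite -(ler_pM2r rp); apply: (le_trans h6).
  rewrite -mulrA -exprS expr_div_n -mulrA divfK ?gt_eqF//.
have q : 0 <= th / r < 1.
  by rewrite divr_ge0 ?(ltW th0) ?(ltW r0)//= ltr_pdivrMr// mul1r.
by have := le0_geometric q main; rewrite leNgt d0.
Qed.

Lemma bessel_integral_necessary {R : realType} (alpha beta gamma : R) :
  -1 < alpha -> -1 < gamma -> beta < alpha + 1 ->
  (forall x : R, 0 < x -> 0 <= bessel_integral alpha beta gamma x) ->
  - (gamma + 1 / 2) <= beta /\ - alpha - 1 < beta < alpha + 1.
Proof.
move=> a1 g1 ba h; pose a := (alpha - beta + 1) / 2.
have a0 : 0 < a by rewrite /a; lra.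
have b0 : 0 < alpha + 1 by lra.
have ac : a < a + gamma + 1 by lra.
have f0 y : 0 < y -> 0 <= hyp1F2 a (alpha + 1) (a + gamma + 1) y.
  move=> y0; have x0 : 0 < 2 * Num.sqrt y by rewrite mulr_gt0// sqrtr_gt0.
  have [K K0 e] := bessel_integral_sign a1 g1 ba x0.
  have := h _ x0; rewrite e pmulr_rge0// exprMn sqr_sqrtr ?(ltW y0)//.
  by rewrite (_ : 2 ^+ 2 * y / 4 = y)//; field.
have := hyp1F2_ge0_lt a0 b0 ac f0; have := hyp1F2_ge0_sum a0 b0 ac f0.
by rewrite /a => h1 h2; split; [|apply/andP; split]; lra.
Qed.

Theorem theorem6p1 (R : realType) :
  (forall alpha beta gamma : R,
     -1 < alpha -> -1 < gamma -> beta < alpha + 1 ->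
     (forall x : R, 0 < x -> 0 <= bessel_integral alpha beta gamma x) ->
     - (gamma + 1 / 2) <= beta /\ - alpha - 1 < beta < alpha + 1)
  /\
  (forall gamma : R, -1 < gamma ->
     forall alpha beta : R, Sstar gamma (alpha, beta) ->
       (forall x : R, 0 < x -> 0 <= bessel_integral alpha beta gamma x) /\
       (~ ((alpha = gamma + 1 / 2 /\ beta = - (gamma + 1 / 2)) \/
           (gamma = - (1 / 2) /\ beta = 0)) ->
        forall x : R, 0 < x -> 0 < bessel_integral alpha beta gamma x)).
Proof.
split=> [alpha beta gamma a1 g1 ba h|gamma g1 alpha beta hS].
  exact: bessel_integral_necessary.
exact: Sstar_positive.
Qed.
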